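(* Let $X_1,\dots,X_n$ be $n$ independent copies of a random vector $X\in\mathbb{R}^d$. Assume that for some known constant $\kappa$, $\sup\{\mathbb{E}(\langle\theta,X\rangle^4):\theta\in\mathbb{R}^d,\ \mathbb{E}(\langle\theta,X\rangle^2)\le1\}\le\kappa<\infty$. Let $\epsilon>0$ be any confidence parameter and let the sample size $n$ be such that $$n>\Biggl[20\sqrt{\kappa d}+\Bigl(\frac52+\frac1{2(\kappa-1)}\Bigr)\sqrt{2(\kappa-1)\bigl[\log(\epsilon^{-1})+0.73\,d\bigr]}\Biggr]^2 .$$ Consider some exponents $p\in[1,2]$ and $q\in[1,2]$ and the bound $$\widetilde\gamma_+=\frac1{p+1}\Bigl(\frac{2[\log(\epsilon^{-1})+0.73\,d]}{(\kappa-1)n}\Bigr)^{p/2}(1+\widehat\delta)^{p+1}\Biggl[\mathbb{E}\bigl(\|G^{-1/2}X\|^{2(p+1)}\bigr)+\frac{C_q\,\mathbb{E}\bigl(\|G^{-1/2}X\|^{2q(p+1)}\bigr)^{1/q}}{\epsilon^{1/q}n^{1-1/q}}\Biggr].$$ With probability at least $1-4\epsilon$, for any $\theta\in\mathbb{R}^d$, $$-\frac{\widehat\delta+\gamma_-}{1+\widehat\delta}\le\frac{\overline N(\theta)}{N(\theta)}-1\le\frac1{(1-\widehat\delta)(1-\widetilde\gamma_+)_+}-1\le\frac{\widehat\delta+\widetilde\gamma_+}{(1-\widehat\delta)(1-\widetilde\gamma_+)_+},$$ where $$\frac{\widehat\delta+\gamma_-}{1+\widehat\delta}=\mathbf{O}(\widehat\delta),\qquad\frac{\widehat\delta+\widetilde\gamma_+}{(1-\widehat\delta)(1-\widetilde\gamma_+)_+}=\mathbf{O}_{n\to\infty}(\widehat\delta)\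 \text{ when }p>1,\qquad\widehat\delta=\mathbf{O}\Biggl(\sqrt{\frac{\kappa[d+\log(\epsilon^{-1})]}{n}}\Biggr).$$
   Context: $N(\theta)=\mathbb{E}(\langle\theta,X\rangle^2)$, $\overline N(\theta)=\frac1n\sum_{i=1}^n\langle\theta,X_i\rangle^2$, $G=\mathbb{E}(XX^\top)$, $G^{-1/2}$ is the symmetric square root of the pseudo-inverse of $G$, $(z)_+=\max\{z,0\}$. $\mu=\sqrt{\frac{2(\kappa-1)}{n}[\log(\epsilon^{-1})+0.73\,d]}+6.81\sqrt{\frac{2\kappa d}{n}}$, $\widehat\delta=\frac{\mu}{1-2\mu}$, $\gamma_-=\frac{2[\log(\epsilon^{-1})+0.73\,d]}{3(\kappa-1)n}$. $C_q=\dfrac{q^{q-1}}{2(q-1)^{q-1}(1-q/2)^{(2-q)/q}}\le1.4$ for $q\in(1,2)$, with $C_1=C_2=1$ by convention (limits). Convention: $0/0=1$ and $z/0=+\infty$ for $z>0$. $A=\mathbf{O}(B)$ means that there is a numerical constant $c$ such that $A\le cB$; $A=\mathbf{O}_{n\to\infty}(B)$ means that there is a numerical constant $c$ such that $\limsup_{n\to\infty}A/B\le c$.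
   Formalization: Upper bounds are stated only for δ̂≤1 (false beyond); in the first O the constant depends on κ₀>1 where κ≥κ₀; the n→∞ claim assumes E‖G^{-1/2}X‖^{2q(p+1)}<∞; the O-claims assume log(1/ε)+0.73d≥0; κ>1 and E‖X‖²<∞ are assumed. *)

(* Defs.v *)
From HB Require Import structures.
From mathcomp Require Import all_boot all_order all_algebra.
From mathcomp Require Import spectral.
From mathcomp.real_closed Require Import complex.
From mathcomp Require Import all_classical all_reals all_analysis.

Set Implicit Arguments.
Unset Strict Implicit.
Unset Printing Implicit Defensive.

Import Order.TTheory GRing.Theory Num.Theory.

Local Open Scope classical_set_scope.
Local Open Scope ring_scope.

(* Division with the convention 0 / 0 = 1.  The division of [\bar R] already
   satisfies z / 0 = +oo for z > 0, but has 0 / 0 = 0. *)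
Definition quot (R : realType) (x y : \bar R) : \bar R :=
  (if (x == 0) && (y == 0) then 1 else x / y)%E.

Section linear_algebra.
Context (R : realType) (d : nat).
Implicit Types (G H S : 'M[R]_d) (u v : 'cV[R]_d).

Definition dotp u v : R := \sum_(j < d) u j 0 * v j 0.

(* The norm [`|v|] that MathComp-Analysis puts on matrices is the sup norm. *)
Definition enorm v : R := Num.sqrt (dotp v v).

Definition psd S : Prop := S^T = S /\ forall v, 0 <= dotp v (S *m v).

(* Penrose's equations; [pinvmx] is only a one-sided partial inverse. *)
Definition is_pseudo_inverse G H : Prop :=
  [/\ G *m H *m G = G, H *m G *m H = H,
      (G *m H)^T = G *m H & (H *m G)^T = H *m G].

(* G^{-1/2}: the symmetric positive semi-definite square root of the
   pseudo-inverse of G; it exists for psd G by [pinv_sqrtP] below. *)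
Definition pinv_sqrt G : 'M[R]_d :=
  xget 0 [set S | psd S /\ is_pseudo_inverse G (S *m S)].

Lemma dotpE u v : dotp u v = (u^T *m v) 0 0.
Proof. by rewrite mxE; apply: eq_bigr => j _; rewrite mxE. Qed.

Lemma dotpvv_ge0 v : 0 <= dotp v v.
Proof. by apply: sumr_ge0 => j _; rewrite -expr2 sqr_ge0. Qed.

End linear_algebra.

Lemma interpolation (F : fieldType) (s : seq F) (f : F -> F) :
  exists q : {poly F}, {in s, forall x, q.[x] = f x}.
Proof.
elim: s => [|x s [q qE]]; first by exists 0.
have [xs|xs] := boolP (x \in s).
  by exists q => y; rewrite inE => /predU1P[->|/qE//]; exact: qE.
pose w := \prod_(a <- s) ('X - a%:P).
have w0 : w.[x] != 0 by rewrite -[_ == 0]/(root w x) root_prod_XsubC.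
exists (q + ((f x - q.[x]) / w.[x]) *: w) => y; rewrite inE !hornerE.
case/predU1P => [->|ys]; first by rewrite divfK// addrC subrK.
have /eqP -> : root w y by rewrite root_prod_XsubC.
by rewrite mulr0 addr0 qE.
Qed.

Lemma sym_spectrum (R : realType) (n : nat) (G : 'M[R]_n.+1) : G^T = G ->
  exists2 s : seq R, {in s, forall a, eigenvalue G a} &
    forall p, {in s, forall a, p.[a] = 0} -> horner_mx G p = 0.
Proof.
move=> GT.
pose f : R -> R[i] := real_complex R.
pose A := map_mx f G.
have Ah : A \is hermsymmx.
  apply: realsym_hermsym; last first.
    by apply/mxOverP => i j; rewrite mxE; apply/complex_realP; exists (G i j).
  apply/is_hermitianmxP; rewrite expr0 scale1r map_mx_id//.
  by rewrite /A map_trmx GT.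
have /orthomx_spectralP AE := hermitian_normalmx Ah.
set P := spectralmx A in AE; set D := spectral_diag A in AE.
have Pu : P \in unitmx by exact: spectral_unit.
have Dreal i : exists x, D 0 i == f x.
  have /mxOverP/(_ 0 i) := hermitian_spectral_diag_real Ah.
  by move=> /complex_realP[x xE]; exists x; apply/eqP.
pose l i := xchoose (Dreal i).
have lE i : D 0 i = f (l i) by exact/eqP/(xchooseP (Dreal i)).
exists [seq l i | i <- enum 'I_n.+1].
  move=> _ /mapP[i _ ->].
  rewrite -(eigenvalue_map f) -/A; apply/eigenvalueP; exists (row i P).
    rewrite -[RHS]/(f (l i) *: row i P) -lE -row_mul AE !mulmxA mulmxV// mul1mx.
    by apply/rowP => j; rewrite mul_diag_mx !mxE.
  apply: contraTneq Pu => Pi0; rewrite -row_free_unit -kermx_eq0.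
  apply/negP => /eqP k0; have : delta_mx 0 i *m P = 0 :> 'rV_n.+1.
    by rewrite -rowE.
  move/sub_kermxP; rewrite k0 submx0 => /eqP/matrixP/(_ 0 i).
  by rewrite !mxE !eqxx => /eqP; rewrite oner_eq0.
move=> p p0; apply: (map_mx_inj (f := f)).
rewrite map_horner_mx -/A map_mx0.
have -> : horner_mx A (map_poly f p) =
    invmx P *m horner_mx (diag_mx D) (map_poly f p) *m P.
  elim/poly_ind: (map_poly f p) => [|q c IH].
    by rewrite !rmorph0 mulmx0 mul0mx.
  rewrite !rmorphD !rmorphM /= !horner_mx_X !horner_mx_C IH {1}AE.
  rewrite mulmxDr mulmxDl; congr (_ + _).
    by rewrite -!mulmxE !mulmxA mulmxK.
  by rewrite -[RHS]mulmxA mul_scalar_mx -scalemxAr mulVmx// scalemx1.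
rewrite horner_mx_diag (_ : map_mx _ D = 0).
  by rewrite raddf0 mulmx0 mul0mx.
apply/rowP => i; rewrite !mxE lE horner_map p0 ?rmorph0//.
by apply/mapP; exists i; rewrite ?mem_enum.
Qed.

Lemma pinv_sqrtP (R : realType) (d : nat) (G : 'M[R]_d) : psd G ->
  psd (pinv_sqrt G) /\ is_pseudo_inverse G (pinv_sqrt G *m pinv_sqrt G).
Proof.
move=> [GT G0]; rewrite /pinv_sqrt.
apply: (xgetPex 0 (P := [set S | psd S /\ is_pseudo_inverse G (S *m S)])).
case: d => [|n] in G GT G0 *.
  exists 0; split; first split.
  - by rewrite trmx0.
  - by move=> v; rewrite /dotp big_ord0.
  - by split; apply/matrixP; case.
have [s sG s0] := sym_spectrum GT.
have symh p : (horner_mx G p)^T = horner_mx G p.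
  elim/poly_ind: p => [|q c IH]; first by rewrite rmorph0 trmx0.
  rewrite rmorphD rmorphM /= horner_mx_X horner_mx_C linearD/= tr_scalar_mx.
  rewrite -mulmxE trmx_mul IH GT; congr (_ + _).
  by apply/esym/comm_horner_mx.
have s_ge0 a : a \in s -> 0 <= a.
  move=> /sG /eigenvalueP[v vG v0].
  have := G0 v^T; rewrite dotpE trmxK mulmxA vG -scalemxAl mxE.
  rewrite -[v *m _]/(v *m v^T) -{1}[v]trmxK -dotpE pmulr_lge0//.
  rewrite lt_neqAle dotpvv_ge0 andbT eq_sym; apply: contra v0.
  rewrite /dotp psumr_eq0; last by move=> j _; rewrite -expr2 sqr_ge0.
  move=> /allP v0; apply/eqP/rowP => j; have := v0 j (mem_index_enum j).
  by rewrite !mxE mulf_eq0 orbb => /eqP.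
have [r rE] := interpolation s (fun x => Num.sqrt (Num.sqrt x)^-1).
have hmul p q : horner_mx G p *m horner_mx G q = horner_mx G (p * q).
  by rewrite rmorphM.
have heq p q : {in s, forall a, p.[a] = q.[a]} ->
    horner_mx G p = horner_mx G q.
  move=> pq; apply/eqP; rewrite -subr_eq0 -rmorphB; apply/eqP/s0 => a /pq e.
  by rewrite !hornerE e subrr.
have r4 a : a \in s -> r.[a] * r.[a] * (r.[a] * r.[a]) = a^-1.
  move=> sa; have a0 := s_ge0 _ sa.
  have -> : r.[a] * r.[a] = (Num.sqrt a)^-1.
    by rewrite rE// -expr2 sqr_sqrtr// invr_ge0 sqrtr_ge0.
  by rewrite -invfM -expr2 sqr_sqrtr.
exists (horner_mx G (r * r)); split; first split.
- exact: symh.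
- move=> v; rewrite dotpE -hmul -[X in X *m horner_mx G r]symh !mulmxA.
  by rewrite -trmx_mul -mulmxA -dotpE dotpvv_ge0.
- rewrite hmul; set t := r * r * (r * r).
  suff : is_pseudo_inverse (horner_mx G 'X) (horner_mx G t).
    by rewrite horner_mx_X.
  rewrite /t; split; rewrite !hmul.
  + apply: heq => a sa.
    rewrite !hornerM ?hornerX r4//; have [->|a0] := eqVneq a 0; first by rewrite !mulr0.
    by rewrite divff// mul1r.
  + apply: heq => a sa; rewrite !hornerM ?hornerX r4//.
    have [->|a0] := eqVneq a 0; first by rewrite invr0 !mul0r.
    by rewrite mulVf// mul1r.
  + exact: symh.
  + exact: symh.
Qed.

Section explicit_constants.
Context (R : realType) (kappa eps : R) (d n : nat).

Definition conf : R := ln eps^-1 + 73 / 100 * d%:R.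

Definition mu : R :=
  Num.sqrt (2 * (kappa - 1) / n%:R * conf)
  + 681 / 100 * Num.sqrt (2 * kappa * d%:R / n%:R).

Definition delta_hat : R := mu / (1 - 2 * mu).

Definition gamma_minus : R := 2 * conf / (3 * (kappa - 1) * n%:R).

Definition sample_threshold : R :=
  (20 * Num.sqrt (kappa * d%:R)
   + (5 / 2 + 1 / (2 * (kappa - 1)))
     * Num.sqrt (2 * (kappa - 1) * conf)) ^+ 2.

(* The values at q = 1 and q = 2 are the limits of the general formula. *)
Definition Cq (q : R) : R :=
  if (q == 1) || (q == 2) then 1
  else q `^ (q - 1)
       / (2 * (q - 1) `^ (q - 1) * (1 - q / 2) `^ ((2 - q) / q)).

End explicit_constants.

Section random_vectors.
Context (R : realType) (d : nat).

(* Random vectors take values in [d.-tuple R], which carries the product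
   sigma-algebra; [colv] moves to column vectors for the linear algebra. *)
Definition colv (x : d.-tuple R) : 'cV[R]_d := \col_j tnth x j.

Section one_vector.
Context (disp : measure_display) (T : measurableType disp).
Context (P : probability T R) (X : T -> d.-tuple R).

Definition quadN (theta : 'cV[R]_d) : \bar R :=
  ('E_P[fun w => (dotp theta (colv (X w)) ^+ 2)%R])%E.

(* The entries are finite expectations when E(|X|^2) < +oo. *)
Definition gram : 'M[R]_d :=
  \matrix_(j, k) fine ('E_P[fun w => (tnth (X w) j * tnth (X w) k)%R])%E.

(* E(|G^{-1/2} X|^r) *)
Definition whitened_moment (r : R) : \bar R :=
  ('E_P[fun w => (enorm (pinv_sqrt gram *m colv (X w)) `^ r)%R])%E.

Definition fourth_moment_bound (kappa : R) : Prop :=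
  (ereal_sup [set 'E_P[fun w => (dotp theta (colv (X w)) ^+ 4)%R]
             | theta in [set theta | quadN theta <= 1]] <= kappa%:E)%E.

Definition gamma_plus (kappa eps p q : R) (n : nat) : \bar R :=
  (((p + 1)^-1
    * (2 * conf eps d / ((kappa - 1) * n%:R)) `^ (p / 2)
    * (1 + delta_hat kappa eps d n) `^ (p + 1))%:E
   * (whitened_moment (2 * (p + 1))
      + (Cq q / (eps `^ q^-1 * n%:R `^ (1 - q^-1)))%:E
        * whitened_moment (2 * q * (p + 1)) `^ q^-1))%E.

(* (1 - delta) (1 - gamma)_+ *)
Definition upper_denom (kappa eps p q : R) (n : nat) : \bar R :=
  ((1 - delta_hat kappa eps d n)%:E
   * maxe (1 - gamma_plus kappa eps p q n) 0)%E.

(* (delta + gamma) / ((1 - delta) (1 - gamma)_+) *)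
Definition upper_bound (kappa eps p q : R) (n : nat) : \bar R :=
  quot ((delta_hat kappa eps d n)%:E + gamma_plus kappa eps p q n)
       (upper_denom kappa eps p q n).

End one_vector.

Section sample.
Context (n : nat) (disp : measure_display) (T : measurableType disp).
Context (P : probability T R) (Xs : 'I_n -> {RV P >-> d.-tuple R}).

Definition empN (theta : 'cV[R]_d) (w : T) : R :=
  n%:R^-1 * \sum_(i < n) dotp theta (colv (Xs i w)) ^+ 2.

Definition mutually_independent : Prop :=
  forall (J : {set 'I_n}) (B : 'I_n -> set (d.-tuple R)),
    (forall i, measurable (B i)) ->
    P (\bigcap_(i in [set` J]) (Xs i @^-1` B i))
    = (\prod_(i in J) P (Xs i @^-1` B i))%E.

Definition independent_copies (disp0 : measure_display)
    (T0 : measurableType disp0) (P0 : probability T0 R)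
    (X : {RV P0 >-> d.-tuple R}) : Prop :=
  mutually_independent /\
  forall i (B : set (d.-tuple R)), measurable B ->
    distribution P (Xs i) B = distribution P0 X B.

End sample.
End random_vectors.

(* Main.v *)
Require Import Defs.
From HB Require Import structures.
From mathcomp Require Import all_boot all_order all_algebra.
From mathcomp Require Import ring lra.
From mathcomp Require Import all_classical all_reals all_analysis.
From mathcomp Require Import measurable_realfun.

Set Implicit Arguments.
Unset Strict Implicit.
Unset Printing Implicit Defensive.

Import Order.TTheory GRing.Theory Num.Theory.
Import numFieldNormedType.Exports.

Local Open Scope classical_set_scope.
Local Open Scope ring_scope.

(** Why the theorem holds.  Write [Y = G^{-1/2} X].  Almost surely [X] lies in
the range of [G], and there the ratio of [empN theta] to [N theta] is the
empirical second moment [rho u] of [<u, Y>] for a unit vector [u] of that range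
([quot_normalized]); both moments vanish together when [N theta = 0].  So
[rho u] must be controlled for all unit [u] at once.

Heavy tails are tamed by the truncated logarithm
[psi z = min (ln (1 + z + z^2 / 2)) (ln 2)], which satisfies
[z - max z 0 ^ (p + 1) / (p + 1) <= psi z] for [p] in [[1, 2]]
([log_trunc_ge]).  With [lam = sqrt (2 conf / ((kappa - 1) n))] and for either
sign, outside an event of probability [eps] one has
[sum_i psi (+- (m <u, Y_i>^2 - lam)) <= 0] for all unit [u], where
[m = lam (1 -+ delta)].  The lower bound on [psi] turns these two inequalities
into a lower bound on [rho u] with loss [lam^2 / 3 = gamma_minus] (for
[p = 2], the argument of [psi] being at most [lam]: [empirical_lower]) and an
upper bound with loss proportional to the empirical mean of
[|Y_i|^{2 (p + 1)}] ([empirical_upper]).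

Uniformity in [u] comes from a variational argument
([uniform_log_trunc_bound]).  The vector [sqrt m u] is rounded at random,
without bias, to a point of a grid of mesh [h] ([random_rounding]).  Using two
independent roundings [g] and [g'], the product [<g, Y> <g', Y>] is an unbiased
estimate of [m <u, Y>^2].  The logarithm of a suitably enlarged quadratic
exponential [softened] of that product averages to at least [psi]
([log_trunc_le_avg]), while the average of [softened] itself is barely larger
than the quadratic exponential of [m <u, Y>^2 - lam] ([avg_softened_le]).  The
grid is finite, so Markov's inequality and a union bound with weights
[exp (- k^2 - 3 / 2)] per coordinate control all grid points simultaneously
([log_moment_union_bound]); averaging over the rounding law then costs only
the mean of [k^2 + 3 / 2].  The fourth moment hypothesis bounds the expectations
that appear, and the lower bound on [n] makes the resulting right-hand side
nonpositive ([deviation_rhs_lower], [deviation_rhs_upper]).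

The empirical mean of [|Y_i|^{2 (p + 1)}] has [q] moments.  Truncating each
term at [(n M / eps)^{1 / q}], [M] being the [q]-th moment, loses probability
[eps], and Chebyshev's inequality for the truncated sum another [eps]
([empirical_mean_deviation]); this gives the stated bound with constant [1],
and [1 <= C_q].  The total is [4 eps].

The orders of magnitude rest on the threshold alone: it keeps [1 - 2 mu] above
[1 / 40] and [(kappa - 1) lam] below [delta].  When [p > 1],
[gamma_plus = O (lam ^ p)] is eventually smaller than [delta]. *)

(** * The truncated logarithm *)

Section truncated_log.
Context {R : realType}.
Implicit Types x z t : R.

Lemma ln_ge1BV x : 0 < x -> 1 - x^-1 <= ln x.
Proof.
move=> x0; have : ln (1 + (x^-1 - 1)) <= x^-1 - 1.
  by apply: le_ln1Dx; rewrite ltrBrDl subrr invr_gt0.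
rewrite addrC subrK lnV ?posrE//; lra.
Qed.

(** Needed for [log_trunc_ge] at [p = 2], where [p / (p + 1) = 2 / 3]. *)
Lemma ln2_ge : 2 / 3 <= ln 2 :> R.
Proof.
(* The bound ln x >= 1 - 1/x is sharp near 1: it is applied to r = 2^(1/16). *)
pose r : R := iter 4 Num.sqrt 2.
have r0 : 0 < r by rewrite /r /= !sqrtr_gt0.
have r16 : r ^+ 16 = 2.
  rewrite (exprM r 2 8) sqr_sqrtr ?sqrtr_ge0// (exprM _ 2 4) sqr_sqrtr ?sqrtr_ge0//.
  by rewrite (exprM _ 2 2) sqr_sqrtr ?sqrtr_ge0// sqr_sqrtr.
have -> : ln 2 = ln r *+ 16 by rewrite -lnXn// r16.
have := ln_ge1BV r0.
have rb : 261 / 250 <= r.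
  have h : 0 <= 261 / 250 :> R by lra.
  have : (261 / 250) ^+ 16 <= r ^+ 16 by rewrite r16; lra.
  by rewrite ler_pXn2r ?nnegrE// ltW.
have : r^-1 <= 250 / 261.
  by rewrite -[250 / 261]invrK lef_pV2 ?posrE ?invr_gt0//; lra.
rewrite -mulr_natl; lra.
Qed.

(** The influence function: it agrees with [z] to second order at [0] and is
bounded above, so that one heavy-tailed observation has a bounded effect. *)
Definition log_trunc z : R := Num.min (ln (1 + z + z ^+ 2 / 2)) (ln 2).

Lemma quad_ge z : 1 / 2 <= 1 + z + z ^+ 2 / 2.
Proof. by have := sqr_ge0 (z + 1); rewrite expr2 expr2; lra. Qed.

Lemma quad_gt0 z : 0 < 1 + z + z ^+ 2 / 2.
Proof. by apply: lt_le_trans (quad_ge z). Qed.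

(** [ln (1 + t + t^2 / 2)] has derivative
[1 - t^2 / (2 (1 + t + t^2 / 2))]; the parameter [k] is the cubic correction
that makes the remaining derivative nonnegative ([k = 1]) or nonpositive
([k = 0]). *)
Lemma is_derive_ln_quad k z : is_derive z (1 : R)
  (fun t => ln (1 + t + t ^+ 2 / 2) - t + k * t ^+ 3 / 3)
  (z ^+ 2 * (k - (2 * (1 + z + z ^+ 2 / 2))^-1)).
Proof.
have q0 := quad_gt0 z.
have dq : is_derive z (1 : R) (fun t => 1 + t + t ^+ 2 / 2) (1 + z).
  by apply: is_derive_eq; rewrite /GRing.scale/=; field.
have dl : is_derive z (1 : R) (@ln R \o (fun t => 1 + t + t ^+ 2 / 2))
    (((1 + z + z ^+ 2 / 2)^-1) * (1 + z)).
  exact: (@is_derive1_comp R (@ln R) _ z _ _ (is_derive1_ln q0) dq).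
have d3 : is_derive z (1 : R) (fun t => k * t ^+ 3 / 3) (k * z ^+ 2).
  by apply: is_derive_eq; rewrite /GRing.scale/=; field.
have := is_deriveD (is_deriveB dl (is_derive_id z (1 : R))) d3.
have -> : (1 + z + z ^+ 2 / 2)^-1 * (1 + z) - 1 + k * z ^+ 2 =
    z ^+ 2 * (k - (2 * (1 + z + z ^+ 2 / 2))^-1) => //.
by field; rewrite gt_eqF//; have := quad_gt0 z; lra.
Qed.

Lemma ln_quad_MVT (k a b : R) : a <= b -> exists c,
  ln (1 + b + b ^+ 2 / 2) - b + k * b ^+ 3 / 3
  - (ln (1 + a + a ^+ 2 / 2) - a + k * a ^+ 3 / 3)
  = c ^+ 2 * (k - (2 * (1 + c + c ^+ 2 / 2))^-1) * (b - a).
Proof.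
move=> ab.
have df (x : R) := is_derive_ln_quad k x.
have [|c _ H] := @MVT_segment R _ _ a b ab (fun x _ => df x); last by exists c.
apply: continuous_subspaceT => x.
by apply/differentiable_continuous/derivable1_diffP; have [] := df x.
Qed.

Let ln_quad0 k : ln (1 + 0 + 0 ^+ 2 / 2) - 0 + k * 0 ^+ 3 / 3 = 0 :> R.
Proof. by rewrite !expr0n/= mulr0 !mul0r !addr0 subr0 ln1. Qed.

Lemma ln_quad_ge_npos z : z <= 0 -> z <= ln (1 + z + z ^+ 2 / 2).
Proof.
move=> z0; have [c] := ln_quad_MVT 0 z0.
rewrite ln_quad0 !mul0r !sub0r addr0.
have : c ^+ 2 * - (2 * (1 + c + c ^+ 2 / 2))^-1 * - z <= 0.
  rewrite !mulrN mulNr opprK mulr_ge0_le0// mulr_ge0 ?sqr_ge0//.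
  by rewrite invr_ge0 mulr_ge0// ltW// quad_gt0.
lra.
Qed.

Lemma ln_quad_ge_nneg z : 0 <= z -> z - z ^+ 3 / 3 <= ln (1 + z + z ^+ 2 / 2).
Proof.
move=> z0; have [c] := ln_quad_MVT 1 z0.
rewrite ln_quad0 !subr0 mul1r.
have : 0 <= c ^+ 2 * (1 - (2 * (1 + c + c ^+ 2 / 2))^-1) * z.
  rewrite mulr_ge0// mulr_ge0 ?sqr_ge0// subr_ge0 invf_le1.
    by have := quad_ge c; lra.
  by have := quad_ge c; lra.
lra.
Qed.

(** Young's inequality for [z * 1] with exponents [p + 1] and [(p + 1) / p]
bounds the left side by [p / (p + 1) <= 2 / 3]. *)
Lemma subr_powR_le p z : 1 <= p <= 2 -> 0 <= z -> z - z `^ (p + 1) / (p + 1) <= ln 2.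
Proof.
move=> /andP[p1 p2] z0; apply: le_trans ln2_ge.
have r0 : 0 < p + 1 by lra.
have q0 : 0 < (p + 1) / p by rewrite divr_gt0//; lra.
have pq : (p + 1)^-1 + ((p + 1) / p)^-1 = 1.
  by field; apply/andP; split; rewrite gt_eqF//; lra.
have := conjugate_powR z0 ler01 r0 q0 pq.
rewrite mulr1 powR1 mul1r => H.
have : (3 : R)^-1 <= (p + 1)^-1 by rewrite lef_pV2 ?posrE//; lra.
lra.
Qed.

(** For [0 < z <= 1] the remainder [z^3 / 3] of the cubic lower bound of
[ln (1 + z + z^2 / 2)] is at most [z ^ (p + 1) / (p + 1)].  Young's inequality
bounds the left side by [ln 2]; this settles the other branch of the minimum and,
when [z > 1], both branches. *)
Lemma log_trunc_ge p z : 1 <= p <= 2 ->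
  z - Num.max z 0 `^ (p + 1) / (p + 1) <= log_trunc z.
Proof.
move=> p12; have /andP[p1 p2] := p12.
rewrite /log_trunc le_min; have [z0|z0] := leP z 0.
  rewrite powR0 ?mul0r ?subr0; last by rewrite gt_eqF//; lra.
  by rewrite ln_quad_ge_npos//= (le_trans z0)// (le_trans _ ln2_ge)//; lra.
apply/andP; split; last exact: subr_powR_le p12 (ltW z0).
have [z1|z1] := leP z 1; last first.
  apply: le_trans (subr_powR_le p12 (ltW z0)) _.
  rewrite ler_ln ?posrE ?quad_gt0//.
  have : 1 <= z ^+ 2 by rewrite expr_ge1 // ltW.
  lra.
apply: le_trans (ln_quad_ge_nneg (ltW z0)).
rewrite lerB// ler_pdivlMr; last lra.
rewrite mulrAC ler_pdivrMr; last lra.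
have z3 : z ^+ 3 <= z `^ (p + 1).
  rewrite -(powR_mulrn _ (ltW z0)); apply: ger_powR; last lra.
  by rewrite z0.
have : 0 <= z ^+ 3 by rewrite exprn_ge0 ?ltW.
nra.
Qed.

(** A reverse Jensen inequality in pointwise form: when [t] is centred, averaging
loses only [A / e] times the variance of [t] in the logarithm of a quadratic
bounded below by [e] (the condition on [p ^+ 2] says that the discriminant
of the quadratic minus [e] is nonpositive).  It follows from
[ln x >= 1 - x^-1] applied to the ratio of the quadratic to [q]. *)
Lemma ln_quadratic_ge (A e p q t : R) : 0 <= A -> 0 < e -> e <= q ->
  p ^+ 2 <= 4 * A * (q - e) ->
  ln q + p / q * t - A / e * t ^+ 2 <= ln (q + p * t + A * t ^+ 2).
Proof.
move=> A0 e0 eq pA.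
have q0 : 0 < q by lra.
set y := q + p * t + A * t ^+ 2.
have [A00|Ap] := eqVneq A 0.
  have p0 : p = 0.
    apply/eqP; rewrite -sqrf_eq0; apply/eqP/le_anti; rewrite sqr_ge0 andbT.
    by apply: le_trans pA _; rewrite A00 mulr0 mul0r.
  by rewrite /y A00 p0 !mul0r !addr0 subr0.
have {A0 Ap}A0 : 0 < A by rewrite lt_neqAle eq_sym Ap.
have yE : 4 * A * (y - e) = (2 * A * t + p) ^+ 2 + (4 * A * (q - e) - p ^+ 2).
  by rewrite /y; ring.
have ey : e <= y.
  have : 0 <= 4 * A * (y - e).
    by rewrite yE addr_ge0 ?sqr_ge0 ?subr_ge0.
  by rewrite pmulr_rge0 ?subr_ge0// mulr_gt0.
have y0 : 0 < y by lra.
have : 1 - (y / q)^-1 <= ln (y / q) by apply: ln_ge1BV; rewrite divr_gt0.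
rewrite ln_div ?posrE// invf_div => H.
suff : p / q * t - A / e * t ^+ 2 <= 1 - q / y by lra.
rewrite -subr_ge0.
have -> : 1 - q / y - (p / q * t - A / e * t ^+ 2) =
   t ^+ 2 * (A * (q * y) / e + A * q - p ^+ 2 - p * A * t) / (q * y).
  by rewrite /y; field; rewrite -/y !gt_eqF.
apply: divr_ge0; last by rewrite mulr_ge0// ltW.
apply: mulr_ge0; first exact: sqr_ge0.
rewrite -(pmulr_rge0 _ e0).
have -> : e * (A * (q * y) / e + A * q - p ^+ 2 - p * A * t) =
   A * (q * y) + e * A * q - e * p ^+ 2 - e * p * A * t.
  by field; rewrite gt_eqF.
(* Replacing [p ^+ 2] with its upper bound leaves a factor [A]. *)
suff : 0 <= A * (q * y + e * q - 4 * e * (q - e) - e * p * t).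
  have := ler_wpM2l (ltW e0) pA.
  by move=> h1 h2; nra.
rewrite pmulr_rge0//.
have -> : q * y + e * q - 4 * e * (q - e) - e * p * t =
  (q ^+ 2 - 3 * e * q + 4 * e ^+ 2) + (q - e) * (p * t) + q * A * t ^+ 2.
  by rewrite /y; ring.
(* Completing the square in [t]. *)
have qA : 0 < 4 * (q * A) by rewrite !mulr_gt0.
rewrite -(pmulr_rge0 _ qA).
have -> : 4 * (q * A) * (q ^+ 2 - 3 * e * q + 4 * e ^+ 2 + (q - e) * (p * t) + q * A * t ^+ 2) =
  (2 * q * A * t + (q - e) * p) ^+ 2 +
  ((q - e) ^+ 2 * (4 * A * (q - e) - p ^+ 2) + 4 * A * (e ^+ 2 * q + e ^+ 3)).
  by ring.
rewrite addr_ge0 ?sqr_ge0// addr_ge0//.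
  by rewrite mulr_ge0 ?sqr_ge0// subr_ge0.
have e0' := ltW e0; have q0' := ltW q0; have A0' := ltW A0.
by rewrite !mulr_ge0// addr_ge0// ?mulr_ge0 ?exprn_ge0.
Qed.

End truncated_log.

(** * Averages of the truncated logarithm over random perturbations *)

Section softened.
Context {R : realType}.
Implicit Types s sg lam a b : R.

(** The quadratic exponential of [sg * (a * b - lam)], where [a] and [b] stand
for two independent perturbations of the same number, so that [a * b] is an
unbiased estimate of its square.  With [s] a bound on their variances, the last
two terms compensate what the concavity of the logarithm costs in
[log_trunc_le_avg]. *)
Definition softened s sg lam a b : R :=
  let z := sg * (a * b - lam) in
  1 + z + z ^+ 2 / 2 + 4 * s * (a ^+ 2 + b ^+ 2) + 68 * s ^+ 2.

Lemma softened_sym s sg lam a b : softened s sg lam a b = softened s sg lam b a.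
Proof. by rewrite /softened [a * b]mulrC [a ^+ 2 + _]addrC. Qed.

Lemma softened_ge s sg lam a b : 0 <= s -> 1 / 2 <= softened s sg lam a b.
Proof.
move=> s_ge0; rewrite /softened; set z := sg * _; have := quad_ge z.
have : 0 <= 4 * s * (a ^+ 2 + b ^+ 2).
  by rewrite mulr_ge0 ?mulr_ge0// addr_ge0 ?sqr_ge0.
have : 0 <= 68 * s ^+ 2 by rewrite mulr_ge0// sqr_ge0.
lra.
Qed.

End softened.

Section random_perturbation.
Context {R : realType} {I : finType}.
Variables (w : I -> R) (y : I -> R) (tau s : R).
Hypothesis w_ge0 : forall k, 0 <= w k.
Hypothesis w_sum : \sum_k w k = 1.
Hypothesis y_mean : \sum_k w k * (y k - tau) = 0.
Hypothesis y_var : \sum_k w k * (y k - tau) ^+ 2 <= s.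

Let s_ge0 : 0 <= s.
Proof. by apply: le_trans y_var; apply: sumr_ge0 => k _; rewrite mulr_ge0 ?sqr_ge0. Qed.

Lemma avg_quadratic (a b c : R) :
  \sum_k w k * (a + b * (y k - tau) + c * (y k - tau) ^+ 2)
  = a + c * \sum_k w k * (y k - tau) ^+ 2.
Proof.
transitivity (a * \sum_k w k + b * \sum_k w k * (y k - tau)
              + c * \sum_k w k * (y k - tau) ^+ 2).
  by rewrite !mulr_sumr -!big_split; apply: eq_bigr => k _ /=; ring.
by rewrite w_sum y_mean mulr1 mulr0 addr0.
Qed.

(** The linear term of [ln_quadratic_ge] disappears in the mean. *)
Lemma avg_ln_quadratic_ge (A e p q : R) : 0 <= A -> 0 < e -> e <= q ->
  p ^+ 2 <= 4 * A * (q - e) ->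
  ln q - A / e * s
  <= \sum_k w k * ln (q + p * (y k - tau) + A * (y k - tau) ^+ 2).
Proof.
move=> A0 e0 eq pA.
apply: (@le_trans _ _ (\sum_k w k *
   (ln q + p / q * (y k - tau) + (- (A / e)) * (y k - tau) ^+ 2))).
  rewrite avg_quadratic mulNr lerB// ler_wpM2l// divr_ge0// ltW//.
apply: ler_sum => k _; apply: ler_wpM2l => //.
rewrite mulNr; exact: ln_quadratic_ge.
Qed.

Variables (sg lam : R).
Hypothesis sg2 : sg ^+ 2 = 1.

Local Notation W := (softened s sg lam).

(* The cost of averaging over the first factor when the second one is [b]. *)
Let loss (b : R) : R := (b ^+ 2 / 2 + 4 * s) / (1 / 2 + 4 * s * b ^+ 2 + 68 * s ^+ 2) * s.

Let loss_den b : 1 / 2 <= 1 / 2 + 4 * s * b ^+ 2 + 68 * s ^+ 2.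
Proof.
have : 0 <= 4 * s * b ^+ 2 by rewrite mulr_ge0 ?sqr_ge0 ?mulr_ge0.
have : 0 <= 68 * s ^+ 2 by rewrite mulr_ge0// sqr_ge0.
lra.
Qed.

Let loss_le b : loss b <= 1 / 8 /\ loss b <= s * b ^+ 2 + 8 * s ^+ 2.
Proof.
have := loss_den b; rewrite /loss; set D := (X in _ <= X) => D2.
have D0 : 0 < D by lra.
have sb : 0 <= s * b ^+ 2 by rewrite mulr_ge0 ?sqr_ge0.
have s2 : 0 <= s ^+ 2 by rewrite sqr_ge0.
rewrite mulrAC !ler_pdivrMr//; split; first by rewrite /D; nra.
have : (s * b ^+ 2 + 8 * s ^+ 2) * (1 / 2) <= (s * b ^+ 2 + 8 * s ^+ 2) * D.
  by rewrite ler_wpM2l// addr_ge0// mulr_ge0.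
nra.
Qed.

(* For fixed [b], [W] is a quadratic in the other factor, bounded below by [e]. *)
Let inner_ge b : ln (W tau b) - loss b <= \sum_k w k * ln (W (y k) b).
Proof.
pose g := sg * b; pose al := 1 - sg * lam; pose nu := 4 * s.
pose A := g ^+ 2 / 2 + nu.
pose p := g * (al + g * tau) + 2 * nu * tau.
pose e := 1 / 2 + 4 * s * b ^+ 2 + 68 * s ^+ 2.
have g2 : g ^+ 2 = b ^+ 2 by rewrite /g exprMn sg2 mul1r.
have nu0 : 0 <= nu by rewrite mulr_ge0.
have A0 : 0 <= A by rewrite addr_ge0// mulr_ge0// sqr_ge0.
have e0 : 0 < e by have := loss_den b; rewrite -/e; lra.
have qE : W tau b = (al + g * tau) ^+ 2 / 2 + nu * tau ^+ 2 + e.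
  by rewrite /softened /e /al /g /nu; field.
have eq : e <= W tau b.
  by rewrite qE lerDr addr_ge0// mulr_ge0// sqr_ge0.
have pA : p ^+ 2 <= 4 * A * (W tau b - e).
  have nal : 0 <= 2 * nu * al ^+ 2 by rewrite mulr_ge0 ?sqr_ge0 ?mulr_ge0.
  rewrite qE -subr_ge0; apply: le_trans nal _.
  by rewrite le_eqVlt; apply/predU1P; left; rewrite /A /p; field.
have := avg_ln_quadratic_ge A0 e0 eq pA.
rewrite /loss -g2 -/A -[1 / 2 + _ + _]/(1 / 2 + 4 * s * g ^+ 2 + 68 * s ^+ 2) g2 -/e.
move=> /le_trans; apply; apply: ler_sum => k _; apply: ler_wpM2l => //.
rewrite le_eqVlt; apply/predU1P; left; congr ln.
rewrite /A g2 /p /g /al /nu /softened.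
have -> : b ^+ 2 / 2 = sg ^+ 2 * b ^+ 2 / 2 by rewrite sg2 mul1r.
by field.
Qed.

Lemma avg_sqr_le : \sum_k w k * y k ^+ 2 <= tau ^+ 2 + s.
Proof.
have E k : y k ^+ 2 = tau ^+ 2 + 2 * tau * (y k - tau) + 1 * (y k - tau) ^+ 2.
  by ring.
under eq_bigr => k _ do rewrite E.
by rewrite avg_quadratic mul1r lerD2l.
Qed.

(** Averaging over one factor, then over the other, costs at most [x] in
total, by [inner_ge] twice and the symmetry of [softened].  The
coefficients of [softened] are chosen so that its correction terms are at least
[4 * x], and [c * expR x <= c + 4 * x] for [c <= 2]: this absorbs the loss where
the quadratic exponential is at most [2]; where it exceeds [2], only [ln 2] has
to be reached. *)
Lemma log_trunc_le_avg : log_trunc (sg * (tau ^+ 2 - lam))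
  <= \sum_l w l * \sum_k w k * ln (W (y k) (y l)).
Proof.
pose x := Num.min (1 / 4) (2 * s * tau ^+ 2 + 17 * s ^+ 2).
have st0 : 0 <= s * tau ^+ 2 by rewrite mulr_ge0 ?sqr_ge0.
have s20 : 0 <= s ^+ 2 by rewrite sqr_ge0.
have lossx : \sum_l w l * loss (y l) + loss tau <= x.
  have [l1 l2] := loss_le tau.
  have a1 : \sum_l w l * loss (y l) <= 1 / 8.
    rewrite -[1 / 8]mul1r -{1}w_sum mulr_suml; apply: ler_sum => l _.
    by apply: ler_wpM2l => //; by have [] := loss_le (y l).
  have a2 : \sum_l w l * loss (y l) <= s * (tau ^+ 2 + s) + 8 * s ^+ 2.
    apply: (@le_trans _ _ (s * (\sum_l w l * y l ^+ 2) + 8 * s ^+ 2 * \sum_l w l)).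
      rewrite !mulr_sumr -big_split/=; apply: ler_sum => l _.
      have [_ /(ler_wpM2l (w_ge0 l))] := loss_le (y l).
      by move=> /le_trans; apply; rewrite le_eqVlt; apply/predU1P; left; ring.
    by rewrite w_sum mulr1 lerD2r ler_wpM2l// avg_sqr_le.
  by rewrite le_min; apply/andP; split; [lra|nra].
have main : ln (W tau tau) - x
   <= \sum_l w l * \sum_k w k * ln (W (y k) (y l)).
  have := inner_ge tau.
  under eq_bigr => k _ do rewrite softened_sym.
  move=> H.
  apply: (@le_trans _ _ (\sum_l w l * (ln (W tau (y l)) - loss (y l)))).
    rewrite (_ : \sum_l _ = \sum_l w l * ln (W tau (y l)) - \sum_l w l * loss (y l)).
      lra.
    by rewrite -sumrB; apply: eq_bigr => l _; rewrite mulrBr.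
  by apply: ler_sum => l _; apply: ler_wpM2l.
apply: le_trans main; rewrite /softened -expr2; set z := sg * _.
have q0 := quad_gt0 z; set q := 1 + z + z ^+ 2 / 2 in q0 *.
have x0 : 0 <= x by rewrite le_min; apply/andP; split => //; nra.
have x4 : x <= 1 / 4 by rewrite /x ge_min lexx.
have xs : x <= 2 * s * tau ^+ 2 + 17 * s ^+ 2 by rewrite /x ge_min lexx orbT.
rewrite lerBrDr.
have ex : expR x <= 1 + 2 * x.
  have := expR_ge1Dx (- x); rewrite expRN => ex.
  have e0 := expR_gt0 x.
  have : (1 - x) * expR x <= 1.
    by have := ler_wpM2r (ltW e0) ex; rewrite mulVf ?gt_eqF// mulrDl mul1r.
  nra.
(* Used with [c] the quadratic exponential itself, or [c = 2]. *)
have key c : 0 < c -> c <= q -> c <= 2 -> ln c + x <= ln (q + 4 * s * (tau ^+ 2 + tau ^+ 2) + 68 * s ^+ 2).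
  move=> c0 cq c2; rewrite -[x in leLHS]expRK -lnM ?posrE ?expR_gt0//.
  rewrite ler_ln ?posrE ?mulr_gt0 ?expR_gt0//; last by nra.
  have := ler_wpM2l (ltW c0) ex; nra.
rewrite /log_trunc -/q; case: (leP q 2) => q2.
  apply: le_trans (key q q0 (lexx _) q2).
  by rewrite lerD2r ge_min lexx.
apply: le_trans (key 2 _ (ltW q2) (lexx _)) => //.
by rewrite lerD2r ge_min lexx orbT.
Qed.

(** Since [a * b] is unbiased, only second-order terms in the variance remain. *)
Lemma avg_softened_le :
  \sum_l w l * \sum_k w k * W (y k) (y l)
  <= 1 + sg * (tau ^+ 2 - lam) + (sg * (tau ^+ 2 - lam)) ^+ 2 / 2 + 9 * (s * tau ^+ 2) + 153 / 2 * s ^+ 2.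
Proof.
set z := sg * _; set v := \sum_k w k * (y k - tau) ^+ 2.
have vs : v <= s := y_var.
have v0 : 0 <= v by apply: sumr_ge0 => k _; rewrite mulr_ge0 ?sqr_ge0.
have quadE a b : W a b = W tau b
    + (sg * b * (1 + sg * (tau * b - lam)) + 8 * s * tau) * (a - tau)
    + (sg ^+ 2 * b ^+ 2 / 2 + 4 * s) * (a - tau) ^+ 2.
  by rewrite /softened; field.
have innerE l : \sum_k w k * W (y k) (y l) =
    (W tau tau + (tau ^+ 2 / 2 + 4 * s) * v)
    + (sg * tau * (1 + sg * (tau * tau - lam)) + 8 * s * tau + tau * v) * (y l - tau)
    + (tau ^+ 2 / 2 + 4 * s + v / 2) * (y l - tau) ^+ 2.
  under eq_bigr => k _ do rewrite quadE.
  rewrite avg_quadratic -/v sg2 mul1r softened_sym quadE sg2 mul1r.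
  by field.
under eq_bigr => l _ do rewrite innerE.
rewrite avg_quadratic -/v /softened -expr2 -/z.
have t0 : 0 <= tau ^+ 2 by rewrite sqr_ge0.
have h1 : tau ^+ 2 * v <= tau ^+ 2 * s by rewrite ler_wpM2l.
have h2 : v ^+ 2 <= s ^+ 2 by rewrite ler_sqr ?nnegrE.
have h3 : s * v <= s ^+ 2 by rewrite expr2 ler_wpM2l.
nra.
Qed.

End random_perturbation.

(** * Random rounding to a weighted grid *)

Section rounding.
Context {R : realType}.

Lemma geometric_half_sum n : \sum_(i < n) (1 / 2) ^+ i <= 2 :> R.
Proof.
suff -> : \sum_(i < n) (1 / 2) ^+ i = 2 - 2 * (1 / 2) ^+ n :> R.
  by rewrite gerBl mulr_ge0// exprn_ge0// divr_ge0.
elim: n => [|n IHn]; first by rewrite big_ord0 expr0 mulr1 subrr.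
by rewrite big_ord_recr/= IHn exprS; field.
Qed.

Lemma expR_Nsqr_le n : expR (- (n%:R ^+ 2)) <= (1 / 2) ^+ n :> R.
Proof.
rewrite -natrX -[n in leRHS]muln1.
have e1 : expR (- 1) <= 1 / 2 :> R.
  rewrite expRN -[1 / 2]invrK lef_pV2 ?posrE ?expR_gt0 ?invr_gt0//.
  by have := @expR_ge1Dx R 1; lra.
have -> : expR (- (n ^ 2)%:R) = expR (- 1) ^+ (n ^ 2) :> R.
  by rewrite -expRM_natl mulrN mulr1.
apply: (@le_trans _ _ ((1 / 2) ^+ (n ^ 2))).
  by rewrite lerXn2r ?nnegrE ?expR_ge0 ?divr_ge0.
rewrite ler_wiXn2l ?divr_ge0//; first by lra.
by rewrite -mulnn leq_mul2l; case: n.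
Qed.

Definition grid (K d : nat) := {ffun 'I_d -> 'I_(K + K.+1)}.

(** The coordinates of the grid are the integers from [- K] to [K]. *)
Definition gridpt (K d : nat) (k : grid K d) (j : 'I_d) : R := (k j)%:R - K%:R.

(** Minus the logarithm of the prior weight of a grid point; the constant
[3 / 2] makes the weights sum to at most [1], because
[\sum_k exp (- k^2) <= 3 <= exp (3 / 2)]. *)
Definition grid_cost (K d : nat) (k : grid K d) : R :=
  \sum_j (gridpt k j ^+ 2 + 3 / 2).

Lemma gauss_weight_sum K :
  \sum_(i < K + K.+1) expR (- ((i%:R - K%:R) ^+ 2 + 3 / 2)) <= 1 :> R.
Proof.
under eq_bigr do rewrite opprD expRD.
rewrite -mulr_suml expRN ler_pdivrMr ?expR_gt0// mul1r.
apply: (@le_trans _ _ 3); last first.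
  have -> : 3 / 2 = 3%:R * (1 / 2) :> R by field.
  rewrite expRM_natl; have := @expR_ge1Dx R (1 / 2).
  have : 0 <= (1 + 1 / 2) :> R by lra.
  move=> h1 h2; have : (1 + 1 / 2) ^+ 3 <= expR (1 / 2) ^+ 3 :> R.
    by rewrite lerXn2r ?nnegrE ?expR_ge0.
  by apply: le_trans; lra.
rewrite big_split_ord/=.
have -> : 3 = 1 + 2 :> R by ring.
apply: lerD.
  rewrite (reindex_inj rev_ord_inj)/=.
  apply: (@le_trans _ _ (1 / 2 * \sum_(i < K) (1 / 2) ^+ i)); last first.
    by have := geometric_half_sum K; lra.
  rewrite mulr_sumr; apply: ler_sum => i _; rewrite -exprS.
  rewrite -[X in X - _]addr0 natrB ?ltn_ord// addr0.
  rewrite (_ : (_ - _) ^+ 2 = i.+1%:R ^+ 2) ?expR_Nsqr_le//.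
  by rewrite addrAC subrr sub0r sqrrN.
apply: le_trans (geometric_half_sum K.+1); apply: ler_sum => i _.
by rewrite natrD addrAC subrr add0r expR_Nsqr_le.
Qed.

Lemma grid_weight_sum (K d : nat) :
  \sum_(k : grid K d) expR (- grid_cost k) <= 1.
Proof.
under eq_bigr do rewrite /grid_cost -sumrN expR_sum.
rewrite -(bigA_distr_bigA (fun (j : 'I_d) (i : 'I_(K + K.+1)) =>
  expR (- ((i%:R - K%:R) ^+ 2 + 3 / 2)) : R)).
apply: prodr_ile1 => j _; rewrite gauss_weight_sum andbT.
by apply: sumr_ge0 => i _; exact: expR_ge0.
Qed.

(** A number is rounded to one of its two integer neighbours, with the
probabilities that make the rounding unbiased; the variance is then
[f (1 - f)], where [f] is the fractional part. *)
Lemma rounding1 (K : nat) (x : R) : `|x| < K%:R ->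
  exists r : 'I_(K + K.+1) -> R, [/\ forall i, 0 <= r i, \sum_i r i = 1,
    \sum_i r i * (i%:R - K%:R - x) = 0 &
    \sum_i r i * (i%:R - K%:R - x) ^+ 2 <= 1 / 4].
Proof.
rewrite ltr_norml => /andP[xl xu].
have y0 : 0 <= x + K%:R by lra.
pose t := Num.truncn (x + K%:R).
have /andP[t1 t2] : t%:R <= x + K%:R < t.+1%:R by exact: truncn_itv.
have tK : (t < K + K)%N.
  by rewrite -(ltr_nat R) natrD; lra.
pose f := x + K%:R - t%:R.
have f0 : 0 <= f by rewrite subr_ge0.
have f1 : f <= 1 by rewrite /f -natr1 in t2 *; lra.
have tM : (t < K + K.+1)%N by rewrite addnS ltnS ltnW.
have tM1 : (t.+1 < K + K.+1)%N by rewrite addnS ltnS.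
pose i0 := Ordinal tM; pose i1 := Ordinal tM1.
have i10 : i1 != i0 by rewrite -val_eqE/= gtn_eqF.
pose r i := if i == i0 then 1 - f else if i == i1 then f else 0.
have sumE (F : 'I_(K + K.+1) -> R) : \sum_i r i * F i = (1 - f) * F i0 + f * F i1.
  rewrite (bigD1 i0)//= (bigD1 i1)//= big1 ?addr0.
    by rewrite /r eqxx (negbTE i10) eqxx.
  by move=> i /andP[/negbTE h0 /negbTE h1]; rewrite /r h0 h1 mul0r.
exists r; split.
- by move=> i; rewrite /r; case: ifP => _; [|case: ifP => //]; lra.
- by have := sumE (fun=> 1); under eq_bigr do rewrite mulr1; move=> ->; ring.
- by rewrite sumE /= -natr1 /f; ring.
- rewrite sumE /= -natr1.
  rewrite (_ : _ + _ = f * (1 - f)); last by rewrite /f; ring.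
  by have := sqr_ge0 (f - 1 / 2); rewrite expr2; lra.
Qed.

(** The coordinates are rounded independently, so the variance of a linear form
is the sum of the variances of its terms. *)
Lemma random_rounding (K d : nat) (x : 'I_d -> R) : (forall j, `|x j| < K%:R) ->
  exists w : grid K d -> R, [/\ forall k, 0 <= w k, \sum_k w k = 1,
    forall a : 'I_d -> R, \sum_k w k * (\sum_j a j * (gridpt k j - x j)) = 0 &
    forall a : 'I_d -> R, \sum_k w k * (\sum_j a j * (gridpt k j - x j)) ^+ 2
      <= (\sum_j a j ^+ 2) / 4].
Proof.
move=> xK.
have /choice[r rP] j := rounding1 (xK j).
pose c j (i : 'I_(K + K.+1)) : R := i%:R - K%:R - x j.
pose w (k : grid K d) := \prod_j r j (k j).
(* The expectation of a product of functions of single coordinates. *)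
have prodE (h : 'I_d -> 'I_(K + K.+1) -> R) :
    \sum_(k : grid K d) w k * \prod_j h j (k j) = \prod_j \sum_i r j i * h j i.
  rewrite (bigA_distr_bigA (fun j i => r j i * h j i)).
  by apply: eq_bigr => k _; rewrite /w -big_split.
have w1 : \sum_k w k = 1.
  have := prodE (fun _ _ => 1).
  rewrite (eq_bigr w) => [->|k _]; last by rewrite prodr_const expr1n mulr1.
  apply: big1 => j _; under eq_bigr do rewrite mulr1.
  by have [] := rP j.
pose pick (j : 'I_d) (h : 'I_(K + K.+1) -> R) l i := if l == j then h i else 1.
have pickE (k : grid K d) j h : \prod_l pick j h l (k l) = h (k j).
  rewrite (bigD1 j)//= big1 ?mulr1; first by rewrite /pick eqxx.
  by move=> l /negbTE lj; rewrite /pick lj.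
have Epick j (h : 'I_(K + K.+1) -> R) : \sum_k w k * h (k j) = \sum_i r j i * h i.
  under eq_bigr do rewrite -(pickE _ j h).
  rewrite prodE (bigD1 j)//= [X in _ * X]big1 ?mulr1.
    by apply: eq_bigr => i _; rewrite /pick eqxx.
  move=> l /negbTE lj; rewrite /pick lj.
  by under eq_bigr do rewrite mulr1; have [] := rP l.
have Epick2 j l : l != j -> \sum_k w k * (c j (k j) * c l (k l)) = 0.
  move=> lj.
  under eq_bigr do rewrite -(pickE _ j (c j)) -(pickE _ l (c l)) -big_split/=.
  rewrite (prodE (fun m i => pick j (c j) m i * pick l (c l) m i)) (bigD1 j)//=.
  have jl : (j == l) = false by rewrite eq_sym (negbTE lj).
  under eq_bigr do rewrite /pick eqxx jl mulr1.
  by have [_ _ -> _] := rP j; rewrite mul0r.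
exists w; split => //.
- by move=> k; apply: prodr_ge0 => j _; have [] := rP j.
- move=> a; under eq_bigr do rewrite mulr_sumr.
  rewrite exchange_big/= big1// => j _.
  under eq_bigr do rewrite mulrCA.
  rewrite -mulr_sumr (Epick j (c j)).
  by have [_ _ -> _] := rP j; rewrite mulr0.
- move=> a.
  have sqE (k : grid K d) : w k * (\sum_j a j * (gridpt k j - x j)) ^+ 2 =
      \sum_j \sum_l a j * a l * (w k * (c j (k j) * c l (k l))).
    rewrite expr2 mulr_suml mulr_sumr; apply: eq_bigr => j _.
    rewrite !mulr_sumr; apply: eq_bigr => l _; rewrite /c /gridpt; ring.
  under eq_bigr do rewrite sqE.
  rewrite exchange_big/= mulr_suml; apply: ler_sum => j _.
  rewrite exchange_big/= (bigD1 j)//= [X in _ + X]big1 ?addr0.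
    rewrite -mulr_sumr -expr2 ler_wpM2l ?sqr_ge0//.
    under eq_bigr do rewrite -expr2.
    rewrite (Epick j (fun i => c j i ^+ 2)).
    by have [_ _ _ /le_trans] := rP j; apply; lra.
  by move=> l lj; rewrite -mulr_sumr Epick2// mulr0.
Qed.

Lemma avg_grid_cost (K d : nat) (x : 'I_d -> R) (w : grid K d -> R) :
  \sum_k w k = 1 ->
  (forall a : 'I_d -> R, \sum_k w k * (\sum_j a j * (gridpt k j - x j)) = 0) ->
  (forall a : 'I_d -> R, \sum_k w k * (\sum_j a j * (gridpt k j - x j)) ^+ 2
      <= (\sum_j a j ^+ 2) / 4) ->
  \sum_k w k * grid_cost k <= \sum_j x j ^+ 2 + 7 / 4 * d%:R.
Proof.
move=> w1 wm wv.
pose e (j l : 'I_d) : R := (l == j)%:R.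
have eE k j : \sum_l e j l * (gridpt k l - x l) = gridpt k j - x j.
  rewrite (bigD1 j)//= big1 ?addr0; first by rewrite /e eqxx mul1r.
  by move=> l /negbTE lj; rewrite /e lj mul0r.
have ee j : \sum_l e j l ^+ 2 = 1.
  rewrite (bigD1 j)//= big1 ?addr0; first by rewrite /e eqxx expr1n.
  by move=> l /negbTE lj; rewrite /e lj expr0n.
rewrite /grid_cost; under eq_bigr do rewrite mulr_sumr.
rewrite exchange_big/=.
have -> : 7 / 4 * d%:R = \sum_(j < d) (7 / 4 : R).
  by rewrite sumr_const card_ord mulr_natr.
rewrite -big_split/=; apply: ler_sum => j _.
have := wv (e j); under [X in X <= _]eq_bigr do rewrite eE.
have := wm (e j); under [X in X = _]eq_bigr do rewrite eE.
rewrite ee => m0 v0.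
have E k : w k * (gridpt k j ^+ 2 + 3 / 2) =
    (x j ^+ 2 + 3 / 2) * w k + 2 * x j * (w k * (gridpt k j - x j))
    + w k * (gridpt k j - x j) ^+ 2 by ring.
under eq_bigr => k _ do rewrite E.
rewrite !big_split/= -!mulr_sumr m0 w1; lra.
Qed.

End rounding.

(** * Expectations, Markov's inequality and finite unions *)

Section superlevel_sets.
Context {R : realType}.

Lemma measurable_ge disp' (T' : measurableType disp') (f : T' -> R) (b : R) :
  measurable_fun setT f -> measurable [set x | b <= f x].
Proof.
move=> mf; rewrite -[X in measurable X]setTI.
by have := mf measurableT `[b, +oo[%classic (measurable_itv _);
  rewrite /preimage/=; under eq_set do rewrite in_itv/= andbT.
Qed.

Lemma measurable_gt disp' (T' : measurableType disp') (f : T' -> R) (b : R) :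
  measurable_fun setT f -> measurable [set x | b < f x].
Proof.
move=> mf; rewrite -[X in measurable X]setTI.
by have := mf measurableT `]b, +oo[%classic (measurable_itv _);
  rewrite /preimage/=; under eq_set do rewrite in_itv/= andbT.
Qed.

End superlevel_sets.

Section weighted_expectation.
Context {R : realType} {disp disp' : measure_display}.
Context {T : measurableType disp} {T' : measurableType disp'}.
Variable (P : probability T R).

Import HBNNSimple.

(** Weights that agree on the preimages of measurable sets agree on all
nonnegative measurable functions of [X], by simple approximation.  This is what
allows the factors of a product to be treated one at a time. *)
Lemma ge0_integral_weight_eq (X : {mfun T >-> T'}) (W1 W2 : T -> R)
    (phi : T' -> R) :
  measurable_fun setT W1 -> measurable_fun setT W2 ->
  (forall w, 0 <= W1 w) -> (forall w, 0 <= W2 w) ->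
  (forall B, measurable B ->
    (\int[P]_w (W1 w * \1_B (X w))%:E = \int[P]_w (W2 w * \1_B (X w))%:E)%E) ->
  measurable_fun setT phi -> (forall x, 0 <= phi x) ->
  (\int[P]_w (W1 w * phi (X w))%:E = \int[P]_w (W2 w * phi (X w))%:E)%E.
Proof.
move=> mW1 mW2 W10 W20 W12 mphi phi0.
have mphi' : measurable_fun [set: T'] (fun x => (phi x)%:E) by exact/measurable_EFinP.
pose g := nnsfun_approx measurableT mphi'.
have simple (W : T -> R) n : measurable_fun setT W -> (forall w, 0 <= W w) ->
    (\int[P]_w (W w * g n (X w))%:E =
     \sum_(r \in range (g n)) (r%:E *
        \int[P]_w (W w * \1_(g n @^-1` [set r]) (X w))%:E))%E.
  move=> mW W0.
  have mI r : measurable_fun setT (fun w => (W w * \1_(g n @^-1` [set r]) (X w))%:E).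
    apply/measurable_EFinP/measurable_funM => //.
    by apply: measurableT_comp => //; exact: measurable_indic.
  transitivity (\int[P]_w (\sum_(r \in range (g n))
       (r%:E * (W w * \1_(g n @^-1` [set r]) (X w))%:E)))%E.
    apply: eq_integral => w _; rewrite fimfunE.
    rewrite (_ : W w * _ = \sum_(r \in range (g n)) (r * (W w * \1_(g n @^-1` [set r]) (X w)))).
      by rewrite -fsumEFin.
    rewrite fsbig_finite//= fsbig_finite//= mulr_sumr.
    by apply: eq_bigr => r _; rewrite mulrCA.
  rewrite ge0_integral_fsum//.
  - apply: eq_fsbigr => r /set_mem[t _ <-].
    by rewrite ge0_integralZl_EFin// => w _; rewrite lee_fin mulr_ge0.
  - by move=> r; exact: measurable_funeM.
  - move=> r w _; rewrite -EFinM lee_fin.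
    have [t0|r0] := leP 0 r; first by rewrite !mulr_ge0.
    by rewrite preimage_nnfun0// indic0 !mulr0.
have limit (W : T -> R) : measurable_fun setT W -> (forall w, 0 <= W w) ->
    (\int[P]_w (W w * phi (X w))%:E = limn (fun n => \int[P]_w (W w * g n (X w))%:E))%E.
  move=> mW W0; rewrite -monotone_convergence//.
  - apply: eq_integral => w _; apply/esym/cvg_lim => //.
    have phi0' x : [set: T'] x -> (0 <= (phi x)%:E)%E by rewrite lee_fin.
    have := @cvg_nnsfun_approx _ _ R _ measurableT _ mphi' phi0' (X w) Logic.I.
    rewrite -/g => H; under eq_fun do rewrite EFinM.
    by rewrite EFinM; apply: cvgeZl.
  - move=> n; apply/measurable_EFinP/measurable_funM => //.
    exact: measurableT_comp.
  - by move=> n w _; rewrite lee_fin mulr_ge0.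
  - move=> w _ m n mn; rewrite lee_fin ler_wpM2l//.
    exact/lefP/nd_nnsfun_approx.
rewrite !limit//; congr (limn _); apply/funext => n.
rewrite !simple//; apply: eq_fsbigr => r _; rewrite W12//.
Qed.

Lemma integral_cst_probability (c : R) : (\int[P]_w c%:E = c%:E)%E.
Proof. by rewrite integral_cst//= probability_setT mule1. Qed.

Lemma markov_ge0 (f : T -> R) (a : R) : measurable_fun setT f ->
  (forall w, 0 <= f w) -> 0 < a ->
  (P [set w | a <= f w]%R <= a^-1%:E * \int[P]_w (f w)%:E)%E.
Proof.
move=> mf f0 a0.
have mA : measurable [set w | a <= f w] by exact: measurable_ge.
rewrite -(@mul1e _ (P _)) -(mulVf (lt0r_neq0 a0)) EFinM -muleA.
rewrite lee_pmul2l// ?lte_fin ?invr_gt0//.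
have -> : P [set w | a <= f w] = (\int[P]_w (\1_[set w | a <= f w] w)%:E)%E.
  by rewrite integral_indic// setIT.
rewrite -ge0_integralZl_EFin//; last 2 first.
- by apply/measurable_EFinP; exact: measurable_indic.
- exact: ltW.
apply: ge0_le_integral => //.
- by move=> w _; rewrite -EFinM lee_fin mulr_ge0// ltW.
- by apply/measurable_EFinP/measurable_funM => //; exact: measurable_indic.
- exact/measurable_EFinP.
- move=> w _; rewrite -EFinM lee_fin indicE.
  by have [/set_mem/=|_] := boolP (w \in _); rewrite ?mulr1// mulr0.
Qed.

Lemma finite_union_bound (I : finType) (B : I -> set T) (p : I -> R) :
  (forall i, measurable (B i)) -> (forall i, P (B i) <= (p i)%:E)%E ->
  exists U, [/\ measurable U, forall i, B i `<=` U & (P U <= (\sum_i p i)%:E)%E].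
Proof.
move=> mB pB.
have : exists U, [/\ measurable U, forall i, i \in enum I -> B i `<=` U &
    (P U <= (\sum_(i <- enum I) p i)%:E)%E].
  elim: (enum I) => [|i s [U [mU BU PU]]].
    by exists set0; split => //; rewrite measure0 big_nil.
  exists (B i `|` U); split.
  - exact: measurableU.
  - move=> j; rewrite inE => /predU1P[->|js]; first exact: subsetUl.
    by apply: subset_trans (BU _ js) _; exact: subsetUr.
  - rewrite big_cons EFinD; have := measureU2 P (mB i) mU.
    by move=> /le_trans; apply; exact: (leeD (pB i) PU).
move=> [U [mU BU PU]]; exists U; split => //.
  by move=> i; apply: BU; rewrite mem_enum.
by rewrite big_enum in PU.
Qed.

End weighted_expectation.

(** * Product expectations for independent copies *)

Section iid_sample.
Context {R : realType} {d n : nat} {disp0 disp : measure_display}.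
Context {T0 : measurableType disp0} {P0 : probability T0 R}.
Variable X : {RV P0 >-> d.-tuple R}.
Context {T : measurableType disp} {P : probability T R}.
Variable Xs : 'I_n -> {RV P >-> d.-tuple R}.
Hypothesis copies : independent_copies Xs X.

Lemma copy_expectation i (phi : d.-tuple R -> R) :
  measurable_fun setT phi -> (forall x, 0 <= phi x) ->
  (\int[P]_w (phi (Xs i w))%:E = \int[P0]_w (phi (X w))%:E)%E.
Proof.
move=> mphi phi0; have [_ dE] := copies.
have mphi' : measurable_fun setT (fun x => (phi x)%:E) by exact/measurable_EFinP.
have phi0' x : (0 <= (phi x)%:E)%E by rewrite lee_fin.
rewrite -[LHS](ge0_integral_distribution (Xs i) mphi' phi0').
rewrite -[RHS](ge0_integral_distribution X mphi' phi0').
by apply: eq_measure_integral => A mA _; exact: dE.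
Qed.

(** Independence is a product rule for events, that is, for indicator functions.
Induction on [k] replaces the first [k] indicators by arbitrary functions; the
factors of index at least [k] are still indicators. *)
Lemma indep_expectation_prod (phi : 'I_n -> d.-tuple R -> R) :
  (forall i, measurable_fun setT (phi i)) -> (forall i x, 0 <= phi i x) ->
  (forall i, \int[P]_w (phi i (Xs i w))%:E < +oo)%E ->
  (\int[P]_w (\prod_i phi i (Xs i w))%:E
   = \prod_i \int[P]_w (phi i (Xs i w))%:E)%E.
Proof.
suff H k : (k <= n)%N -> forall phi : 'I_n -> d.-tuple R -> R,
    (forall i, measurable_fun setT (phi i)) -> (forall i x, 0 <= phi i x) ->
    (forall i, \int[P]_w (phi i (Xs i w))%:E < +oo)%E ->
    (forall i : 'I_n, (k <= i)%N -> exists2 B, measurable B & phi i = \1_B) ->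
    (\int[P]_w (\prod_i phi i (Xs i w))%:E
     = \prod_i \int[P]_w (phi i (Xs i w))%:E)%E.
  move=> mphi phi0 phioo; apply: (H n) => // i.
  by rewrite leqNgt ltn_ord.
elim: k => [_|k IHk kn] {}phi mphi phi0 phioo phiB.
  have /choice[B BP] (i : 'I_n) : exists B, measurable B /\ phi i = \1_B.
    by have [//|B mB ->] := phiB i; exists B.
  have [indep _] := copies.
  pose J : {set 'I_n} := finset.finset predT.
  have := indep J B (fun i => (BP i).1).
  have -> : \bigcap_(i in [set` J]) (Xs i @^-1` B i)
      = \bigcap_(i in [set: 'I_n]) (Xs i @^-1` B i).
    by apply/seteqP; split => w h i _; apply: h; rewrite /= ?inE.
  under eq_bigl do rewrite inE.
  have mI (i : 'I_n) : measurable (Xs i @^-1` B i).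
    by rewrite -[X in measurable X]setTI; apply: measurable_funP => //; exact: (BP i).1.
  have mII : measurable (\bigcap_(i in [set: 'I_n]) (Xs i @^-1` B i)).
    by apply: fin_bigcap_measurable => //; exact: finite_finset.
  rewrite -[X in P X]setIT -integral_indic// => H.
  rewrite -[LHS]/(\int[P]_w ((fun w => \prod_i phi i (Xs i w)) w)%:E)%E.
  transitivity (\int[P]_w (\1_(\bigcap_(i in [set: 'I_n]) (Xs i @^-1` B i)) w)%:E)%E.
    apply: eq_integral => w _; congr EFin; rewrite indicE.
    have [/set_mem wB|/negP wB] := boolP (w \in _).
      apply: big1 => i _; rewrite (BP i).2 indicE mem_set//; exact: (wB i).
    have [i Bi] : exists i, ~ B i (Xs i w).
      by apply: contrapT => h; apply: wB; apply/mem_set => i _; apply: contrapT => h'; apply: h; exists i.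
    by rewrite (bigD1 i)//= (BP i).2 indicE memNset// mul0r.
  rewrite H; apply: eq_bigr => i _.
  by rewrite -[X in P X]setIT -integral_indic// (BP i).2.
(* By the induction hypothesis, the product [W1] of the other factors and its
   mean [c] are weights that agree on indicators of the factor of index [k]. *)
pose i0 := Ordinal kn.
pose W1 w := \prod_(i | i != i0) phi i (Xs i w).
pose c := fine (\prod_(i | i != i0) \int[P]_w (phi i (Xs i w))%:E)%E.
have mphiX (i : 'I_n) (f : d.-tuple R -> R) : measurable_fun setT f ->
    measurable_fun setT (fun w => f (Xs i w)).
  by move=> mf; apply: measurableT_comp.
have fin i : (\int[P]_w (phi i (Xs i w))%:E)%E \is a fin_num.
  by rewrite ge0_fin_numE// integral_ge0// => w _; rewrite lee_fin.
have cE : (\prod_(i | i != i0) \int[P]_w (phi i (Xs i w))%:E = c%:E)%E.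
  by rewrite /c fineK// prode_fin_num.
have c0 : 0 <= c.
  by rewrite -lee_fin -cE; apply: prode_ge0 => i _; rewrite integral_ge0// => w _; rewrite lee_fin.
have prodE (f : d.-tuple R -> R) w :
    \prod_i (if i == i0 then f else phi i) (Xs i w) = W1 w * f (Xs i0 w).
  rewrite (bigD1 i0)//= eqxx mulrC; congr (_ * _).
  by apply: eq_bigr => i /negbTE ->.
have prodE' (f : d.-tuple R -> R) :
    (\prod_i \int[P]_w ((if i == i0 then f else phi i) (Xs i w))%:E =
     c%:E * \int[P]_w (f (Xs i0 w))%:E)%E.
  rewrite (bigD1 i0)//= eqxx muleC -cE; congr (_ * _)%E.
  by apply: eq_bigr => i /negbTE ->.
have phiE : phi = fun i => if i == i0 then phi i0 else phi i.
  by apply/funext => i; case: eqVneq => // ->.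
rewrite phiE prodE'; under eq_integral do rewrite prodE.
rewrite (@ge0_integral_weight_eq _ _ _ _ _ _ (Xs i0) W1 (fun=> c))//.
- by under eq_integral do rewrite EFinM; rewrite ge0_integralZl_EFin// => [w _|]; [rewrite lee_fin|exact/measurable_EFinP/mphiX].
- rewrite /W1; under eq_fun do rewrite big_mkcond/=.
  by apply: measurable_prod => i _; case: (i != i0) => //; exact: mphiX.
- by move=> w; apply: prodr_ge0.
move=> B mB.
pose phi' i := if i == i0 then \1_B : d.-tuple R -> R else phi i.
have := IHk (ltnW kn) phi'.
under eq_integral do rewrite prodE.
rewrite prodE' => ->.
- under [RHS]eq_integral do rewrite EFinM.
  rewrite ge0_integralZl_EFin//.
  by apply/measurable_EFinP/mphiX; exact: measurable_indic.
- by move=> i; rewrite /phi'; case: ifP => // _; exact: measurable_indic.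
- by move=> i x; rewrite /phi'; case: ifP.
- move=> i; rewrite /phi'; case: ifP => // _.
  apply: (@le_lt_trans _ _ (\int[P]_w 1)%E); last first.
    by rewrite integral_cst_probability ltry.
  apply: ge0_le_integral => //; last by move=> w _; rewrite lee_fin indicE lern1 leq_b1.
  by apply/measurable_EFinP/mphiX; exact: measurable_indic.
- move=> i ki; rewrite /phi'; case: (eqVneq i i0) => [_|ii0]; first by exists B.
  by apply: phiB; rewrite ltn_neqAle ki andbT; apply: contra_neq ii0 => ki'; apply/val_inj.
Qed.

End iid_sample.

(** * Deviations of sums of independent copies *)

Section deviations.
Context {R : realType} {d n : nat} {disp0 disp : measure_display}.
Context {T0 : measurableType disp0} {P0 : probability T0 R}.
Variable X : {RV P0 >-> d.-tuple R}.
Context {T : measurableType disp} {P : probability T R}.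
Variable Xs : 'I_n -> {RV P >-> d.-tuple R}.
Hypothesis copies : independent_copies Xs X.
Variable eps : R.
Hypothesis eps0 : 0 < eps.

(** Markov's inequality for the product of the [W i (Xs j)], whose expectation is
[ew i ^+ n], with probability [eps * exp (- cost i)] granted to the index [i]. *)
Lemma log_moment_union_bound (I : finType) (W : I -> d.-tuple R -> R)
    (ew cost : I -> R) :
  (forall i, measurable_fun setT (W i)) -> (forall i x, 0 < W i x) ->
  (forall i, \int[P0]_w (W i (X w))%:E = (ew i)%:E)%E ->
  (forall i, 0 < ew i) ->
  \sum_i expR (- cost i) <= 1 ->
  exists U, [/\ measurable U, (P U <= eps%:E)%E &
    forall w, ~ U w -> forall i,
      \sum_j ln (W i (Xs j w)) <= n%:R * (ew i - 1) + ln eps^-1 + cost i].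
Proof.
move=> mW W0 WE ew0 costP.
pose prodW i w := \prod_j W i (Xs j w).
pose a i := ew i ^+ n * expR (cost i) / eps.
have a0 i : 0 < a i by rewrite divr_gt0// mulr_gt0 ?exprn_gt0 ?expR_gt0.
have mprod i : measurable_fun setT (prodW i).
  by apply: measurable_prod => j _; exact: measurableT_comp.
have mB i : measurable [set w | a i <= prodW i w].
  exact: measurable_ge.
have EW i j : (\int[P]_w (W i (Xs j w))%:E = (ew i)%:E)%E.
  by rewrite (copy_expectation copies)// => x; exact: ltW.
have PB i : (P [set w | (a i <= prodW i w)%R] <= (eps * expR (- cost i))%:E)%E.
  have p0 w : 0 <= prodW i w by apply: prodr_ge0 => j _; exact: ltW.
  apply: le_trans (markov_ge0 P (mprod i) p0 (a0 i)) _.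
  have -> : (\int[P]_w (prodW i w)%:E = \prod_(j < n) \int[P]_w (W i (Xs j w))%:E)%E.
    apply: (indep_expectation_prod copies (phi := fun=> W i)) => //.
    - by move=> j x; exact: ltW.
    - by move=> j; rewrite EW ltry.
  under eq_bigr do rewrite EW.
  rewrite prodEFin prodr_const card_ord -EFinM lee_fin /a expRN.
  by rewrite le_eqVlt; apply/predU1P; left; field; rewrite !gt_eqF ?expR_gt0 ?exprn_gt0.
have [U [mU BU PU]] := finite_union_bound mB PB.
exists U; split => //.
  apply: le_trans PU _; rewrite lee_fin -mulr_sumr -[leRHS]mulr1.
  by rewrite ler_wpM2l// ltW.
move=> w Uw i.
have : prodW i w < a i.
  by rewrite ltNge; apply/negP => h; apply: Uw; apply: BU h.
rewrite -ler_expR expR_sum !expRD lnK ?posrE ?invr_gt0//.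
under eq_bigr => j _ do rewrite lnK ?posrE//.
move=> /ltW/le_trans; apply.
rewrite /a mulrAC ler_wpM2r ?expR_ge0//.
rewrite ler_wpM2r ?invr_ge0 ?(ltW eps0)// expRM_natl lerXn2r ?nnegrE ?expR_ge0//.
- exact: ltW.
- by have := expR_ge1Dx (ew i - 1); rewrite addrC subrK.
Qed.

(** With [u = (q - 1) / q <= 1 / 2] the claim reduces to
[ln u <= - 2 * ln 2 * (1 - u)], which follows from the tangent of [ln] at
[1 / 2]. *)
Lemma Cq_ge1 (q : R) : 1 <= q <= 2 -> 1 <= Cq q.
Proof.
move=> /andP[q1 q2]; rewrite /Cq; case: eqVneq => //= q1'; case: eqVneq => //= q2'.
have {q1 q1'}q1 : 1 < q by rewrite lt_neqAle eq_sym q1'.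
have {q2 q2'}q2 : q < 2 by rewrite lt_neqAle q2'.
have q0 : 0 < q by lra.
have q10 : 0 < q - 1 by lra.
have h0 : 0 < 1 - q / 2 by lra.
have D0 : 0 < 2 * (q - 1) `^ (q - 1) * (1 - q / 2) `^ ((2 - q) / q).
  by rewrite !mulr_gt0 ?powR_gt0.
rewrite ler_pdivlMr// mul1r -ler_ln ?posrE ?powR_gt0//.
rewrite !lnM ?posrE ?powR_gt0 ?mulr_gt0 ?powR_gt0// !ln_powR.
pose u := (q - 1) / q.
have uE : u = 1 - q^-1 by rewrite /u; field; rewrite gt_eqF.
have u0 : 0 < u by rewrite divr_gt0.
have u2 : u <= 1 / 2.
  rewrite uE; suff : 1 / 2 <= q^-1 by lra.
  by rewrite -[1 / 2]invrK lef_pV2 ?posrE ?invr_gt0//; lra.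
have lnu : ln (q - 1) = ln u + ln q.
  by rewrite -lnM ?posrE//; congr ln; rewrite /u; field; rewrite gt_eqF.
have lnh : ln (1 - q / 2) <= - ln 2.
  by rewrite -lnV ?posrE// ler_ln ?posrE ?invr_gt0//; lra.
have h1 : (2 - q) / q * ln (1 - q / 2) <= (2 - q) / q * - ln 2.
  by rewrite ler_wpM2l// divr_ge0//; lra.
have key : ln u <= - 2 * ln 2 * (1 - u).
  have -> : ln u = - ln 2 + ln (1 + (2 * u - 1)).
    rewrite -lnV ?posrE// -lnM ?posrE ?invr_gt0//; last by lra.
    by congr ln; field.
  have l2 : ln 2 <= 1 :> R.
    by have := @le_ln1Dx R 1; rewrite (_ : 1 + 1 = 2)//; apply; lra.
  have : ln (1 + (2 * u - 1)) <= 2 * u - 1 by apply: le_ln1Dx; lra.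
  nra.
have : (q - 1) * ln u <= - 2 * ln 2 * ((q - 1) / q).
  have := ler_wpM2l (ltW q10) key.
  by rewrite (_ : 1 - u = q^-1) ?uE; [move/le_trans; apply; rewrite le_eqVlt; apply/predU1P; left; ring|ring].
have : (2 - q) / q * - ln 2 = - ln 2 + 2 * ln 2 * ((q - 1) / q).
  by field; rewrite gt_eqF.
rewrite lnu; lra.
Qed.

Lemma truncated_second_moment (a q y : R) : 1 <= q <= 2 -> 0 < a -> 0 <= y ->
  Num.min y a ^+ 2 <= a `^ (2 - q) * y `^ q.
Proof.
move=> /andP[q1 q2] a0 y0.
have m0 : 0 <= Num.min y a by rewrite le_min y0 ltW.
have [->|y_neq0] := eqVneq y 0.
  by rewrite min_l ?(ltW a0)// expr0n/= mulr_ge0// powR_ge0.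
have mp : 0 < Num.min y a by rewrite lt_min a0 lt_neqAle eq_sym y_neq0 y0.
have -> : Num.min y a ^+ 2 = Num.min y a `^ (2 - q) * Num.min y a `^ q.
  by rewrite -powRD ?subrK ?powR_mulrn// (gt_eqF mp) implybT.
apply: ler_pM; rewrite ?powR_ge0//.
  have q20 : 0 <= 2 - q by rewrite subr_ge0.
  by rewrite ge0_ler_powR ?nnegrE ?(ltW a0)// ge_min lexx orbT.
have q0 : 0 <= q by lra.
by rewrite ge0_ler_powR ?nnegrE// ge_min lexx.
Qed.

(** Chebyshev's inequality; the variance of the sum is computed with nonnegative
integrands only, from the expectations of [V (Xs i) * V (Xs j)]. *)
Lemma bounded_sum_chebyshev (V : d.-tuple R -> R) (a v eta : R) :
  measurable_fun setT V -> (forall x, 0 <= V x <= a) ->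
  (\int[P0]_w (V (X w) ^+ 2)%:E <= v%:E)%E -> 0 < eta ->
  exists m : R, (\int[P0]_w (V (X w))%:E = m%:E)%E /\
  (P [set w | (n%:R * m + eta <= \sum_j V (Xs j w))%R] <= (n%:R * v / eta ^+ 2)%:E)%E.
Proof.
move=> mV Va Vv eta0.
have V0 x : 0 <= V x by have /andP[] := Va x.
have bounded (f : d.-tuple R -> R) b : measurable_fun setT f -> (forall x, 0 <= f x <= b) ->
    exists r : R, (\int[P0]_w (f (X w))%:E = r%:E)%E.
  move=> mf fb; have f0 x : 0 <= f x by have /andP[] := fb x.
  have ge0 : (0 <= \int[P0]_w (f (X w))%:E)%E by apply: integral_ge0 => w _; rewrite lee_fin.
  have lt : (\int[P0]_w (f (X w))%:E < +oo)%E.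
    apply: (@le_lt_trans _ _ (\int[P0]_w b%:E)%E).
      apply: ge0_le_integral => //.
      - by move=> w _; rewrite lee_fin.
      - by apply/measurable_EFinP; apply: measurableT_comp.
      - by move=> w _; rewrite lee_fin; have /andP[] := fb (X w).
    by rewrite integral_cst_probability ltry.
  by exists (fine (\int[P0]_w (f (X w))%:E)); rewrite fineK// ge0_fin_numE.
have [m mE] := bounded V a mV Va.
have mV2 : measurable_fun setT (fun x => V x ^+ 2) by exact: measurable_funX.
have [v' v'E] : exists r : R, (\int[P0]_w (V (X w) ^+ 2)%:E = r%:E)%E.
  apply: (bounded (fun x => V x ^+ 2) (a ^+ 2) mV2) => x.
  have /andP[h1 h2] := Va x; rewrite sqr_ge0 lerXn2r// nnegrE//; exact: le_trans h2.
have v'v : v' <= v by rewrite v'E lee_fin in Vv.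
exists m; split => //.
have mVX j : measurable_fun setT (fun w => V (Xs j w)) by exact: measurableT_comp.
pose S w := \sum_j V (Xs j w).
have mS : measurable_fun setT S by exact: measurable_sum.
have S0 w : 0 <= S w by apply: sumr_ge0.
have m0 : 0 <= m by rewrite -lee_fin -mE integral_ge0// => w _; rewrite lee_fin.
have ES : (\int[P]_w (S w)%:E = (n%:R * m)%:E)%E.
  under eq_integral do rewrite -sumEFin.
  rewrite ge0_integral_sum//; last 2 first.
  - by move=> j; exact/measurable_EFinP.
  - by move=> j w _; rewrite lee_fin.
  under eq_bigr do rewrite (copy_expectation copies)// mE.
  by rewrite sumEFin sumr_const card_ord mulr_natl.
have EVV (i j : 'I_n) : (\int[P]_w (V (Xs i w) * V (Xs j w))%:E
    = (m ^+ 2 + (i == j)%:R * (v' - m ^+ 2))%:E)%E.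
  have [<-|ij] := eqVneq i j.
    rewrite mul1r addrC subrK -v'E.
    exact: (copy_expectation copies i mV2 (fun x => sqr_ge0 (V x))).
  (* A product of two factors is a product of [n] factors, most of them [1]. *)
  pose phi (l : 'I_n) (x : d.-tuple R) := if (l == i) || (l == j) then V x else 1.
  have phiE w : V (Xs i w) * V (Xs j w) = \prod_l phi l (Xs l w).
    rewrite (bigD1 i)//= (bigD1 j)/= 1?eq_sym// big1.
      by rewrite /phi !eqxx orbT mulr1.
    by move=> l /andP[/negbTE h1 /negbTE h2]; rewrite /phi h1 h2.
  have Ephi l : (\int[P]_w (phi l (Xs l w))%:E = (if (l == i) || (l == j) then m else 1)%:E)%E.
    rewrite /phi; case: ifP => _; first by rewrite (copy_expectation copies)// mE.
    by rewrite integral_cst_probability.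
  under eq_integral do rewrite phiE.
  rewrite (indep_expectation_prod copies); last 3 first.
  - by move=> l; rewrite /phi; case: (_ || _).
  - by move=> l x; rewrite /phi; case: ifP.
  - by move=> l; rewrite Ephi ltry.
  under eq_bigr do rewrite Ephi.
  rewrite prodEFin (bigD1 i)//= (bigD1 j)/= 1?eq_sym// big1.
    by rewrite !eqxx orbT mulr1 mul0r addr0 expr2.
  by move=> l /andP[/negbTE h1 /negbTE h2]; rewrite h1 h2.
have ES2 : (\int[P]_w (S w ^+ 2)%:E = (n%:R ^+ 2 * m ^+ 2 + n%:R * (v' - m ^+ 2))%:E)%E.
  transitivity (\int[P]_w (\sum_i \sum_j (V (Xs i w) * V (Xs j w))%:E))%E.
    apply: eq_integral => w _; rewrite /S expr2 mulr_suml -sumEFin.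
    by apply: eq_bigr => i _; rewrite mulr_sumr -sumEFin.
  have mVV i j : measurable_fun setT (fun w => (V (Xs i w) * V (Xs j w))%:E).
    by apply/measurable_EFinP/measurable_funM.
  rewrite ge0_integral_sum//; last 2 first.
  - by move=> i; apply: emeasurable_sum => j.
  - by move=> i w _; apply: sume_ge0 => j _; rewrite lee_fin mulr_ge0.
  under eq_bigr => i _.
    rewrite ge0_integral_sum//; last by move=> j w _; rewrite lee_fin mulr_ge0.
    under eq_bigr do rewrite EVV.
    rewrite sumEFin big_split/= sumr_const card_ord -mulr_suml.
    rewrite (bigD1 i)//= big1 ?addr0; last by move=> j /negbTE; rewrite eq_sym => ->.
    rewrite eqxx mul1r; over.
  rewrite sumEFin sumr_const card_ord; congr (_%:E).
  by ring.
pose D w := (S w - n%:R * m) ^+ 2.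
have mD : measurable_fun setT D by apply: measurable_funX; apply: measurable_funB.
have D0 w : 0 <= D w by exact: sqr_ge0.
have ED : (\int[P]_w (D w)%:E <= (n%:R * v)%:E)%E.
  have : (\int[P]_w ((D w)%:E + (2 * (n%:R * m) * S w)%:E)
      = \int[P]_w ((S w ^+ 2)%:E + ((n%:R * m) ^+ 2)%:E))%E.
    by apply: eq_integral => w _; rewrite -!EFinD; congr EFin; rewrite /D; ring.
  have nm0 : 0 <= 2 * (n%:R * m) by rewrite mulr_ge0// mulr_ge0.
  rewrite !ge0_integralD//; last first.
  - by apply/measurable_EFinP/measurable_funM.
  - by move=> w _; rewrite lee_fin mulr_ge0.
  - exact/measurable_EFinP.
  - by move=> w _; rewrite lee_fin.
  - by move=> w _; rewrite lee_fin sqr_ge0.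
  - by apply/measurable_EFinP/measurable_funX.
  - by move=> w _; rewrite lee_fin sqr_ge0.
  under [X in (_ + X = _)%E -> _]eq_integral do rewrite EFinM.
  rewrite ge0_integralZl_EFin//; last 2 first.
  - by move=> w _; rewrite lee_fin.
  - exact/measurable_EFinP.
  rewrite ES ES2 integral_cst_probability -EFinM.
  move=> /(congr1 (fun z => z - (2 * (n%:R * m) * (n%:R * m))%:E)%E).
  rewrite addeK// -EFinN -!EFinD => ->; rewrite lee_fin.
  have : n%:R * v' <= n%:R * v by rewrite ler_wpM2l.
  have : 0 <= n%:R * m ^+ 2 by rewrite mulr_ge0 ?sqr_ge0.
  nra.
have e20 : 0 < eta ^+ 2 by rewrite exprn_gt0.
apply: (@le_trans _ _ (P [set w | (eta ^+ 2 <= D w)%R])).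
  apply: le_measure; rewrite ?inE; [exact: measurable_ge|exact: measurable_ge|].
  by move=> w /=; rewrite -lerBrDl => h; rewrite lerXn2r// nnegrE ltW// (lt_le_trans eta0).
apply: le_trans (markov_ge0 P mD D0 e20) _.
rewrite [n%:R * v / _]mulrC EFinM lee_wpmul2l// lee_fin invr_ge0 ltW//.
Qed.

End deviations.

(** * Deviations of an empirical mean *)

Section empirical_mean.
Context {R : realType} {d n : nat} {disp0 disp : measure_display}.
Context {T0 : measurableType disp0} {P0 : probability T0 R}.
Variable X : {RV P0 >-> d.-tuple R}.
Context {T : measurableType disp} {P : probability T R}.
Variable Xs : 'I_n -> {RV P >-> d.-tuple R}.
Hypothesis copies : independent_copies Xs X.

(** Carries almost sure properties of [X] over to the whole sample. *)
Lemma expectation0_sample_null (f : d.-tuple R -> R) :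
  measurable_fun setT f -> (forall x, 0 <= f x) ->
  (\int[P0]_w (f (X w))%:E = 0)%E ->
  exists U, [/\ measurable U, P U = 0%E & forall w, ~ U w -> forall j, f (Xs j w) = 0].
Proof.
move=> mf f0 Ef0.
have PB (j : 'I_n) : (P [set w | (0 < f (Xs j w))%R] <= 0%:E)%E.
  have mfX : measurable_fun setT (fun w => f (Xs j w)) by exact: measurableT_comp.
  have : (\int[P]_w `|(f (Xs j w))%:E| = 0)%E.
    rewrite -Ef0 -(copy_expectation copies j)//.
    by apply: eq_integral => w _; rewrite gee0_abs ?lee_fin.
  have mfE : measurable_fun [set: T] (fun w => (f (Xs j w))%:E) by exact/measurable_EFinP.
  move=> /(ae_eq_integral_abs P measurableT mfE)[N [mN PN sN]].
  rewrite -[leRHS]PN; apply: le_measure; rewrite ?inE//; first exact: measurable_gt.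
  move=> w /= fw; apply: sN => /= /(_ Logic.I)[] fw0.
  by rewrite fw0 ltxx in fw.
have mB (j : 'I_n) : measurable [set w | 0 < f (Xs j w)].
  by apply: measurable_gt; exact: measurableT_comp.
have [U [mU BU PU]] := finite_union_bound mB PB.
exists U; split => //.
  by apply/eqP; rewrite eq_le measure_ge0 andbT; rewrite big1 in PU.
move=> w Uw j; apply/eqP; rewrite eq_le f0 andbT leNgt.
by apply/negP => fw; apply: Uw; exact: (BU j).
Qed.

(** Each term is truncated at the level [a] with [a `^ q = n M / eps], [M] being
the [q]-th moment: Markov's inequality makes all truncations inactive outside an
event of probability [eps].  The truncated second moment is at most
[a `^ (2 - q) * M], so Chebyshev's inequality at the same level [a] costs another
[eps], and [a / n = (M / eps) `^ q^-1 * n `^ (q^-1 - 1)] is the stated error. *)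
Lemma empirical_mean_deviation (Y : d.-tuple R -> R) (q eps : R) :
  (0 < n)%N -> 0 < eps -> 1 <= q <= 2 ->
  measurable_fun setT Y -> (forall x, 0 <= Y x) ->
  exists U, [/\ measurable U, (P U <= (2 * eps)%:E)%E & forall w, ~ U w ->
    ((n%:R^-1 * \sum_j Y (Xs j w))%:E <= \int[P0]_w (Y (X w))%:E +
      (Cq q / (eps `^ q^-1 * n%:R `^ (1 - q^-1)))%:E *
        (\int[P0]_w (Y (X w) `^ q)%:E) `^ q^-1)%E].
Proof.
move=> n0 eps0 q12 mY Y0; have /andP[q1 q2] := q12.
have q0 : 0 < q by lra.
have nR0 : 0 < n%:R :> R by rewrite ltr0n.
have C1 := Cq_ge1 q12.
set c := (X in (X%:E * _)%E).
have c0 : 0 < c by rewrite divr_gt0 ?mulr_gt0 ?powR_gt0//; lra.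
have EY0 : (0 <= \int[P0]_w (Y (X w))%:E)%E by apply: integral_ge0 => w _; rewrite lee_fin.
have EM0 : (0 <= \int[P0]_w (Y (X w) `^ q)%:E)%E.
  by apply: integral_ge0 => w _; rewrite lee_fin powR_ge0.
have null : exists U, measurable U /\ P U = 0%E by exists set0; split => //; exact: measure0.
have e20 : (0 <= (2 * eps)%:E)%E by rewrite lee_fin mulr_ge0// ltW.
case EYE : (\int[P0]_w (Y (X w))%:E)%E => [e| |]; last 2 first.
- exists set0; split => //; first by rewrite measure0.
  move=> w _; rewrite addye ?leey//.
  have : (0 <= c%:E * (\int[P0]_w (Y (X w) `^ q)%:E) `^ q^-1)%E.
    by rewrite mule_ge0 ?poweR_ge0// lee_fin ltW.
  by apply: contraTneq => ->.
- by rewrite EYE in EY0.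
case EME : (\int[P0]_w (Y (X w) `^ q)%:E)%E => [M| |]; last 2 first.
- exists set0; split => //; first by rewrite measure0.
  by move=> w _; rewrite poweRyr ?invr_eq0 ?gt_eqF// gt0_muley ?lte_fin// addey// leey.
- by rewrite EME in EM0.
have mYq : measurable_fun setT (fun x => Y x `^ q).
  by apply: (measurableT_comp (measurable_powR q)).
have M0 : 0 <= M by rewrite EME lee_fin in EM0.
have e0 : 0 <= e by rewrite EYE lee_fin in EY0.
rewrite poweR_EFin -EFinM -EFinD.
(* A vanishing moment makes the truncation level [0]; the sample then vanishes
   almost surely. *)
have [M00|Mneq0] := eqVneq M 0.
  have [U [mU PU HU]] := expectation0_sample_null mYq (fun x => powR_ge0 _ _) (etrans EME (congr1 EFin M00)).
  exists U; split => //; first by rewrite PU.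
  move=> w /HU Yw; rewrite lee_fin big1 ?mulr0.
    by rewrite addr_ge0// mulr_ge0 ?powR_ge0// ltW.
  by move=> j _; exact: powR_eq0_eq0 (Yw j).
have {M0 Mneq0}M0 : 0 < M by rewrite lt_neqAle eq_sym Mneq0.
pose a := (n%:R * M / eps) `^ q^-1.
have a0 : 0 < a by rewrite powR_gt0// divr_gt0// mulr_gt0.
have aq : a `^ q = n%:R * M / eps.
  by rewrite /a -powRrM mulVf ?gt_eqF// powRr1// divr_ge0 ?mulr_ge0// ltW.
have ca : a / n%:R <= c * M `^ q^-1.
  have -> : a / n%:R = M `^ q^-1 / (eps `^ q^-1 * n%:R `^ (1 - q^-1)).
    rewrite /a powRM ?invr_ge0 ?mulr_ge0 ?(ltW eps0) ?(ltW M0)//.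
    rewrite powRM ?(ltW M0)// -(powR_inv1 (ltW eps0)) -powRrM mulN1r powRN.
    rewrite powRB; last by rewrite (gt_eqF nR0) implybT.
    rewrite powRr1//.
    by field; rewrite !gt_eqF ?powR_gt0.
  rewrite mulrC ler_wpM2r ?powR_ge0// /c -[leLHS]mul1r ler_wpM2r// invr_ge0 mulr_ge0 ?powR_ge0//.
pose V x := Num.min (Y x) a.
have mV : measurable_fun setT V by apply: measurable_minr.
have V0a x : 0 <= V x <= a by rewrite le_min Y0 (ltW a0) ge_min lexx orbT.
have EV2 : (\int[P0]_w (V (X w) ^+ 2)%:E <= (a `^ (2 - q) * M)%:E)%E.
  rewrite EFinM -EME -ge0_integralZl_EFin ?powR_ge0//; last 2 first.
  - by move=> w _; rewrite lee_fin powR_ge0.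
  - by apply/measurable_EFinP; exact: (measurableT_comp mYq).
  apply: ge0_le_integral => //.
  - by move=> w _; rewrite lee_fin sqr_ge0.
  - by apply/measurable_EFinP/measurable_funX; exact: measurableT_comp.
  - apply: measurable_funeM; apply/measurable_EFinP.
    exact: (measurableT_comp mYq).
  - by move=> w _; rewrite -EFinM lee_fin; exact: truncated_second_moment.
have [m [mE PV]] := bounded_sum_chebyshev copies mV V0a EV2 a0.
have me : m <= e.
  rewrite -lee_fin -mE -EYE; apply: ge0_le_integral => //.
  - by move=> w _; rewrite lee_fin; have /andP[] := V0a (X w).
  - by apply/measurable_EFinP; exact: measurableT_comp.
  - by apply/measurable_EFinP; exact: measurableT_comp.
  - by move=> w _; rewrite lee_fin ge_min lexx.
pose B (j : 'I_n) := [set w | a `^ q <= Y (Xs j w) `^ q].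
pose U2 := [set w | n%:R * m + a <= \sum_j V (Xs j w)].
have mB j : measurable (B j) by apply: measurable_ge; exact: (measurableT_comp mYq).
have mU2 : measurable U2.
  by apply: measurable_ge; apply: measurable_sum => j; exact: measurableT_comp.
have aq0 : 0 < a `^ q by exact: powR_gt0.
have PB j : (P (B j) <= (eps / n%:R)%:E)%E.
  apply: le_trans (markov_ge0 P _ _ aq0) _.
  - exact: (measurableT_comp mYq).
  - by move=> w; exact: powR_ge0.
  rewrite (copy_expectation copies j mYq) ?EME; last by move=> x; exact: powR_ge0.
  by rewrite -EFinM lee_fin aq le_eqVlt; apply/predU1P; left; field; rewrite !gt_eqF.
have PU2 : (P U2 <= eps%:E)%E.
  apply: le_trans PV _; rewrite lee_fin le_eqVlt; apply/predU1P; left.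
  have -> : a ^+ 2 = a `^ (2 - q) * a `^ q.
    by rewrite -powRD ?subrK ?powR_mulrn ?(ltW a0)// (gt_eqF a0) implybT.
  by rewrite aq; field; rewrite !gt_eqF ?(powR_gt0 _ a0).
have [U1 [mU1 BU1 PU1]] := finite_union_bound mB PB.
have PU := measureU2 P mU1 mU2.
exists (U1 `|` U2); split; first exact: measurableU.
  apply: le_trans PU _.
  rewrite (_ : 2 * eps = eps + eps); last by ring.
  have PU1' : (P U1 <= eps%:E)%E.
    apply: le_trans PU1 _.
    by rewrite lee_fin sumr_const card_ord -[_ *+ n]mulr_natr divfK// gt_eqF.
  by rewrite EFinD; exact: (leeD PU1' PU2).
move=> w Uw; rewrite lee_fin.
have Yj j : Y (Xs j w) <= a.
  rewrite leNgt; apply/negP => h; apply: Uw; left; apply: (BU1 j); rewrite /B/=.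
  by rewrite ge0_ler_powR ?nnegrE ?(ltW a0) ?(ltW q0)// ltW.
have SV : \sum_j Y (Xs j w) < n%:R * m + a.
  rewrite (eq_bigr (fun j => V (Xs j w))); last by move=> j _; rewrite /V min_l.
  by rewrite ltNge; apply/negP => h; apply: Uw; right.
apply: (@le_trans _ _ (m + a / n%:R)); last exact: lerD.
rewrite mulrC ler_pdivrMr// mulrDl divfK ?gt_eqF// mulrC; exact: ltW.
Qed.

End empirical_mean.

(** * The inverse square root of a Gram matrix *)

Section whitening_matrix.
Context {R : realType} {d : nat}.
Implicit Types (A : 'M[R]_d) (u v x : 'cV[R]_d).

Lemma dotpC u v : dotp u v = dotp v u.
Proof. by apply: eq_bigr => j _; rewrite mulrC. Qed.

Lemma dotp_mulmxl A u v : dotp (A *m u) v = dotp u (A^T *m v).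
Proof. by rewrite !dotpE trmx_mul mulmxA. Qed.

Lemma dotp_mulmxr A u v : dotp u (A *m v) = dotp (A^T *m u) v.
Proof. by rewrite dotp_mulmxl trmxK. Qed.

Lemma dotpDr u v x : dotp u (v + x) = dotp u v + dotp u x.
Proof. by rewrite !dotpE mulmxDr mxE. Qed.

Lemma dotpDl u v x : dotp (u + v) x = dotp u x + dotp v x.
Proof. by rewrite dotpC dotpDr !(dotpC x). Qed.

Lemma dotpZr (a : R) u v : dotp u (a *: v) = a * dotp u v.
Proof. by rewrite !dotpE -scalemxAr mxE. Qed.

Lemma dotpZl (a : R) u v : dotp (a *: u) v = a * dotp u v.
Proof. by rewrite dotpC dotpZr dotpC. Qed.

Lemma dotp_delta (j : 'I_d) v : dotp (delta_mx j 0) v = v j 0.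
Proof.
rewrite /dotp (bigD1 j)//= big1 ?addr0; first by rewrite mxE !eqxx mul1r.
by move=> k /negbTE kj; rewrite mxE kj mul0r.
Qed.

Lemma trmx_mulmx_eq0 A : A^T *m A = 0 -> A = 0.
Proof.
move=> AA; apply/matrixP => i j; rewrite [RHS]mxE.
have : (A^T *m A) j j = 0 by rewrite AA mxE.
rewrite mxE => /eqP; rewrite psumr_eq0; last first.
  by move=> k _; rewrite mxE -expr2 sqr_ge0.
by move=> /allP/(_ i (mem_index_enum i)); rewrite mxE mulf_eq0 orbb => /eqP.
Qed.

Variable G : 'M[R]_d.
Hypothesis psdG : psd G.

Let S := pinv_sqrt G.
Let H := S *m S.
(** The product of [G] and its pseudo-inverse is the orthogonal projection on the
range of [G]. *)
Definition range_proj : 'M[R]_d := G *m (pinv_sqrt G *m pinv_sqrt G).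
Let Pi := range_proj.

Let GT : G^T = G. Proof. by case: psdG. Qed.
Let ST : S^T = S. Proof. by have [[]] := pinv_sqrtP psdG. Qed.
Let HT : H^T = H. Proof. by rewrite /H trmx_mul ST. Qed.
Let GHG : G *m H *m G = G. Proof. by have [_ []] := pinv_sqrtP psdG. Qed.
Let HGH : H *m G *m H = H. Proof. by have [_ []] := pinv_sqrtP psdG. Qed.
Let PiT : Pi^T = Pi. Proof. by have [_ []] := pinv_sqrtP psdG. Qed.
Let PiE : Pi = H *m G. Proof. by rewrite -PiT /Pi/range_proj trmx_mul GT -/S -/H HT. Qed.

Let HPi : H *m Pi = H.
Proof. by rewrite /Pi/range_proj -/S -/H mulmxA HGH. Qed.

(* [S - S Pi] has Gram matrix [(1 - Pi) H (1 - Pi)], which vanishes. *)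
Let SPi : S *m Pi = S.
Proof.
apply/eqP; rewrite eq_sym -subr_eq0 -[X in X - _]mulmx1 -mulmxBr; apply/eqP/trmx_mulmx_eq0.
by rewrite trmx_mul ST mulmxA -[X in X *m _]mulmxA -/H -mulmxA mulmxBr mulmx1 HPi subrr mulmx0.
Qed.

Let PiS : Pi *m S = S.
Proof. by have := congr1 trmx SPi; rewrite trmx_mul ST PiT. Qed.

Let SGS : S *m G *m S = Pi.
Proof.
have E : Pi *m S = G *m S *m H by rewrite /Pi /range_proj -/S /H -!mulmxA.
rewrite -[X in X *m G]PiS E -(mulmxA _ H G) -PiE -(mulmxA _ Pi S) PiS.
by rewrite -mulmxA.
Qed.

Let PiG : Pi *m G = G.
Proof. by rewrite /Pi /range_proj -/S -/H GHG. Qed.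

Let GPi : G *m Pi = G.
Proof. by have := congr1 trmx PiG; rewrite trmx_mul PiT GT. Qed.

(** The vector [G ^ (1/2) v], since [G ^ (1/2) = G * G ^ (-1/2)]. *)
Definition whitened_direction v : 'cV[R]_d := G *m (pinv_sqrt G *m v).

Lemma dotp_whitened_direction v x : range_proj *m x = x ->
  dotp (whitened_direction v) (pinv_sqrt G *m x) = dotp v x.
Proof.
move=> xE; rewrite /whitened_direction mulmxA !dotp_mulmxl trmx_mul ST GT.
by rewrite mulmxA SGS xE.
Qed.

Lemma range_proj_whitened_direction v :
  range_proj *m whitened_direction v = whitened_direction v.
Proof. by rewrite /whitened_direction mulmxA -/Pi PiG. Qed.

Lemma whitened_direction_norm v :
  dotp (whitened_direction v) (whitened_direction v) = dotp v (G *m v).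
Proof.
have SG : S *m G = G *m S.
  have -> : S *m G = G *m S *m Pi.
    by rewrite PiE -{1}PiS /Pi /range_proj -/S -/H /H -!mulmxA.
  by rewrite -mulmxA SPi.
rewrite /whitened_direction mulmxA dotp_mulmxl trmx_mul ST GT; congr dotp.
rewrite -/S !mulmxA; congr (_ *m _).
by rewrite -(mulmxA (S *m G)) -SG mulmxA SGS PiG.
Qed.

Lemma dotp_range_proj_le v : dotp v (range_proj *m v) <= dotp v v.
Proof.
have PP : Pi *m Pi = Pi by rewrite {1}PiE -mulmxA GPi -PiE.
rewrite -subr_ge0; set w := range_proj *m v.
have wv : dotp w w = dotp v w by rewrite /w dotp_mulmxl -/Pi PiT mulmxA PP.
have -> : dotp v v - dotp v w = dotp (v - w) (v - w).
  rewrite -[- w]scaleN1r !(dotpDl, dotpDr) !(dotpZl, dotpZr).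
  by rewrite [dotp w v]dotpC wv; ring.
exact: dotpvv_ge0.
Qed.

(** The covariance of the whitened vector is the projection [G ^ (-1/2) G G ^ (-1/2)]
rather than the identity, as [G] may be singular. *)
Lemma dotp_pinv_sqrt v :
  dotp (pinv_sqrt G *m v) (G *m (pinv_sqrt G *m v)) = dotp v (range_proj *m v).
Proof. by rewrite dotp_mulmxl ST !mulmxA SGS. Qed.

Lemma gram_range_proj_complement v :
  dotp (v - range_proj *m v) (G *m (v - range_proj *m v)) = 0.
Proof.
by rewrite mulmxBr mulmxA GPi subrr dotpE mulmx0 mxE.
Qed.

Lemma dotp_complement v x :
  dotp (v - range_proj *m v) x = dotp v (x - range_proj *m x).
Proof.
by rewrite !dotpE linearB /= mulmxBl mulmxBr trmx_mul -/Pi PiT -(mulmxA v^T Pi x).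
Qed.

End whitening_matrix.

(** * Moments of the whitened vector *)

Section moments.
Context {R : realType} {d : nat} {disp0 : measure_display}.
Context {T0 : measurableType disp0} {P0 : probability T0 R}.
Variable X : {RV P0 >-> d.-tuple R}.
Hypothesis X2 : ('E_P0[fun w => (enorm (colv (X w)) ^+ 2)%R] < +oo)%E.

Let G := gram P0 X.

Lemma enorm_sqr (v : 'cV[R]_d) : enorm v ^+ 2 = dotp v v.
Proof. by rewrite sqr_sqrtr// dotpvv_ge0. Qed.

Lemma measurable_dotp_colv (v : 'cV[R]_d) :
  measurable_fun setT (fun x : d.-tuple R => dotp v (colv x)).
Proof.
apply: measurable_sum => j; under eq_fun do rewrite mxE.
by apply: measurable_funM => //; exact: measurable_tnth.
Qed.

Lemma dotp_sqr_sum (v x : 'cV[R]_d) :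
  dotp v x ^+ 2 = \sum_j \sum_k v j 0 * v k 0 * (x j 0 * x k 0).
Proof.
rewrite /dotp expr2 mulr_suml; apply: eq_bigr => j _; rewrite mulr_sumr.
by apply: eq_bigr => k _; ring.
Qed.

Lemma entry_product_le (x : 'cV[R]_d) j k : `|x j 0 * x k 0| <= dotp x x.
Proof.
have le1 i : x i 0 ^+ 2 <= dotp x x.
  rewrite /dotp (bigD1 i)//= -expr2 lerDl sumr_ge0// => l _.
  by rewrite -expr2 sqr_ge0.
have := le1 j; have := le1 k.
rewrite -(real_normK (num_real (x j 0))) -(real_normK (num_real (x k 0))) normrM.
have := sqr_ge0 (`|x j 0| - `|x k 0|); nra.
Qed.

Let mX (v : 'cV[R]_d) : measurable_fun setT (fun w => dotp v (colv (X w))).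
Proof. exact: (measurableT_comp (measurable_dotp_colv v)). Qed.

Let mXj j : measurable_fun setT (fun w => tnth (X w) j).
Proof. exact: (measurableT_comp (measurable_tnth j)). Qed.

Let norm_integrable : P0.-integrable setT (fun w => (dotp (colv (X w)) (colv (X w)))%:E).
Proof.
apply/integrableP; split.
  apply/measurable_EFinP; apply: measurable_sum => j.
  by under eq_fun do rewrite !mxE; exact: measurable_funM.
move: X2; rewrite unlock; apply: le_lt_trans; rewrite le_eqVlt; apply/predU1P; left.
by apply: eq_integral => w _; rewrite gee0_abs ?lee_fin ?dotpvv_ge0// enorm_sqr.
Qed.

Let entry_integrable j k :
  P0.-integrable setT (fun w => (tnth (X w) j * tnth (X w) k)%:E).
Proof.
apply: le_integrable norm_integrable => //.
  by apply/measurable_EFinP; exact: measurable_funM.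
move=> w _; rewrite !abse_EFin lee_fin [leRHS]ger0_norm ?dotpvv_ge0//.
by have := entry_product_le (colv (X w)) j k; rewrite !mxE.
Qed.

(** The products of two entries are dominated by [|X|^2], hence integrable, so the
expanded square can be integrated term by term. *)
Lemma quadN_gram (v : 'cV[R]_d) : quadN P0 X v = (dotp v (G *m v))%:E.
Proof.
rewrite /quadN unlock.
transitivity (\int[P0]_w (\sum_j \sum_k ((v j 0 * v k 0)%:E *
    (tnth (X w) j * tnth (X w) k)%:E)))%E.
  apply: eq_integral => w _; rewrite dotp_sqr_sum -sumEFin; apply: eq_bigr => j _.
  by rewrite -sumEFin; apply: eq_bigr => k _; rewrite EFinM !mxE.
rewrite integral_sum//; last first.
  by move=> j; apply: integrable_sum => // k _; exact: integrableZl.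
transitivity (\sum_j \sum_k ((v j 0 * v k 0) * G j k)%:E)%E.
  apply: eq_bigr => j _; rewrite integral_sum//; last by move=> k; exact: integrableZl.
  apply: eq_bigr => k _; rewrite integralZl// [RHS]EFinM; congr (_ * _)%E.
  by rewrite mxE unlock fineK// integrable_fin_num.
rewrite /dotp -sumEFin; apply: eq_bigr => j _.
by rewrite mxE mulr_sumr -sumEFin; apply: eq_bigr => k _; congr EFin; ring.
Qed.

Lemma gram_psd : psd G.
Proof.
split.
  by apply/matrixP => j k; rewrite !mxE; congr (fine (expectation _ _)); apply/funext => w; rewrite mulrC.
move=> v; rewrite -lee_fin -quadN_gram /quadN unlock.
by apply: integral_ge0 => w _; rewrite lee_fin sqr_ge0.
Qed.

Let S := pinv_sqrt G.

Lemma whitened_dotp (v : 'cV[R]_d) x :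
  dotp v (pinv_sqrt G *m colv x) = dotp (pinv_sqrt G *m v) (colv x).
Proof.
by rewrite dotp_mulmxr; congr dotp; congr (_ *m _); have [[]] := pinv_sqrtP gram_psd.
Qed.

Lemma measurable_whitened (v : 'cV[R]_d) :
  measurable_fun setT (fun x : d.-tuple R => dotp v (pinv_sqrt G *m colv x)).
Proof. by under eq_fun do rewrite whitened_dotp; exact: measurable_dotp_colv. Qed.

Lemma whitened_second_moment (v : 'cV[R]_d) :
  (\int[P0]_w (dotp v (pinv_sqrt G *m colv (X w)) ^+ 2)%:E
   = (dotp v (range_proj G *m v))%:E)%E.
Proof.
rewrite -(dotp_pinv_sqrt gram_psd) -quadN_gram /quadN unlock.
by under eq_integral do rewrite whitened_dotp.
Qed.

(** The directions orthogonal to the range of [G] have zero second moment. *)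
Lemma sample_in_range n disp (T : measurableType disp) (P : probability T R)
    (Xs : 'I_n -> {RV P >-> d.-tuple R}) : independent_copies Xs X ->
  exists U, [/\ measurable U, P U = 0%E & forall w, ~ U w -> forall j,
    range_proj G *m colv (Xs j w) = colv (Xs j w)].
Proof.
move=> copies; pose Pi := range_proj G.
pose e (j : 'I_d) : 'cV[R]_d := delta_mx j 0.
pose f (x : d.-tuple R) := \sum_j dotp (e j - Pi *m e j) (colv x) ^+ 2.
have mf : measurable_fun setT f.
  by apply: measurable_sum => j; apply: measurable_funX; exact: measurable_dotp_colv.
have f0 x : 0 <= f x by apply: sumr_ge0 => j _; rewrite sqr_ge0.
have Ef : (\int[P0]_w (f (X w))%:E = 0)%E.
  under eq_integral do rewrite -sumEFin.
  rewrite ge0_integral_sum//; last 2 first.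
  - by move=> j; apply/measurable_EFinP/measurable_funX.
  - by move=> j w _; rewrite lee_fin sqr_ge0.
  apply: big1 => j _.
  have := quadN_gram (e j - Pi *m e j); rewrite /quadN unlock => ->.
  by rewrite (gram_range_proj_complement gram_psd).
have [U [mU PU HU]] := expectation0_sample_null copies mf f0 Ef.
exists U; split => // w /HU fw j.
have /eqP := fw j; rewrite psumr_eq0; last by move=> i _; rewrite sqr_ge0.
move=> /allP h; apply/matrixP => i k; rewrite !ord1.
have := h i (mem_index_enum i); rewrite sqrf_eq0 (dotp_complement gram_psd) dotp_delta.
by rewrite !mxE subr_eq0 => /eqP ->.
Qed.

Variable kappa : R.
Hypothesis kappa0 : 0 <= kappa.
Hypothesis X4 : fourth_moment_bound P0 X kappa.

(** The hypothesis is homogeneous of degree four: it is applied to multiples of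
[v].  When [N v = 0] all multiples are admissible, and the fourth moment must
vanish. *)
Lemma fourth_moment_le (v : 'cV[R]_d) :
  (\int[P0]_w (dotp v (colv (X w)) ^+ 4)%:E <= (kappa * dotp v (G *m v) ^+ 2)%:E)%E.
Proof.
have scaled (t : R) : t ^+ 2 * dotp v (G *m v) <= 1 ->
    ((t ^+ 4)%:E * \int[P0]_w (dotp v (colv (X w)) ^+ 4)%:E <= kappa%:E)%E.
  move=> t1; have Nt : (quadN P0 X (t *: v) <= 1)%E.
    by rewrite quadN_gram lee_fin -scalemxAr dotpZl dotpZr mulrA -expr2.
  rewrite -ge0_integralZl_EFin//; last 3 first.
  - by move=> w _; rewrite lee_fin (exprM _ 2 2) sqr_ge0.
  - by apply/measurable_EFinP/measurable_funX.
  - by rewrite (exprM _ 2 2) sqr_ge0.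
  apply: le_trans X4; apply: ereal_sup_ubound; exists (t *: v) => //.
  by rewrite unlock; apply: eq_integral => w _; rewrite dotpZl exprMn EFinM.
set F := (\int[P0]_w _)%E in scaled *.
have F0 : (0 <= F)%E by apply: integral_ge0 => w _; rewrite lee_fin (exprM _ 2 2) sqr_ge0.
have N0 : 0 <= dotp v (G *m v) by have [_] := gram_psd; apply.
have [Nv0|Nv] := eqVneq (dotp v (G *m v)) 0.
  rewrite Nv0 expr0n/= mulr0.
  have Foo : F \is a fin_num.
    have /(_ 1) := scaled; rewrite Nv0 mulr0 expr1n mul1e => /(_ ler01) h.
    by rewrite ge0_fin_numE//; apply: le_lt_trans h _; rewrite ltry.
  have /fineK FE := Foo; rewrite -FE lee_fin; apply/ler_addgt0Pl => e e0.
  pose t := Num.sqrt (Num.sqrt ((kappa + 1) / e)).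
  have t4 : t ^+ 4 = (kappa + 1) / e.
    rewrite (exprM _ 2 2) sqr_sqrtr ?sqrtr_ge0// sqr_sqrtr//.
    by rewrite divr_ge0 ?addr_ge0// ltW.
  have /(_ t) := scaled; rewrite Nv0 mulr0 => /(_ ler01).
  rewrite t4 -FE -EFinM lee_fin mulrAC ler_pdivrMr// addr0 => h.
  have k1 : 0 < kappa + 1 by rewrite ltr_wpDl.
  rewrite -(ler_pM2l k1); apply: le_trans h _.
  by rewrite ler_wpM2r ?(ltW e0)// lerDl.
have Np : 0 < dotp v (G *m v) by rewrite lt_neqAle eq_sym Nv.
have := scaled (Num.sqrt (dotp v (G *m v))^-1).
rewrite (exprM _ 2 2) sqr_sqrtr ?invr_ge0// mulVf// => /(_ (lexx _)).
rewrite muleC -[X in (X <= _)%E -> _]/(_ * _)%E exprVn lee_pdivrMr ?exprn_gt0//.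
Qed.

End moments.

Section whitened_vector.
Context {R : realType} {d : nat} {disp0 : measure_display}.
Context {T0 : measurableType disp0} {P0 : probability T0 R}.
Variable X : {RV P0 >-> d.-tuple R}.
Hypothesis X2 : ('E_P0[fun w => (enorm (colv (X w)) ^+ 2)%R] < +oo)%E.
Variable kappa : R.
Hypothesis kappa0 : 0 <= kappa.
Hypothesis X4 : fourth_moment_bound P0 X kappa.

Let G := gram P0 X.

Definition white (x : d.-tuple R) : 'cV[R]_d := pinv_sqrt (gram P0 X) *m colv x.

Lemma measurable_dotp_white (v : 'cV[R]_d) :
  measurable_fun setT (fun x => dotp v (white x)).
Proof. exact: measurable_whitened. Qed.

Lemma white_fourth_moment (v : 'cV[R]_d) :
  (\int[P0]_w (dotp v (white (X w)) ^+ 4)%:E <= (kappa * dotp v v ^+ 2)%:E)%E.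
Proof.
under eq_integral do rewrite /white (whitened_dotp X2).
apply: le_trans (fourth_moment_le X2 kappa0 X4 _) _.
have psdG := gram_psd X2.
rewrite (dotp_pinv_sqrt psdG) lee_fin ler_wpM2l// lerXn2r ?nnegrE ?dotpvv_ge0//.
  by rewrite -(dotp_pinv_sqrt psdG); have [_] := psdG; apply.
exact: dotp_range_proj_le.
Qed.

(** Up to the factor [d], this dominates [|Y|^4]; its expectation needs the
fourth moments in the coordinate directions only. *)
Definition white_quartic (x : d.-tuple R) : R := \sum_(j < d) white x j 0 ^+ 4.

Lemma measurable_white_entry j : measurable_fun setT (fun x => white x j 0).
Proof. by under eq_fun do rewrite -dotp_delta; exact: measurable_dotp_white. Qed.

Lemma measurable_white_norm :
  measurable_fun setT (fun x => dotp (white x) (white x)).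
Proof.
by apply: measurable_sum => j; apply: measurable_funM; exact: measurable_white_entry.
Qed.

Let pow4_ge0 (x : R) : 0 <= x ^+ 4. Proof. by rewrite (exprM _ 2 2) sqr_ge0. Qed.

Lemma measurable_white_quartic : measurable_fun setT white_quartic.
Proof.
by apply: measurable_sum => j; apply: measurable_funX; exact: measurable_white_entry.
Qed.

Lemma white_quartic_ge0 x : 0 <= white_quartic x.
Proof. exact: sumr_ge0. Qed.

Lemma white_quartic_moment :
  (\int[P0]_w (white_quartic (X w))%:E <= (d%:R * kappa)%:E)%E.
Proof.
under eq_integral do rewrite -sumEFin.
have mj j : measurable_fun setT (fun w => (white (X w) j 0 ^+ 4)%:E).
  apply/measurable_EFinP/measurable_funX.
  exact: (measurableT_comp (measurable_white_entry j)).
rewrite ge0_integral_sum//; last by move=> j w _; rewrite lee_fin.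
have -> : d%:R * kappa = \sum_(j < d) kappa by rewrite sumr_const card_ord mulr_natl.
rewrite -sumEFin; apply: lee_sum => j _.
under eq_integral do rewrite -dotp_delta.
apply: le_trans (white_fourth_moment _) _.
by rewrite dotp_delta mxE !eqxx expr1n mulr1.
Qed.

Lemma white_norm_sqr_le x : dotp (white x) (white x) ^+ 2 <= d%:R * white_quartic x.
Proof.
rewrite /white_quartic; set y := white x.
have -> : d%:R * (\sum_j y j 0 ^+ 4) = \sum_(j < d) \sum_(k < d) (y j 0 ^+ 4 + y k 0 ^+ 4) / 2.
  under [RHS]eq_bigr do rewrite -mulr_suml big_split/= sumr_const card_ord.
  by rewrite -mulr_suml big_split/= sumr_const card_ord sumrMnl -mulr_natl; field.
rewrite expr2 mulr_suml; apply: ler_sum => j _; rewrite mulr_sumr; apply: ler_sum => k _.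
have := sqr_ge0 (y j 0 ^+ 2 - y k 0 ^+ 2); nra.
Qed.

Lemma white_norm_mul_le x (q : R) :
  dotp (white x) (white x) * q ^+ 2 <= (white_quartic x + d%:R * q ^+ 4) / 2.
Proof.
rewrite /white_quartic; set y := white x.
have -> : (\sum_j y j 0 ^+ 4 + d%:R * q ^+ 4) / 2 = \sum_(j < d) (y j 0 ^+ 4 + q ^+ 4) / 2.
  by rewrite -mulr_suml big_split/= sumr_const card_ord mulr_natl.
rewrite mulr_suml; apply: ler_sum => j _.
have := sqr_ge0 (y j 0 ^+ 2 - q ^+ 2); nra.
Qed.

(** The constants [c0] and [c1] may be negative: the nonnegative function
[p + r * q ^+ 2] is added to both sides before integrating, so that integrals of
nonnegative functions suffice. *)
Lemma expectation_le_quartic (u : 'cV[R]_d) (f : d.-tuple R -> R) (c0 c1 A B : R) :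
  dotp u u = 1 -> range_proj G *m u = u ->
  measurable_fun setT f -> (forall x, 0 <= f x) -> 0 <= A -> 0 <= B ->
  (forall x, f x <= c0 + c1 * dotp u (white x) ^+ 2 + A * dotp u (white x) ^+ 4
     + B * white_quartic x) ->
  (\int[P0]_w (f (X w))%:E <= (c0 + c1 + A * kappa + B * (d%:R * kappa))%:E)%E.
Proof.
move=> u1 Pu mf f0 A0 B0 fle.
pose q w := dotp u (white (X w)).
have mq : measurable_fun setT q by exact: (measurableT_comp (measurable_dotp_white u)).
have mfX : measurable_fun setT (fun w => f (X w)) by exact: measurableT_comp.
have mB : measurable_fun setT (fun w => white_quartic (X w)).
  exact: (measurableT_comp measurable_white_quartic).
have mq2 : measurable_fun setT (fun w => q w ^+ 2) by exact: measurable_funX.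
have mq4 : measurable_fun setT (fun w => q w ^+ 4) by exact: measurable_funX.
have Eq2 : (\int[P0]_w (q w ^+ 2)%:E = 1)%E.
  by rewrite (whitened_second_moment X2) Pu u1.
have Eq4 : (\int[P0]_w (q w ^+ 4)%:E <= kappa%:E)%E.
  by have := white_fourth_moment u; rewrite u1 expr1n mulr1.
pose p := `|c0|; pose r := `|c1|.
have p0 : 0 <= p by exact: normr_ge0.
have r0 : 0 <= r by exact: normr_ge0.
have cp : 0 <= c0 + p by rewrite -lerBlDl sub0r ler_normr lexx orbT.
have cr : 0 <= c1 + r by rewrite -lerBlDl sub0r ler_normr lexx orbT.
have Z (c : R) (g : T0 -> R) : 0 <= c -> measurable_fun setT g -> (forall w, 0 <= g w) ->
    (\int[P0]_w (c * g w)%:E = c%:E * \int[P0]_w (g w)%:E)%E.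
  move=> c_ge0 mg g0; under eq_integral do rewrite EFinM.
  by rewrite ge0_integralZl_EFin// => [w _|]; [rewrite lee_fin|exact/measurable_EFinP].
have D (g1 g2 : T0 -> R) : measurable_fun setT g1 -> measurable_fun setT g2 ->
    (forall w, 0 <= g1 w) -> (forall w, 0 <= g2 w) ->
    (\int[P0]_w (g1 w + g2 w)%:E = \int[P0]_w (g1 w)%:E + \int[P0]_w (g2 w)%:E)%E.
  move=> m1 m2 g10 g20; under eq_integral do rewrite EFinD.
  by rewrite ge0_integralD// => *; rewrite ?lee_fin//; exact/measurable_EFinP.
have qq2 w : 0 <= q w ^+ 2 by exact: sqr_ge0.
have lhs : (\int[P0]_w (f (X w) + (p + r * q w ^+ 2))%:E
   = \int[P0]_w (f (X w))%:E + (p + r)%:E)%E.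
  rewrite D//; last 2 first.
  - by apply: measurable_funD => //; apply: measurable_funM.
  - by move=> w; rewrite addr_ge0// mulr_ge0.
  rewrite D// ?Z//; last 2 first.
  - exact: measurable_funM.
  - by move=> w; rewrite mulr_ge0.
  by rewrite Eq2 mule1 integral_cst_probability.
have rhs : (\int[P0]_w ((c0 + p) + ((c1 + r) * q w ^+ 2 + (A * q w ^+ 4 + B * white_quartic (X w))))%:E
   <= (c0 + p + (c1 + r + (A * kappa + B * (d%:R * kappa))))%:E)%E.
  have m1 : measurable_fun setT (fun w => (c1 + r) * q w ^+ 2) by exact: measurable_funM.
  have m2 : measurable_fun setT (fun w => A * q w ^+ 4) by exact: measurable_funM.
  have m3 : measurable_fun setT (fun w => B * white_quartic (X w)) by exact: measurable_funM.
  have g1 w : 0 <= (c1 + r) * q w ^+ 2 by rewrite mulr_ge0.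
  have g2 w : 0 <= A * q w ^+ 4 by rewrite mulr_ge0.
  have g3 w : 0 <= B * white_quartic (X w) by rewrite mulr_ge0// white_quartic_ge0.
  rewrite D//; last 2 first.
  - by apply: measurable_funD => //; exact: measurable_funD.
  - by move=> w; rewrite !addr_ge0.
  rewrite integral_cst_probability D//; last 2 first.
  - exact: measurable_funD.
  - by move=> w; rewrite !addr_ge0.
  rewrite D// !Z//; last by move=> w; exact: white_quartic_ge0.
  rewrite Eq2 mule1 (EFinD (c0 + p)) (EFinD (c1 + r)) (EFinD (A * kappa)) !leeD2l//.
  by apply: leeD; rewrite EFinM lee_wpmul2l ?lee_fin// white_quartic_moment.
have step : (\int[P0]_w (f (X w))%:E + (p + r)%:E <=
    (c0 + p + (c1 + r + (A * kappa + B * (d%:R * kappa))))%:E)%E.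
  rewrite -lhs; apply: le_trans rhs; apply: ge0_le_integral => //.
  - by move=> w _; rewrite lee_fin addr_ge0// addr_ge0// mulr_ge0.
  - apply/measurable_EFinP; apply: measurable_funD => //; apply: measurable_funD => //.
    exact: measurable_funM.
  - apply/measurable_EFinP; do 3?(apply: measurable_funD => //); exact: measurable_funM.
  - by move=> w _; rewrite lee_fin; have := fle (X w); rewrite -/(q w); lra.
rewrite -(@leeD2rE _ (p + r)%:E)//; apply: le_trans step _.
by rewrite -EFinD lee_fin; lra.
Qed.

End whitened_vector.

(** * Uniform deviations of the truncated empirical mean *)

Section uniform_bound.
Context {R : realType} {d n : nat} {disp0 disp : measure_display}.
Context {T0 : measurableType disp0} {P0 : probability T0 R}.
Variable X : {RV P0 >-> d.-tuple R}.
Context {T : measurableType disp} {P : probability T R}.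
Variable Xs : 'I_n -> {RV P >-> d.-tuple R}.
Hypothesis copies : independent_copies Xs X.
Hypothesis X2 : ('E_P0[fun w => (enorm (colv (X w)) ^+ 2)%R] < +oo)%E.
Variable kappa : R.
Hypothesis kappa0 : 0 <= kappa.
Hypothesis X4 : fourth_moment_bound P0 X kappa.

Let G := gram P0 X.
Local Notation Y := (white X).

Lemma measurable_softened disp' (T' : measurableType disp') (sg lam : R)
    (s a b : T' -> R) :
  measurable_fun setT s -> measurable_fun setT a -> measurable_fun setT b ->
  measurable_fun setT (fun x => softened (s x) sg lam (a x) (b x)).
Proof.
move=> ms ma mb; rewrite /softened.
have mz : measurable_fun setT (fun x => sg * (a x * b x - lam)).
  by apply: measurable_funM => //; apply: measurable_funB => //; exact: measurable_funM.
apply: measurable_funD; last first.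
  by apply: measurable_funM => //; exact: measurable_funX.
apply: measurable_funD; last first.
  apply: measurable_funM; first exact: measurable_funM.
  by apply: measurable_funD; exact: measurable_funX.
apply: measurable_funD; first exact: measurable_funD.
by apply: measurable_funM => //; exact: measurable_funX.
Qed.

Lemma ge0_integrable_bounded (f : T0 -> R) (b : R) :
  measurable_fun setT f -> (forall w, 0 <= f w) ->
  (\int[P0]_w (f w)%:E <= b%:E)%E -> P0.-integrable setT (fun w => (f w)%:E).
Proof.
move=> mf f0 fb; apply/integrableP; split; first exact/measurable_EFinP.
under eq_integral do rewrite gee0_abs ?lee_fin//.
by apply: le_lt_trans fb _; rewrite ltry.
Qed.

Lemma softened_le (s sg lam a b : R) : sg ^+ 2 = 1 ->
  softened s sg lam a b
  <= (3 / 2 + 2 * lam ^+ 2) + 3 * a ^+ 4 + 3 * b ^+ 4 + 72 * s ^+ 2.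
Proof.
move=> sg2; rewrite /softened; set z := sg * _.
have z2 : z ^+ 2 = (a * b - lam) ^+ 2 by rewrite exprMn sg2 mul1r.
have := sqr_ge0 (z - 1); have := sqr_ge0 (a * b + lam).
have := sqr_ge0 (a ^+ 2 - b ^+ 2); have := sqr_ge0 (s - a ^+ 2).
have := sqr_ge0 (s - b ^+ 2); move: z2; rewrite !expr2 => z2; nra.
Qed.

(** Integrability is reduced to that of fourth powers by [softened_le]. *)
Lemma softened_expectation_fin (g1 g2 : 'cV[R]_d) (v sg lam : R) : sg ^+ 2 = 1 -> 0 <= v ->
  exists e : R, (\int[P0]_w (softened (v * dotp (Y (X w)) (Y (X w))) sg lam
     (dotp g1 (Y (X w))) (dotp g2 (Y (X w))))%:E = e%:E)%E.
Proof.
move=> sg2 v0.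
have mY g : measurable_fun setT (fun w => dotp g (Y (X w))).
  exact: (measurableT_comp (measurable_dotp_white X2 g)).
have pow4_ge0 (t : R) : 0 <= t ^+ 4 by rewrite (exprM _ 2 2) sqr_ge0.
have mN : measurable_fun setT (fun w => dotp (Y (X w)) (Y (X w))).
  exact: (measurableT_comp (measurable_white_norm X2)).
have i4 g : P0.-integrable setT (fun w => (dotp g (Y (X w)) ^+ 4)%:E).
  apply: ge0_integrable_bounded (white_fourth_moment X2 kappa0 X4 g) => //.
  exact: measurable_funX.
have iq : P0.-integrable setT (fun w => (white_quartic X (X w))%:E).
  apply: ge0_integrable_bounded (white_quartic_moment X2 kappa0 X4) => //.
  - exact: (measurableT_comp (measurable_white_quartic X2)).
  - by move=> w; exact: white_quartic_ge0.
have ic (c : R) : P0.-integrable setT (fun=> c%:E).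
  apply/integrableP; split => //; under eq_integral do rewrite abse_EFin.
  by rewrite integral_cst_probability ltry.
pose f w := softened (v * dotp (Y (X w)) (Y (X w))) sg lam
  (dotp g1 (Y (X w))) (dotp g2 (Y (X w))).
have mf : measurable_fun setT f.
  by apply: measurable_softened => //; exact: measurable_funM.
have f0 w : 0 <= f w.
  have s0 : 0 <= v * dotp (Y (X w)) (Y (X w)) by rewrite mulr_ge0 ?dotpvv_ge0.
  by apply: le_trans (softened_ge _ _ _ _ s0); lra.
suff : P0.-integrable setT (fun w => (f w)%:E).
  move=> /(integrable_fin_num measurableT) fin.
  by exists (fine (\int[P0]_w (f w)%:E)); rewrite fineK.
pose bound w := (((3 / 2 + 2 * lam ^+ 2)%:E + 3%:E * (dotp g1 (Y (X w)) ^+ 4)%:E)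
  + (3%:E * (dotp g2 (Y (X w)) ^+ 4)%:E
  + (72 * v ^+ 2 * d%:R)%:E * (white_quartic X (X w))%:E))%E.
have ib : P0.-integrable setT bound.
  by apply: integrableD => //; apply: integrableD => //; exact: integrableZl.
apply: le_integrable ib => //; first exact/measurable_EFinP.
move=> w _; rewrite gee0_abs ?lee_fin//.
apply: le_trans (ler_norm _); apply: le_trans (softened_le _ _ _ _ sg2) _.
have n2 := white_norm_sqr_le X (X w).
have v2 : 0 <= 72 * v ^+ 2 by rewrite mulr_ge0// sqr_ge0.
have := ler_wpM2l v2 n2; rewrite exprMn; lra.
Qed.

(** The direction [sqrt m *: u] is replaced by a random grid point: the sum of
truncated logarithms is at most the average of [\sum_j ln (W kl (Xs j))] over the
grid, which [log_moment_union_bound] controls at every grid point at once.  What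
is left is the average of [ew], evaluated with the moments of [Y], and the
average of the prior costs, [m / (2 * v) + 7 / 2 * d].  The parameter [v] is the
variance of the rounding in each direction. *)
Lemma uniform_log_trunc_bound (eps sg lam m v : R) :
  0 < eps -> sg ^+ 2 = 1 -> 0 <= m -> 0 < v ->
  exists U, [/\ measurable U, (P U <= eps%:E)%E & forall w, ~ U w ->
    forall u : 'cV[R]_d, dotp u u = 1 -> range_proj G *m u = u ->
    \sum_i log_trunc (sg * (m * dotp u (Y (Xs i w)) ^+ 2 - lam))
    <= n%:R * (sg * (m - lam) + ((kappa - 1) * m ^+ 2 + (m - lam) ^+ 2) / 2
               + 9 * kappa * d%:R * m * v + 153 / 2 * kappa * d%:R ^+ 2 * v ^+ 2)
       + ln eps^-1 + m / (2 * v) + 7 / 2 * d%:R].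
Proof.
move=> eps0 sg2 m0 v0.
(* Mesh of the grid: rounding to integers has variance at most [1 / 4]. *)
pose h := 2 * Num.sqrt v.
have h0 : 0 < h by rewrite mulr_gt0// sqrtr_gt0.
have h2 : h ^+ 2 = 4 * v by rewrite exprMn sqr_sqrtr ?(ltW v0)//; ring.
(* Large enough for the grid to contain the ball of radius [sqrt m]. *)
pose K := Num.bound (Num.sqrt m / h).
have KP : Num.sqrt m / h < K%:R.
  by apply: archi_boundP; rewrite divr_ge0 ?sqrtr_ge0// ltW.
pose I := (grid K d * grid K d)%type.
pose y (k : grid K d) (x : d.-tuple R) := h * \sum_j gridpt k j * Y x j 0.
pose s (x : d.-tuple R) := v * dotp (Y x) (Y x).
have s0 x : 0 <= s x by rewrite mulr_ge0 ?(ltW v0)// dotpvv_ge0.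
pose W (kl : I) x := softened (s x) sg lam (y kl.1 x) (y kl.2 x).
have W12 kl x : 1 / 2 <= W kl x by exact: softened_ge (s0 x).
have W0 kl x : 0 < W kl x by apply: lt_le_trans (W12 kl x); lra.
have my k : measurable_fun setT (y k).
  apply: measurable_funM => //; apply: measurable_sum => j; apply: measurable_funM => //.
  exact: measurable_white_entry.
have ms : measurable_fun setT s by apply: measurable_funM => //; exact: measurable_white_norm.
have mW kl : measurable_fun setT (W kl).
  exact: measurable_softened.
have yE k z : y k z = dotp (\col_j (h * gridpt k j)) (Y z).
  by rewrite /y /dotp mulr_sumr; apply: eq_bigr => j _; rewrite [X in _ = X * _]mxE mulrA.
have /choice[ew ewE] (kl : I) : exists e : R, (\int[P0]_w (W kl (X w))%:E = e%:E)%E.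
  rewrite /W /s; under eq_integral do rewrite !yE.
  exact: (softened_expectation_fin _ _ _ sg2 (ltW v0)).
have ew0 kl : 0 < ew kl.
  rewrite -lte_fin -ewE; apply: (@lt_le_trans _ _ (\int[P0]_w (1 / 2)%:E)%E).
    by rewrite integral_cst_probability lte_fin; lra.
  apply: ge0_le_integral => //.
  - by apply/measurable_EFinP; exact: measurableT_comp.
  - by move=> w _; rewrite lee_fin W12.
pose cost (kl : I) : R := grid_cost kl.1 + grid_cost kl.2.
have cost1 : \sum_kl expR (- cost kl) <= 1.
  rewrite -(pair_big predT predT (fun k l => expR (- (grid_cost k + grid_cost l)) : R))/=.
  under eq_bigr do under eq_bigr do rewrite opprD expRD.
  under eq_bigr do rewrite -mulr_sumr.
  rewrite -mulr_suml; have g0 : 0 <= \sum_(k : grid K d) expR (- grid_cost k) :> R.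
    by apply: sumr_ge0 => k _; exact: expR_ge0.
  have g1 := @grid_weight_sum R K d; nra.
have [U [mU PU HU]] := log_moment_union_bound copies eps0 mW W0 ewE ew0 cost1.
exists U; split => // w Uw u u1 Pu.
(* The point to be rounded, in grid units. *)
pose x j := Num.sqrt m * u j 0 / h.
have xK j : `|x j| < K%:R.
  apply: le_lt_trans KP; rewrite /x mulrAC normrM (ger0_norm (divr_ge0 (sqrtr_ge0 _) (ltW h0))).
  rewrite ler_piMr ?divr_ge0 ?sqrtr_ge0 ?(ltW h0)//.
  rewrite -(@ler_pXn2r _ 2) ?nnegrE// expr1n real_normK ?num_real//.
  rewrite -u1 /dotp (bigD1 j)//= -expr2 lerDl sumr_ge0// => l _.
  by rewrite -expr2 sqr_ge0.
have [r [r0 r1 rm rv]] := random_rounding xK.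
have sumx : \sum_j x j ^+ 2 = m / (4 * v).
  have E j : x j ^+ 2 = m / (4 * v) * (u j 0 * u j 0).
    by rewrite /x exprMn exprMn sqr_sqrtr// exprVn h2; ring.
  under eq_bigr do rewrite E.
  by rewrite -mulr_sumr -/(dotp u u) u1 mulr1.
have costr : \sum_k r k * grid_cost k <= m / (4 * v) + 7 / 4 * d%:R.
  by rewrite -sumx; exact: avg_grid_cost.
pose tau z := Num.sqrt m * dotp u (Y z).
have ytau k z : y k z - tau z = \sum_j (h * Y z j 0) * (gridpt k j - x j).
  rewrite /y /tau /dotp !mulr_sumr -sumrB; apply: eq_bigr => j _.
  by rewrite /x; field; rewrite gt_eqF.
have ym z : \sum_k r k * (y k z - tau z) = 0.
  by under eq_bigr do rewrite ytau; exact: rm.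
have yv z : \sum_k r k * (y k z - tau z) ^+ 2 <= s z.
  under eq_bigr do rewrite ytau.
  apply: le_trans (rv _) _; rewrite le_eqVlt; apply/predU1P; left.
  under eq_bigr do rewrite exprMn h2.
  rewrite -mulr_sumr /s /dotp; under eq_bigr do rewrite expr2.
  by field.
have tau2 z : tau z ^+ 2 = m * dotp u (Y z) ^+ 2 by rewrite /tau exprMn sqr_sqrtr.
pose avg (F : I -> R) := \sum_l r l * \sum_k r k * F (k, l).
have avgD F1 F2 : avg (fun kl => F1 kl + F2 kl) = avg F1 + avg F2.
  rewrite /avg -big_split; apply: eq_bigr => l _ /=; rewrite -mulrDr -big_split.
  by congr (_ * _); apply: eq_bigr => k _; rewrite mulrDr.
have avgZ c F : avg (fun kl => c * F kl) = c * avg F.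
  rewrite /avg mulr_sumr; apply: eq_bigr => l _; rewrite [RHS]mulrCA.
  by congr (_ * _); rewrite mulr_sumr; apply: eq_bigr => k _; rewrite mulrCA.
have avg1 : avg (fun=> 1) = 1.
  rewrite /avg; under eq_bigr do under eq_bigr do rewrite mulr1.
  by under eq_bigr do rewrite r1 mulr1.
have avg_le F1 F2 : (forall kl, F1 kl <= F2 kl) -> avg F1 <= avg F2.
  move=> F12; apply: ler_sum => l _; apply: ler_wpM2l => //; apply: ler_sum => k _.
  exact: ler_wpM2l.
have avg_sum (F : 'I_n -> I -> R) : avg (fun kl => \sum_j F j kl) = \sum_j avg (F j).
  rewrite /avg exchange_big; apply: eq_bigr => l _ /=; rewrite -mulr_sumr; congr (_ * _).
  by rewrite exchange_big; apply: eq_bigr => k _; rewrite mulr_sumr.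
have avg_cost : avg cost <= m / (2 * v) + 7 / 2 * d%:R.
  have -> : avg cost = 2 * \sum_k r k * grid_cost k.
    rewrite /avg /cost /=.
    under eq_bigr do under eq_bigr do rewrite mulrDr.
    under eq_bigr do rewrite big_split/= -mulr_suml r1 mul1r mulrDr.
    by rewrite big_split/= -mulr_suml r1 mul1r; ring.
  apply: le_trans (ler_wpM2l _ costr) _ => //.
  by rewrite le_eqVlt; apply/predU1P; left; field; rewrite gt_eqF.
(* The average is taken inside the expectation, where [avg_softened_le] applies. *)
have avg_ew : avg ew <= 1 + sg * (m - lam) + ((kappa - 1) * m ^+ 2 + (m - lam) ^+ 2) / 2
    + 9 * kappa * d%:R * m * v + 153 / 2 * kappa * d%:R ^+ 2 * v ^+ 2.
  have avgE : ((avg ew)%:E = \int[P0]_w (avg (fun kl => W kl (X w)))%:E)%E.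
    have mWX kl : measurable_fun setT (fun w => (W kl (X w))%:E).
      by apply/measurable_EFinP; exact: (measurableT_comp (mW kl)).
    transitivity (\int[P0]_w (\sum_l \sum_k (r l * r k)%:E * (W (k, l) (X w))%:E))%E.
      rewrite ge0_integral_sum//; last 2 first.
      - by move=> l; apply: emeasurable_sum => k; exact: measurable_funeM.
      - move=> l om _; apply: sume_ge0 => k _.
        by rewrite -EFinM lee_fin !mulr_ge0// ltW.
      rewrite /avg -sumEFin; apply: eq_bigr => l _.
      rewrite ge0_integral_sum//; last 2 first.
      - by move=> k; exact: measurable_funeM.
      - by move=> k om _; rewrite -EFinM lee_fin !mulr_ge0// ltW.
      rewrite mulr_sumr -sumEFin; apply: eq_bigr => k _.
      rewrite ge0_integralZl_EFin ?mulr_ge0//; first by rewrite ewE -EFinM mulrA.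
      by move=> om _; rewrite lee_fin ltW.
    apply: eq_integral => om _; rewrite /avg -sumEFin; apply: eq_bigr => l _.
    by rewrite mulr_sumr -sumEFin; apply: eq_bigr => k _; rewrite -EFinM mulrA.
  rewrite -lee_fin avgE.
  pose c0 := 1 - sg * lam + lam ^+ 2 / 2.
  pose c1 := (sg - lam) * m.
  pose A := m ^+ 2 / 2 + 9 / 2 * m * v * d%:R.
  pose B := 9 / 2 * m * v + 153 / 2 * v ^+ 2 * d%:R.
  have v0' := ltW v0.
  have A0 : 0 <= A by rewrite /A addr_ge0 ?mulr_ge0 ?sqr_ge0// divr_ge0.
  have B0 : 0 <= B by rewrite /B addr_ge0 ?mulr_ge0 ?sqr_ge0// divr_ge0.
  have -> : 1 + sg * (m - lam) + ((kappa - 1) * m ^+ 2 + (m - lam) ^+ 2) / 2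
    + 9 * kappa * d%:R * m * v + 153 / 2 * kappa * d%:R ^+ 2 * v ^+ 2 =
    c0 + c1 + A * kappa + B * (d%:R * kappa) by rewrite /c0 /c1 /A /B; field.
  apply: (expectation_le_quartic X2 kappa0 X4 u1 Pu (f := fun z => avg (fun kl => W kl z))) => //.
  - apply: measurable_sum => l; apply: measurable_funM => //.
    by apply: measurable_sum => k; apply: measurable_funM.
  - move=> z; apply: sumr_ge0 => l _; rewrite mulr_ge0// sumr_ge0// => k _.
    by rewrite mulr_ge0// ltW.
  - move=> z; apply: le_trans (avg_softened_le r0 r1 (ym z) (yv z) lam sg2) _.
    rewrite tau2; set q := dotp u (Y z).
    have n1 := white_norm_mul_le X z q.
    have n2 := white_norm_sqr_le X z.
    have c9 : 0 <= 9 * v * m by rewrite !mulr_ge0.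
    have c76 : 0 <= 153 / 2 * v ^+ 2 by rewrite mulr_ge0 ?sqr_ge0// divr_ge0.
    have := ler_wpM2l c9 n1; have := ler_wpM2l c76 n2.
    rewrite [(sg * _) ^+ 2]exprMn sg2 mul1r /s /c0 /c1 /A /B [(v * _) ^+ 2]exprMn.
    by lra.
have main : avg (fun kl => \sum_j ln (W kl (Xs j w)))
    <= avg (fun kl => n%:R * (ew kl - 1) + ln eps^-1 + cost kl).
  by apply: avg_le => kl; exact: HU.
apply: (@le_trans _ _ (avg (fun kl => \sum_j ln (W kl (Xs j w))))).
  rewrite avg_sum; apply: ler_sum => j _; rewrite -tau2.
  exact: (log_trunc_le_avg r0 r1 (ym _) (yv _) lam sg2).
apply: le_trans main _.
have -> : avg (fun kl => n%:R * (ew kl - 1) + ln eps^-1 + cost kl)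
   = n%:R * (avg ew - 1) + ln eps^-1 + avg cost.
  rewrite avgD; congr (_ + _).
  rewrite (_ : avg _ = avg (fun kl => n%:R * ew kl + (ln eps^-1 - n%:R) * 1)).
    by rewrite avgD !avgZ avg1; ring.
  by congr avg; apply/funext => kl; ring.
have nn : 0 <= n%:R :> R by [].
have avg_ew' : avg ew - 1 <= sg * (m - lam) + ((kappa - 1) * m ^+ 2 + (m - lam) ^+ 2) / 2
    + 9 * kappa * d%:R * m * v + 153 / 2 * kappa * d%:R ^+ 2 * v ^+ 2 by lra.
by have := ler_wpM2l nn avg_ew'; lra.
Qed.

End uniform_bound.

(** * Consequences of the sample size *)

Section scaled_inequalities.
Context {R : realFieldType}.
Variables (a q mu delta lam : R).
Hypothesis a0 : 0 <= a.
Hypothesis q0 : 0 <= q.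
Hypothesis delta0 : 0 <= delta.

(** [deviation_rhs] divided by [n * lam], at [m = lam * (1 + delta)], with
[a = (kappa - 1) * lam] and [q = sqrt (kappa * d / n)].  The relation
[delta * (1 - 2 * mu) = mu] replaces [- delta] by [- mu - 2 * mu * delta], which
absorbs the other terms. *)
Lemma scaled_lower : delta * (1 - 2 * mu) = mu -> (a + lam) / 2 <= 1 - 2 * mu ->
  a + 19 / 2 * q <= mu ->
  - delta + (a * (1 + delta) ^+ 2 + lam * delta ^+ 2) / 2
    + 59 / 10 * (1 + delta) * q + 707 / 200 * q + a / 2 <= 0.
Proof.
move=> dm mm ml.
have ml2 := ler_wpM2r delta0 ml.
have d2 : 0 <= delta ^+ 2 by exact: sqr_ge0.
have mm2 := ler_wpM2r d2 mm.
have dm2 : (1 - 2 * mu) * delta ^+ 2 = mu * delta by rewrite -{2}dm; ring.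
have qd : 0 <= q * delta by rewrite mulr_ge0.
have -> : - delta + (a * (1 + delta) ^+ 2 + lam * delta ^+ 2) / 2
    + 59 / 10 * (1 + delta) * q + 707 / 200 * q + a / 2 =
  - delta * (1 - 2 * mu) - 2 * (mu * delta) + a + a * delta
  + (a + lam) / 2 * delta ^+ 2 + 1887 / 200 * q + 59 / 10 * (q * delta) by field.
rewrite mulNr dm; rewrite dm2 in mm2; have q_0 := q0; have a_0 := a0.
move: ml2; rewrite mulrDl -[_ * q * delta]mulrA => ml2.
lra.
Qed.

(** The same computation at [m = lam * (1 - delta)]. *)
Lemma scaled_upper : delta <= 1 -> delta * (1 - 2 * mu) = mu ->
  (a + lam) / 2 <= 1 - 2 * mu -> 0 <= mu -> a + 19 / 2 * q <= mu ->
  - delta + (a * (1 - delta) ^+ 2 + lam * delta ^+ 2) / 2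
    + 59 / 10 * (1 - delta) * q + 707 / 200 * q + a / 2 <= 0.
Proof.
move=> d1 dm mm mu0 ml.
have d2 : 0 <= delta ^+ 2 by exact: sqr_ge0.
have mm2 := ler_wpM2r d2 mm.
have dm2 : (1 - 2 * mu) * delta ^+ 2 = mu * delta by rewrite -{2}dm; ring.
have qd : 0 <= q * delta by rewrite mulr_ge0.
have ad : 0 <= a * delta by rewrite mulr_ge0.
have md : 0 <= mu * delta by rewrite mulr_ge0.
have -> : - delta + (a * (1 - delta) ^+ 2 + lam * delta ^+ 2) / 2
    + 59 / 10 * (1 - delta) * q + 707 / 200 * q + a / 2 =
  - delta * (1 - 2 * mu) - 2 * (mu * delta) + a - a * delta
  + (a + lam) / 2 * delta ^+ 2 + 1887 / 200 * q - 59 / 10 * (q * delta) by field.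
rewrite mulNr dm; rewrite dm2 in mm2; have q_0 := q0; have a_0 := a0.
lra.
Qed.

End scaled_inequalities.

Section constants.
Context {R : realType}.
Variables (kappa eps : R) (d n : nat).
Hypothesis kappa1 : 1 < kappa.
Hypothesis conf0 : 0 <= conf eps d.
Hypothesis threshold : sample_threshold kappa eps d < n%:R.

Let c := conf eps d.

(** The value of [lam] that minimizes [(kappa - 1) * lam / 2 + c / (n * lam)], the
sum of the variance term and of the confidence term. *)
Definition trunc_level : R := Num.sqrt (2 * conf eps d / ((kappa - 1) * n%:R)).
Definition dim_rate : R := Num.sqrt (kappa * d%:R / n%:R).

Let lam := trunc_level.
Let q := dim_rate.
Let mu := mu kappa eps d n.
Let delta := delta_hat kappa eps d n.

Lemma sample_size_gt0 : 0 < n%:R :> R.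
Proof. by apply: le_lt_trans threshold; exact: sqr_ge0. Qed.

Let n0 : 0 < n%:R :> R := sample_size_gt0.
Let k1 : 0 < kappa - 1. Proof. by rewrite subr_gt0. Qed.
Let lam0 : 0 <= lam. Proof. exact: sqrtr_ge0. Qed.
Let q0 : 0 <= q. Proof. exact: sqrtr_ge0. Qed.

Lemma trunc_level_sqr : (kappa - 1) * lam ^+ 2 / 2 = c / n%:R.
Proof.
rewrite sqr_sqrtr; last by rewrite divr_ge0 ?mulr_ge0 ?(ltW k1).
by rewrite /c; field; rewrite !gt_eqF.
Qed.

Lemma sqrt_conf : Num.sqrt (2 * (kappa - 1) / n%:R * c) = (kappa - 1) * lam.
Proof.
rewrite -[X in X * lam](ger0_norm (ltW k1)) -sqrtr_sqr -sqrtrM ?sqr_ge0//.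
by congr Num.sqrt; rewrite /c; field; rewrite !gt_eqF.
Qed.

(** The hypothesis on [n], rewritten after division by [sqrt n]. *)
Lemma threshold_margin : 20 * q + (5 / 2) * ((kappa - 1) * lam) + lam / 2 < 1.
Proof.
pose sn := Num.sqrt n%:R : R.
have sn0 : 0 < sn by rewrite sqrtr_gt0.
have kd0 : 0 <= kappa * d%:R by rewrite mulr_ge0// ltW// (lt_trans _ kappa1).
have qE : q * sn = Num.sqrt (kappa * d%:R).
  rewrite -sqrtrM; last by rewrite divr_ge0.
  by rewrite divfK// gt_eqF.
have lE : (kappa - 1) * lam * sn = Num.sqrt (2 * (kappa - 1) * c).
  rewrite -sqrt_conf -sqrtrM; last by rewrite !mulr_ge0 ?invr_ge0 ?(ltW k1).
  by congr Num.sqrt; field; rewrite gt_eqF.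
set L := (X in X < 1).
have L0 : 0 <= L by rewrite /L !addr_ge0 ?mulr_ge0 ?(ltW k1)// divr_ge0.
have : (L * sn) ^+ 2 < n%:R.
  apply: le_lt_trans threshold; rewrite le_eqVlt; apply/predU1P; left.
  rewrite /sample_threshold -qE -/c -lE; congr (_ ^+ 2).
  by rewrite /L; field; rewrite gt_eqF.
rewrite exprMn sqr_sqrtr ?(ltW n0)// -[ltRHS]mul1r ltr_pM2r// => L1.
by rewrite -(@ltr_pXn2r _ 2) ?nnegrE// expr1n.
Qed.

(** Here [mu = (kappa - 1) * lam + 6.81 * sqrt 2 * q]. *)
Lemma mu_bounds : (kappa - 1) * lam + 19 / 2 * q <= mu <= (kappa - 1) * lam + 97 / 10 * q.
Proof.
have -> : mu = (kappa - 1) * lam + 681 / 100 * (Num.sqrt 2 * q).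
  rewrite /mu /Defs.mu -/c sqrt_conf -sqrtrM//.
  by congr (_ + _ * Num.sqrt _); rewrite !mulrA.
have s2 : 7 / 5 <= (Num.sqrt 2 : R) <= 71 / 50.
  have e : Num.sqrt 2 ^+ 2 = 2 :> R by rewrite sqr_sqrtr.
  have s0 : 0 <= Num.sqrt 2 :> R by exact: sqrtr_ge0.
  by apply/andP; split; rewrite -(@ler_pXn2r _ 2) ?nnegrE ?e//; lra.
have /andP[h1 h2] := s2.
have := ler_wpM2r q0 h1; have := ler_wpM2r q0 h2; lra.
Qed.

Let A0 := (kappa - 1) * lam.
Let A00 : 0 <= A0. Proof. by rewrite mulr_ge0// ltW. Qed.

Lemma mu_ge0 : 0 <= mu.
Proof. by have /andP[h _] := mu_bounds; apply: le_trans h; rewrite addr_ge0// mulr_ge0. Qed.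

Lemma mu_margin : (A0 + lam) / 2 <= 1 - 2 * mu.
Proof. have /andP[_ h] := mu_bounds; have := threshold_margin; have := q0; have := A00; have := lam0; rewrite /A0; lra. Qed.

Lemma mu_lt : 1 - 2 * mu >= 1 / 40.
Proof. have /andP[_ h] := mu_bounds; have := threshold_margin; have := q0; have := A00; have := lam0; rewrite /A0; lra. Qed.

Lemma delta_mul : delta * (1 - 2 * mu) = mu.
Proof. by rewrite /delta /delta_hat divfK// gt_eqF//; have := mu_lt; rewrite -/mu; lra. Qed.

Lemma delta_ge0 : 0 <= delta.
Proof. by rewrite divr_ge0 ?mu_ge0//; have := mu_lt; rewrite -/mu; lra. Qed.

Lemma gamma_minusE : gamma_minus kappa eps d n = lam ^+ 2 / 3.
Proof.
rewrite /gamma_minus sqr_sqrtr; last by rewrite divr_ge0 ?mulr_ge0 ?(ltW k1).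
by field; rewrite !gt_eqF.
Qed.

Lemma trunc_level_powR (p : R) :
  (2 * conf eps d / ((kappa - 1) * n%:R)) `^ (p / 2) = lam `^ p.
Proof.
rewrite [p / 2]mulrC powRrM powR12_sqrt//.
by rewrite divr_ge0 ?mulr_ge0 ?(ltW k1).
Qed.

Hypothesis eps1 : eps <= 1.
Hypothesis eps0 : 0 < eps.

(** The confidence term contains [0.73 * d], so terms of order [d / n] are
absorbed by [lam * q]. *)
Lemma dim_over_n_le : d%:R / n%:R <= lam * q.
Proof.
have cd : 73 / 100 * d%:R <= c.
  by rewrite /c /conf lerDr ln_ge0// invf_ge1.
have h0 : 0 <= lam * q by rewrite mulr_ge0.
have d0 : 0 <= d%:R / n%:R :> R by rewrite divr_ge0 ?(ltW n0).
rewrite -(@ler_pXn2r _ 2) ?nnegrE// [leRHS]exprMn.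
have -> : q ^+ 2 = kappa * (d%:R / n%:R).
  by rewrite sqr_sqrtr ?mulrA// divr_ge0 ?mulr_ge0// ?(ltW n0)// ltW// (lt_trans _ kappa1).
have -> : lam ^+ 2 = 2 * (c / n%:R) / (kappa - 1).
  by rewrite -trunc_level_sqr; field; rewrite gt_eqF.
have cn : 73 / 100 * (d%:R / n%:R) <= c / n%:R.
  by rewrite mulrA ler_wpM2r// invr_ge0 ltW.
rewrite mulrAC ler_pdivlMr// expr2.
set x := d%:R / n%:R in d0 cn *.
have : x * x * (kappa - 1) <= x * x * kappa by rewrite ler_wpM2l ?mulr_ge0//; lra.
have kx : 0 <= kappa * x by rewrite mulr_ge0// ltW// (lt_trans _ kappa1).
have := ler_wpM2r kx cn; nra.
Qed.

(** Of the order that balances the terms [9 * kappa * d * m * v * n] and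
[m / (2 * v)] of the uniform bound. *)
Definition rounding_var : R := (10 * Num.sqrt (kappa * d%:R * n%:R))^-1.

(** The right-hand side of [uniform_log_trunc_bound]. *)
Definition deviation_rhs (sg m v : R) : R :=
  n%:R * (sg * (m - lam) + ((kappa - 1) * m ^+ 2 + (m - lam) ^+ 2) / 2
               + 9 * kappa * d%:R * m * v + 153 / 2 * kappa * d%:R ^+ 2 * v ^+ 2)
       + ln eps^-1 + m / (2 * v) + 7 / 2 * d%:R.

Hypothesis d0 : (0 < d)%N.

Lemma rounding_var_gt0 : 0 < rounding_var.
Proof.
rewrite invr_gt0 mulr_gt0// sqrtr_gt0 !mulr_gt0 ?ltr0n//; first exact: lt_trans kappa1.
by rewrite -(ltr0n R).
Qed.

Lemma deviation_rhsE sg m :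
  deviation_rhs sg m rounding_var = n%:R *
    (sg * (m - lam) + ((kappa - 1) * m ^+ 2 + (m - lam) ^+ 2) / 2
     + 59 / 10 * m * q + 707 / 200 * (d%:R / n%:R) + (kappa - 1) * lam ^+ 2 / 2).
Proof.
have k0 : 0 < kappa by exact: lt_trans kappa1.
have dR0 : 0 < d%:R :> R by rewrite ltr0n.
have kdn0 : 0 < kappa * d%:R * n%:R by rewrite !mulr_gt0.
pose r := Num.sqrt (kappa * d%:R * n%:R).
have r0 : 0 < r by rewrite sqrtr_gt0.
have r2 : r ^+ 2 = kappa * d%:R * n%:R by rewrite sqr_sqrtr// ltW.
have qE : q = r / n%:R.
  apply/eqP; rewrite -(@eqrXn2 _ 2)// ?divr_ge0 ?(ltW r0) ?(ltW n0)//.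
  rewrite exprMn exprVn r2 sqr_sqrtr ?divr_ge0 ?mulr_ge0 ?(ltW k0) ?(ltW n0)//.
  by apply/eqP; field; rewrite gt_eqF.
have vE : rounding_var = (10 * r)^-1 by [].
have e1 : kappa * d%:R * rounding_var = q / 10.
  have -> : kappa * d%:R = r ^+ 2 / n%:R by rewrite r2 mulfK// gt_eqF.
  by rewrite vE qE; field; rewrite !gt_eqF.
have e2 : kappa * d%:R * rounding_var ^+ 2 = (100 * n%:R)^-1.
  have -> : kappa * d%:R = r ^+ 2 / n%:R by rewrite r2 mulfK// gt_eqF.
  by rewrite vE; field; rewrite !gt_eqF.
have e3 : (2 * rounding_var)^-1 = 5 * (q * n%:R).
  by rewrite vE qE; field; rewrite !gt_eqF.
have e4 : ln eps^-1 = n%:R * ((kappa - 1) * lam ^+ 2 / 2) - 73 / 100 * d%:R.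
  by rewrite trunc_level_sqr /c /conf; field; rewrite gt_eqF.
rewrite /deviation_rhs e4 e3.
have -> : 9 * kappa * d%:R * m * rounding_var = 9 * m * (kappa * d%:R * rounding_var) by ring.
have -> : 153 / 2 * kappa * d%:R ^+ 2 * rounding_var ^+ 2
    = 153 / 2 * d%:R * (kappa * d%:R * rounding_var ^+ 2) by ring.
rewrite e1 e2; field; rewrite gt_eqF//.
Qed.

Lemma deviation_rhs_lower : deviation_rhs (-1) (lam * (1 + delta)) rounding_var <= 0.
Proof.
rewrite deviation_rhsE; apply: mulr_ge0_le0; first exact: ltW.
apply: (@le_trans _ _ (lam * (- delta + (A0 * (1 + delta) ^+ 2 + lam * delta ^+ 2) / 2
    + 59 / 10 * (1 + delta) * q + 707 / 200 * q + A0 / 2))).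
  have := dim_over_n_le; rewrite /A0; lra.
apply: (mulr_ge0_le0 lam0).
have /andP[ml _] := mu_bounds.
exact: (scaled_lower A00 q0 delta_ge0 delta_mul mu_margin ml).
Qed.

Lemma deviation_rhs_upper : delta <= 1 ->
  deviation_rhs 1 (lam * (1 - delta)) rounding_var <= 0.
Proof.
move=> d1; rewrite deviation_rhsE; apply: mulr_ge0_le0; first exact: ltW.
apply: (@le_trans _ _ (lam * (- delta + (A0 * (1 - delta) ^+ 2 + lam * delta ^+ 2) / 2
    + 59 / 10 * (1 - delta) * q + 707 / 200 * q + A0 / 2))).
  have := dim_over_n_le; rewrite /A0; lra.
apply: (mulr_ge0_le0 lam0).
have /andP[ml _] := mu_bounds.
exact: (scaled_upper A00 q0 delta_ge0 d1 delta_mul mu_margin mu_ge0 ml).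
Qed.

End constants.

(** * From truncated sums to the empirical second moment *)

Section deterministic_step.
Context {R : realType} {d n : nat}.
Implicit Types (u y : 'cV[R]_d).

Lemma dotp_sqr_le u y : dotp u u = 1 -> dotp u y ^+ 2 <= dotp y y.
Proof.
move=> u1; have := dotpvv_ge0 (y - dotp u y *: u).
rewrite -scaleN1r !(dotpDl, dotpDr, dotpZl, dotpZr) u1 [dotp y u]dotpC; nra.
Qed.

Variables (Y : 'I_n -> 'cV[R]_d) (u : 'cV[R]_d) (lam delta : R).
Hypothesis lam0 : 0 < lam.
Hypothesis delta0 : 0 <= delta.
Hypothesis n0 : 0 < n%:R :> R.
Hypothesis u1 : dotp u u = 1.

Let rho : R := n%:R^-1 * \sum_i dotp u (Y i) ^+ 2.

Let sum_rho : \sum_i dotp u (Y i) ^+ 2 = n%:R * rho.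
Proof. by rewrite /rho mulVKf// gt_eqF. Qed.

Let sum_cst (c : R) : \sum_(i < n) c = n%:R * c.
Proof. by rewrite sumr_const card_ord mulr_natl. Qed.

(** The argument [lam - m * t] of the truncated logarithm is at most [lam], so
[log_trunc_ge] with [p = 2] loses at most [lam ^+ 3 / 3] per observation. *)
Lemma empirical_lower :
  \sum_i log_trunc (- 1 * (lam * (1 + delta) * dotp u (Y i) ^+ 2 - lam)) <= 0 ->
  1 - lam ^+ 2 / 3 <= (1 + delta) * rho.
Proof.
move=> H; have m0 : 0 <= lam * (1 + delta) by rewrite mulr_ge0 ?(ltW lam0)// addr_ge0.
have : \sum_i (lam - lam ^+ 3 / 3 - lam * (1 + delta) * dotp u (Y i) ^+ 2) <= 0.
  apply: le_trans H; apply: ler_sum => i _.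
  set t := dotp u (Y i) ^+ 2.
  have t0 : 0 <= lam * (1 + delta) * t by rewrite mulr_ge0 ?sqr_ge0.
  set z := - 1 * _; have z1 : z <= lam by rewrite /z; lra.
  apply: (@le_trans _ _ (z - lam ^+ 3 / 3)); first by rewrite /z; lra.
  apply: le_trans (log_trunc_ge (p := 2) z _); last by apply/andP; split; lra.
  have l0 := ltW lam0.
  have -> : lam ^+ 3 = lam `^ (2 + 1) by rewrite -powR_mulrn//; congr powR; ring.
  have -> : 2 + 1 = 3 :> R by ring.
  rewrite lerB// ler_wpM2r ?invr_ge0// ge0_ler_powR ?nnegrE//.
  - by rewrite le_max lexx orbT.
  - by rewrite ge_max z1.
rewrite sumrB -mulr_sumr sum_rho sum_cst.
have -> : n%:R * (lam - lam ^+ 3 / 3) - lam * (1 + delta) * (n%:R * rho) =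
  n%:R * lam * (1 - lam ^+ 2 / 3 - (1 + delta) * rho) by field.
rewrite pmulr_rle0 ?mulr_gt0//; lra.
Qed.

(** The positive part of [m * t - lam] is at most [lam * (1 + delta) * |Y|^2]. *)
Lemma empirical_upper p : 1 <= p <= 2 -> delta <= 1 ->
  \sum_i log_trunc (1 * (lam * (1 - delta) * dotp u (Y i) ^+ 2 - lam)) <= 0 ->
  (1 - delta) * rho <= 1 + (p + 1)^-1 * lam `^ p * (1 + delta) `^ (p + 1)
    * (n%:R^-1 * \sum_i enorm (Y i) `^ (2 * (p + 1))).
Proof.
move=> p12 d1 H; have /andP[p1 p2] := p12.
have p10 : 0 < p + 1 by lra.
have l0 := ltW lam0; have n0' := n0.
pose M := lam `^ (p + 1) * (1 + delta) `^ (p + 1) / (p + 1).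
have : \sum_i (lam * (1 - delta) * dotp u (Y i) ^+ 2 - lam - M * enorm (Y i) `^ (2 * (p + 1))) <= 0.
  apply: le_trans H; apply: ler_sum => i _; rewrite mul1r.
  set t := dotp u (Y i) ^+ 2; set z := _ - lam.
  apply: le_trans (log_trunc_ge z p12); rewrite lerB//.
  rewrite /M mulrAC ler_wpM2r ?invr_ge0 ?(ltW p10)//.
  have t0 : 0 <= t by exact: sqr_ge0.
  have tY : t <= enorm (Y i) ^+ 2 by rewrite enorm_sqr; exact: dotp_sqr_le.
  have e0 : 0 <= enorm (Y i) by exact: sqrtr_ge0.
  have dd : 0 <= 1 + delta by rewrite addr_ge0.
  rewrite powRrM powR_mulrn// -!powRM ?mulr_ge0 ?sqr_ge0//.
  apply: ge0_ler_powR; rewrite ?nnegrE ?mulr_ge0 ?sqr_ge0 ?(ltW p10)//.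
    by rewrite le_max lexx orbT.
  rewrite ge_max; apply/andP; split; last by rewrite !mulr_ge0 ?sqr_ge0.
  apply: (@le_trans _ _ (lam * (1 - delta) * t)); first by rewrite /z; lra.
  apply: ler_pM => //; first by rewrite mulr_ge0// subr_ge0.
  by rewrite ler_wpM2l//; have := delta0; lra.
rewrite !sumrB -!mulr_sumr sum_rho sum_cst.
set V := \sum_i enorm _ `^ _.
have lp : lam `^ (p + 1) = lam * lam `^ p.
  by rewrite -[X in X * _](powRr1 l0) -powRD 1?addrC// (gt_eqF lam0) implybT.
have -> : lam * (1 - delta) * (n%:R * rho) - n%:R * lam - M * V = n%:R * lam *
  ((1 - delta) * rho - (1 + (p + 1)^-1 * lam `^ p * (1 + delta) `^ (p + 1) * (n%:R^-1 * V))).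
  by rewrite /M lp; field; rewrite !gt_eqF.
rewrite pmulr_rle0 ?mulr_gt0//; lra.
Qed.

End deterministic_step.

(** * The exceptional events and the upper bound *)

Section exceptional_events.
Context {R : realType} {d n : nat} {disp0 disp : measure_display}.
Context {T0 : measurableType disp0} {P0 : probability T0 R}.
Variable X : {RV P0 >-> d.-tuple R}.
Context {T : measurableType disp} {P : probability T R}.
Variable Xs : 'I_n -> {RV P >-> d.-tuple R}.
Hypothesis copies : independent_copies Xs X.
Hypothesis X2 : ('E_P0[fun w => (enorm (colv (X w)) ^+ 2)%R] < +oo)%E.
Variable kappa : R.
Hypothesis kappa1 : 1 < kappa.
Hypothesis X4 : fourth_moment_bound P0 X kappa.

Let G := gram P0 X.
Local Notation Y := (white X).

(** In dimension [0] there is no unit vector, and the rounding variance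
degenerates. *)
Lemma one_sided_event (eps sg m : R) : 0 < eps -> sg ^+ 2 = 1 -> 0 <= m ->
  ((0 < d)%N -> deviation_rhs kappa eps d n sg m (rounding_var kappa d n) <= 0) ->
  ((0 < d)%N -> 0 < rounding_var kappa d n) ->
  exists U, [/\ measurable U, (P U <= eps%:E)%E & forall w, ~ U w ->
    forall u : 'cV[R]_d, dotp u u = 1 -> range_proj G *m u = u ->
    \sum_i log_trunc (sg * (m * dotp u (Y (Xs i w)) ^+ 2 - trunc_level kappa eps d n)) <= 0].
Proof.
move=> eps0 sg2 m0 rhs0 v0; have [d0|d0] := posnP d.
  exists set0; split => //; first by rewrite measure0 lee_fin ltW.
  move=> w _ u; rewrite /dotp big1 => [/eqP|[j jd]]; first by rewrite eq_sym oner_eq0.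
  by exfalso; rewrite d0 in jd.
have k0 : 0 <= kappa by apply: ltW; exact: lt_trans kappa1.
have [U [mU PU HU]] := uniform_log_trunc_bound copies X2 k0 X4
  (trunc_level kappa eps d n) eps0 sg2 m0 (v0 d0).
exists U; split => // w Uw u u1 Pu.
apply: le_trans (HU w Uw u u1 Pu) _; exact: rhs0.
Qed.

Lemma whitened_moment_ge0 r : (0 <= whitened_moment P0 X r)%E.
Proof. by rewrite /whitened_moment unlock; apply: integral_ge0 => w _; rewrite lee_fin powR_ge0. Qed.

Lemma measurable_white_enorm_powR (r : R) :
  measurable_fun setT (fun x => enorm (Y x) `^ r).
Proof.
have E x : enorm (Y x) `^ r = dotp (Y x) (Y x) `^ (2^-1 * r).
  by rewrite powRrM powR12_sqrt// dotpvv_ge0.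
under eq_fun do rewrite E.
apply: (measurableT_comp (measurable_powR (2^-1 * r))).
exact: measurable_white_norm.
Qed.

Lemma moment_event (eps p q : R) : (0 < n)%N -> 0 < eps -> 1 <= q <= 2 ->
  exists U, [/\ measurable U, (P U <= (2 * eps)%:E)%E & forall w, ~ U w ->
    ((n%:R^-1 * \sum_i enorm (Y (Xs i w)) `^ (2 * (p + 1)))%:E <=
      whitened_moment P0 X (2 * (p + 1))
      + (Cq q / (eps `^ q^-1 * n%:R `^ (1 - q^-1)))%:E
        * whitened_moment P0 X (2 * q * (p + 1)) `^ q^-1)%E].
Proof.
move=> n0 eps0 q12.
have [U [mU PU HU]] := empirical_mean_deviation copies n0 eps0 q12
  (measurable_white_enorm_powR (2 * (p + 1))) (fun x => powR_ge0 _ _).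
exists U; split => // w Uw; have := HU w Uw.
rewrite /whitened_moment; move=> /le_trans; apply.
rewrite le_eqVlt; apply/predU1P; left; congr (_ + _ * _ `^ _)%E; rewrite unlock//.
by apply: eq_integral => om _; rewrite -powRrM mulrAC.
Qed.

Lemma gamma_plus_ge0 (eps p q : R) : 1 <= p -> 1 <= q <= 2 -> 0 <= 1 + delta_hat kappa eps d n ->
  (0 <= gamma_plus P0 X kappa eps p q n)%E.
Proof.
move=> p1 q12 d0; rewrite /gamma_plus mule_ge0//.
  rewrite lee_fin !mulr_ge0 ?powR_ge0// invr_ge0; lra.
rewrite adde_ge0 ?whitened_moment_ge0// mule_ge0 ?poweR_ge0// lee_fin.
have C1 := Cq_ge1 q12.
by rewrite divr_ge0 ?mulr_ge0 ?powR_ge0//; lra.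
Qed.

Lemma upper_denomE (eps p q r : R) : gamma_plus P0 X kappa eps p q n = r%:E ->
  upper_denom P0 X kappa eps p q n = ((1 - delta_hat kappa eps d n) * Num.max (1 - r) 0)%:E.
Proof. by rewrite /upper_denom => ->; rewrite -EFinB -EFin_max -EFinM. Qed.

(** From [(1 - delta) * rho <= 1 + r] one gets
[rho <= ((1 - delta) * (1 - r))^-1] because [(1 + r) * (1 - r) <= 1]; the second
inequality is [1 - (1 - delta) * (1 - r) <= delta + r].  When the denominator
vanishes all bounds are [+oo]. *)
Lemma quot_upper (eps p q rho : R) :
  let delta := delta_hat kappa eps d n in
  0 <= delta -> delta <= 1 -> (0 <= gamma_plus P0 X kappa eps p q n)%E ->
  (forall r, gamma_plus P0 X kappa eps p q n = r%:E -> (1 - delta) * rho <= 1 + r) ->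
  (rho%:E - 1 <= quot 1 (upper_denom P0 X kappa eps p q n) - 1)%E /\
  (quot 1 (upper_denom P0 X kappa eps p q n) - 1
     <= upper_bound P0 X kappa eps p q n)%E.
Proof.
move=> delta delta0 delta1 g0 Hr.
have q1 (x : \bar R) : quot 1 x = (1 / x)%E by rewrite /quot eqe oner_eq0.
rewrite q1 /upper_bound.
case gE : (gamma_plus P0 X kappa eps p q n) => [r| |]; last by rewrite gE in g0.
  rewrite (upper_denomE gE); have {}Hr := Hr r gE.
  have r0 : 0 <= r by rewrite gE lee_fin in g0.
  set D := (1 - _) * _.
  have D0 : 0 <= D by rewrite mulr_ge0 ?subr_ge0// le_max lexx orbT.
  have [D00|Dn] := eqVneq D 0.
    rewrite D00 inver eqxx gt0_muley ?lte_fin// addye// leey; split => //.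
    rewrite /quot -EFinD eqe eqxx andbT.
    have dr : 0 < delta + r.
      rewrite lt_neqAle addr_ge0// andbT eq_sym; apply/eqP => dr.
      have d00 : delta = 0 by lra.
      have r00 : r = 0 by lra.
      move: D00; rewrite /D -/delta d00 r00 !subr0 mul1r => /eqP.
      by rewrite gt_eqF// lt_max ltr01.
    by rewrite (gt_eqF dr) inver eqxx gt0_muley.
  have {D0}D0 : 0 < D by rewrite lt_neqAle eq_sym Dn.
  have r1 : r < 1.
    rewrite ltNge; apply/negP => r1; move: Dn; rewrite /D max_r ?subr_le0// mulr0 eqxx //.
  have DE : D = (1 - delta) * (1 - r) by rewrite /D max_l// subr_ge0 ltW.
  rewrite inver (negbTE Dn) -EFinM -!EFinB !lee_fin mul1r; split.
    rewrite lerB// -[leRHS]mul1r ler_pdivlMr// DE.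
    have : rho * (1 - delta) * (1 - r) <= (1 + r) * (1 - r).
      by rewrite ler_wpM2r ?subr_ge0 ?(ltW r1)// mulrC.
    have := sqr_ge0 r; nra.
  rewrite /quot -EFinD !eqe (negbTE Dn) andbF inver (negbTE Dn) -EFinM lee_fin.
  rewrite ?mul1r (_ : D^-1 - 1 = (1 - D) / D); last by field.
  rewrite ler_wpM2r ?invr_ge0 ?(ltW D0)// DE.
  have : 0 <= delta * r by rewrite mulr_ge0.
  rewrite -/delta; lra.
have -> : upper_denom P0 X kappa eps p q n = 0%E.
  by rewrite /upper_denom gE /= max_r ?mule0// leNye.
rewrite inve0 gt0_muley ?lte_fin// addye// leey; split => //.
by rewrite /quot addey// inve0 mulyy.
Qed.

End exceptional_events.

(** * The uniform deviation bound *)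

Section deviation_bound.
Context {R : realType} {d n : nat} {disp0 disp : measure_display}.
Context {T0 : measurableType disp0} {P0 : probability T0 R}.
Variable X : {RV P0 >-> d.-tuple R}.
Context {T : measurableType disp} {P : probability T R}.
Variable Xs : 'I_n -> {RV P >-> d.-tuple R}.
Hypothesis copies : independent_copies Xs X.
Hypothesis X2 : ('E_P0[fun w => (enorm (colv (X w)) ^+ 2)%R] < +oo)%E.

Let G := gram P0 X.

Lemma dotp_eq0 (u : 'cV[R]_d) : dotp u u = 0 -> u = 0.
Proof.
move=> /eqP; rewrite /dotp psumr_eq0; last by move=> j _; rewrite -expr2 sqr_ge0.
move=> /allP h; apply/matrixP => j k; rewrite !ord1 mxE.
by have := h j (mem_index_enum j); rewrite mulf_eq0 orbb => /eqP.
Qed.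

(** The alternative [N theta = 0] forces [empN theta = 0], and the ratio is then
[1] by convention; otherwise [u] is the normalized [G ^ (1/2) theta]. *)
Lemma quot_normalized (theta : 'cV[R]_d) w :
  (0 < n)%N ->
  (forall j, range_proj G *m colv (Xs j w) = colv (Xs j w)) ->
  quot (empN Xs theta w)%:E (quadN P0 X theta) = 1%E \/
  exists u : 'cV[R]_d, [/\ dotp u u = 1, range_proj G *m u = u &
    quot (empN Xs theta w)%:E (quadN P0 X theta)
    = (n%:R^-1 * \sum_i dotp u (white X (Xs i w)) ^+ 2)%:E].
Proof.
move=> n0 inG; have psdG := gram_psd X2.
rewrite (quadN_gram X2) -/G -(whitened_direction_norm psdG); set v := whitened_direction G theta.
have dE i : dotp theta (colv (Xs i w)) = dotp v (white X (Xs i w)).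
  by rewrite /v /white (dotp_whitened_direction psdG)// inG.
have [N0|Nn] := eqVneq (dotp v v) 0.
  left; rewrite N0 (_ : empN Xs theta w = 0) ?/quot ?eqxx//.
  rewrite /empN big1 ?mulr0// => i _.
  by rewrite dE (dotp_eq0 N0) dotpE trmx0 mul0mx mxE expr0n/=.
have Np : 0 < dotp v v by rewrite lt_neqAle eq_sym Nn dotpvv_ge0.
right; pose u := (Num.sqrt (dotp v v))^-1 *: v.
have s0 : Num.sqrt (dotp v v) != 0 by rewrite gt_eqF// sqrtr_gt0.
have s2 : Num.sqrt (dotp v v) ^+ 2 = dotp v v by rewrite sqr_sqrtr// ltW.
exists u; split.
- by rewrite /u dotpZl dotpZr -{3}s2; field.
- by rewrite /u -scalemxAr (range_proj_whitened_direction psdG).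
rewrite /quot !eqe (negbTE Nn) andbF inver (negbTE Nn) -EFinM; congr (_%:E).
rewrite /empN -mulrA mulr_suml; congr (_ * _); apply: eq_bigr => i _.
by rewrite dE /u dotpZl exprMn exprVn s2 mulrC.
Qed.

Lemma prob_complement4 (U1 U2 U3 U4 : set T) (e : R) :
  measurable U1 -> measurable U2 -> measurable U3 -> measurable U4 ->
  (P U1 <= e%:E)%E -> (P U2 <= e%:E)%E -> (P U3 <= (2 * e)%:E)%E -> P U4 = 0%E ->
  measurable (~` (U1 `|` U2 `|` U3 `|` U4)) /\
  ((1 - 4 * e)%:E <= P (~` (U1 `|` U2 `|` U3 `|` U4)))%E.
Proof.
move=> m1 m2 m3 m4 P1 P2 P3 P4.
have m12 := measurableU _ _ m1 m2; have m123 := measurableU _ _ m12 m3.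
have mU := measurableU _ _ m123 m4.
split; first exact: measurableC.
rewrite probability_setC// EFinB; apply: leeB => //.
have P12 : (P (U1 `|` U2) <= (e + e)%:E)%E.
  by rewrite EFinD; exact: le_trans (measureU2 P m1 m2) (leeD P1 P2).
have P123 : (P (U1 `|` U2 `|` U3) <= (e + e + 2 * e)%:E)%E.
  by rewrite EFinD; exact: le_trans (measureU2 P m12 m3) (leeD P12 P3).
have P4' : (P U4 <= 0%:E)%E by rewrite P4.
have := le_trans (measureU2 P m123 m4) (leeD P123 P4').
by rewrite -EFinD (_ : e + e + 2 * e + 0 = 4 * e)//; ring.
Qed.

Variables (kappa eps p q : R).
Hypothesis kappa1 : 1 < kappa.
Hypothesis X4 : fourth_moment_bound P0 X kappa.
Hypothesis eps0 : 0 < eps.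
Hypothesis threshold : sample_threshold kappa eps d < n%:R.
Hypothesis p12 : 1 <= p <= 2.
Hypothesis q12 : 1 <= q <= 2.

Let delta := delta_hat kappa eps d n.
Let gamma_m := gamma_minus kappa eps d n.

(** The exceptional events are the two failures of the truncated sums, each of
probability [eps], the failure of the moment bound, of probability [2 * eps], and
the null event where the sample leaves the range of [G].  For [eps >= 1 / 4] the
empty event does; otherwise [conf eps d > 0], hence [lam > 0]. *)
Lemma uniform_deviation : exists A : set T,
  [/\ measurable A, ((1 - 4 * eps)%:E <= P A)%E &
    forall w, A w -> forall theta : 'cV[R]_d,
      let dev := (quot (empN Xs theta w)%:E (quadN P0 X theta) - 1)%E in
      ((- ((delta + gamma_m) / (1 + delta)))%:E <= dev)%E /\
      (delta <= 1 ->
        (dev <= quot 1 (upper_denom P0 X kappa eps p q n) - 1)%E /\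
        (quot 1 (upper_denom P0 X kappa eps p q n) - 1
           <= upper_bound P0 X kappa eps p q n)%E)].
Proof.
have [eps4|eps4] := leP (1 / 4) eps.
  exists set0; split => //; rewrite measure0 lee_fin; lra.
have eps1 : eps <= 1 by lra.
have c0 : 0 < conf eps d.
  rewrite /conf; apply: ltr_pwDl; last by rewrite mulr_ge0.
  by rewrite ln_gt0// invf_gt1//; lra.
have cge := ltW c0.
have nR0 : 0 < n%:R :> R := sample_size_gt0 threshold.
have n0 : (0 < n)%N by rewrite -(ltr0n R).
pose lam := trunc_level kappa eps d n.
have lam0 : 0 < lam.
  by rewrite sqrtr_gt0 divr_gt0 ?mulr_gt0 ?subr_gt0.
have delta0 : 0 <= delta := delta_ge0 kappa1 cge threshold.
have [U1 [mU1 PU1 H1]] : exists U, [/\ measurable U, (P U <= eps%:E)%E & forall w, ~ U w ->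
    forall u : 'cV[R]_d, dotp u u = 1 -> range_proj G *m u = u ->
    \sum_i log_trunc (-1 * (lam * (1 + delta) * dotp u (white X (Xs i w)) ^+ 2 - lam)) <= 0].
  apply: (one_sided_event copies X2 kappa1 X4 eps0); first by rewrite sqrrN expr1n.
  - by rewrite mulr_ge0 ?(ltW lam0)// addr_ge0.
  - by move=> d0; exact: deviation_rhs_lower.
  - by move=> d0; exact: rounding_var_gt0 kappa1 threshold d0.
have [U2 [mU2 PU2 H2]] : exists U, [/\ measurable U, (P U <= eps%:E)%E & forall w, ~ U w ->
    delta <= 1 -> forall u : 'cV[R]_d, dotp u u = 1 -> range_proj G *m u = u ->
    \sum_i log_trunc (1 * (lam * (1 - delta) * dotp u (white X (Xs i w)) ^+ 2 - lam)) <= 0].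
  have [d1|d1] := leP delta 1; last first.
    by exists set0; split => //; rewrite measure0 lee_fin ltW.
  have [U [mU PU HU]] : exists U, [/\ measurable U, (P U <= eps%:E)%E & forall w, ~ U w ->
    forall u : 'cV[R]_d, dotp u u = 1 -> range_proj G *m u = u ->
    \sum_i log_trunc (1 * (lam * (1 - delta) * dotp u (white X (Xs i w)) ^+ 2 - lam)) <= 0].
    apply: (one_sided_event copies X2 kappa1 X4 eps0); first by rewrite expr1n.
    - by rewrite mulr_ge0 ?(ltW lam0)// subr_ge0.
    - by move=> d0; exact: deviation_rhs_upper.
    - by move=> d0; exact: rounding_var_gt0 kappa1 threshold d0.
  by exists U; split => // w Uw _; exact: HU.
have [U3 [mU3 PU3 H3]] := moment_event copies X2 p n0 eps0 q12.
have [U4 [mU4 PU4 H4]] := sample_in_range X2 copies.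
have [mA PA] := prob_complement4 mU1 mU2 mU3 mU4 PU1 PU2 PU3 PU4.
exists (~` (U1 `|` U2 `|` U3 `|` U4)); split => // w Aw theta dev.
have nU1 : ~ U1 w by move=> h; apply: Aw; do 3!left.
have nU2 : ~ U2 w by move=> h; apply: Aw; left; left; right.
have nU3 : ~ U3 w by move=> h; apply: Aw; left; right.
have nU4 : ~ U4 w by move=> h; apply: Aw; right.
have gmE : gamma_m = lam ^+ 2 / 3 := gamma_minusE kappa1 cge threshold.
have d1p : 0 < 1 + delta by lra.
have [p1 p2] : 1 <= p /\ p <= 2 by apply/andP.
have g0 : (0 <= gamma_plus P0 X kappa eps p q n)%E.
  by apply: gamma_plus_ge0 => //; exact: ltW.
have [rho [rhoE low up]] : exists rho : R, [/\
    quot (empN Xs theta w)%:E (quadN P0 X theta) = rho%:E,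
    1 - lam ^+ 2 / 3 <= (1 + delta) * rho &
    delta <= 1 -> forall r, gamma_plus P0 X kappa eps p q n = r%:E -> (1 - delta) * rho <= 1 + r].
  have [->|[u [u1 Pu ->]]] := quot_normalized theta n0 (H4 w nU4).
    exists 1; split => //; first by have := sqr_ge0 lam; lra.
    by move=> d1 r gr; rewrite gr lee_fin in g0; lra.
  eexists; split; first reflexivity.
    exact: empirical_lower (H1 w nU1 u u1 Pu).
  move=> d1 r gr.
  apply: le_trans (empirical_upper lam0 delta0 nR0 u1 p12 d1 (H2 w nU2 d1 u u1 Pu)) _.
  rewrite lerD2l -lee_fin -gr /gamma_plus (trunc_level_powR n kappa1 cge) EFinM.
  apply: lee_wpmul2l; last exact: H3.
  by rewrite lee_fin !mulr_ge0 ?powR_ge0// invr_ge0; lra.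
rewrite /dev rhoE; split.
  rewrite -EFinB lee_fin gmE -(@ler_pM2l _ (1 + delta))//.
  rewrite mulrN mulrCA divff ?gt_eqF// mulr1; lra.
by move=> d1; apply: quot_upper => //; exact: up.
Qed.

End deviation_bound.

(** * Orders of magnitude *)

Section fixed_sample_size.
Context {R : realType}.
Variables (kappa eps : R) (d n : nat).
Hypothesis kappa1 : 1 < kappa.
Hypothesis conf0 : 0 <= conf eps d.
Hypothesis threshold : sample_threshold kappa eps d < n%:R.

Let lam := trunc_level kappa eps d n.
Let q := dim_rate kappa d n.
Let delta := delta_hat kappa eps d n.
Let n0 : 0 < n%:R :> R := sample_size_gt0 threshold.
Let lam0 : 0 <= lam. Proof. exact: sqrtr_ge0. Qed.

Lemma mu_le_delta : mu kappa eps d n <= delta.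
Proof.
have dm := delta_mul kappa1 conf0 threshold.
have d0 := delta_ge0 kappa1 conf0 threshold.
have m0 := mu_ge0 kappa1 threshold.
have dm0 : 0 <= delta * mu kappa eps d n by rewrite mulr_ge0.
rewrite -dm -/delta; apply: ler_piMr => //; lra.
Qed.

Lemma trunc_level_le_delta : (kappa - 1) * lam <= delta.
Proof.
have /andP[h _] := mu_bounds kappa1 threshold.
apply: le_trans mu_le_delta; apply: le_trans h.
by rewrite lerDl mulr_ge0// sqrtr_ge0.
Qed.

(** [gamma_minus = lam^2 / 3] is at most [2 / 3 * lam], and
[(kappa - 1) * lam <= delta]. *)
Lemma lower_bound_O (kappa0 : R) : 1 < kappa0 -> kappa0 <= kappa ->
  (delta + gamma_minus kappa eps d n) / (1 + delta)
  <= (1 + 2 / (3 * (kappa0 - 1))) * delta.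
Proof.
move=> k01 k0k; have d0 := delta_ge0 kappa1 conf0 threshold.
have d1 : 0 < 1 + delta by rewrite ltr_wpDr.
have q0 : 0 <= q := sqrtr_ge0 _.
have l0 := lam0.
have k0' : 0 < kappa0 - 1 by rewrite subr_gt0.
have kl : (kappa0 - 1) * lam <= delta.
  by apply: le_trans trunc_level_le_delta; rewrite ler_wpM2r// lerB.
have l2 : lam <= 2.
  have := threshold_margin kappa1 conf0 threshold; rewrite -/lam -/q.
  have : 0 <= (kappa - 1) * lam by rewrite mulr_ge0// subr_ge0 ltW.
  lra.
have gd : gamma_minus kappa eps d n <= 2 / (3 * (kappa0 - 1)) * delta.
  rewrite (gamma_minusE kappa1 conf0 threshold); apply: (@le_trans _ _ (2 / 3 * lam)).
    by rewrite expr2 mulrAC ler_wpM2r// ler_wpM2r// invr_ge0.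
  have -> : 2 / (3 * (kappa0 - 1)) * delta = 2 / 3 * (delta / (kappa0 - 1)).
    by field; rewrite gt_eqF.
  by rewrite ler_wpM2l ?divr_ge0// ler_pdivlMr// mulrC.
rewrite ler_pdivrMr//; apply: (@le_trans _ _ ((1 + 2 / (3 * (kappa0 - 1))) * delta)).
  by rewrite mulrDl mul1r lerD2l.
rewrite ler_peMr ?lerDl// mulr_ge0// addr_ge0// divr_ge0// mulr_ge0// ltW//.
Qed.

(** [delta <= 40 * mu], and both terms of [mu] are at most a constant times the
square root: its argument dominates [d] and [conf] because [conf] is nonnegative. *)
Lemma delta_O : delta <= 880 * Num.sqrt (kappa * (d%:R + ln eps^-1) / n%:R).
Proof.
set E := Num.sqrt _.
have k0 : 0 < kappa by exact: lt_trans kappa1.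
have nn : 0 <= n%:R :> R by [].
have cE : conf eps d = ln eps^-1 + 73 / 100 * d%:R by [].
have dR : 0 <= d%:R :> R by [].
have D0 : 0 <= d%:R + ln eps^-1.
  have := conf0; rewrite cE; lra.
have E0 : 0 <= E by exact: sqrtr_ge0.
have E2 : E ^+ 2 = kappa * (d%:R + ln eps^-1) / n%:R.
  by rewrite sqr_sqrtr// divr_ge0// mulr_ge0// ltW.
have q0 : 0 <= q := sqrtr_ge0 _.
have l0 := lam0.
have k1 : 0 <= kappa - 1 by rewrite subr_ge0 ltW.
have AE : (kappa - 1) * lam <= 2 * E.
  rewrite -(@ler_pXn2r _ 2) ?nnegrE ?mulr_ge0//.
  have -> : ((kappa - 1) * lam) ^+ 2 = 2 * (kappa - 1) * (conf eps d / n%:R).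
    by rewrite -(trunc_level_sqr kappa1 conf0 threshold) -/lam; field.
  rewrite exprMn E2 mulrA.
  have -> : 2 ^+ 2 * (kappa * (d%:R + ln eps^-1) / n%:R) =
     4 * (kappa * (d%:R + ln eps^-1)) / n%:R by field; rewrite gt_eqF.
  rewrite ler_wpM2r ?invr_ge0//.
  have c1 : conf eps d <= d%:R + ln eps^-1 by rewrite cE; lra.
  have := conf0 => c0.
  have h1 : (kappa - 1) * conf eps d <= kappa * (d%:R + ln eps^-1).
    by apply: ler_pM => //; lra.
  have h2 : 0 <= kappa * (d%:R + ln eps^-1) by rewrite mulr_ge0// ltW.
  lra.
have qE : q <= 2 * E.
  rewrite -(@ler_pXn2r _ 2) ?nnegrE ?mulr_ge0// exprMn E2.
  rewrite sqr_sqrtr; last by rewrite divr_ge0// mulr_ge0// ltW.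
  have -> : 2 ^+ 2 * (kappa * (d%:R + ln eps^-1) / n%:R) =
     kappa * (4 * (d%:R + ln eps^-1)) / n%:R by field; rewrite gt_eqF.
  rewrite ler_wpM2r ?invr_ge0// ler_wpM2l ?(ltW k0)//.
  have := conf0; rewrite cE; lra.
have /andP[_ muE] := mu_bounds kappa1 threshold.
have ml := mu_lt kappa1 conf0 threshold.
have d0 := delta_ge0 kappa1 conf0 threshold.
have dm := delta_mul kappa1 conf0 threshold.
have : delta * (1 / 40) <= mu kappa eps d n by rewrite -[leRHS]dm ler_wpM2l.
rewrite -/lam -/q in muE; lra.
Qed.

End fixed_sample_size.

Section large_samples.
Context {R : realType}.

Lemma limn_esup_le (u : (\bar R)^nat) (c : \bar R) (N : nat) :
  (forall n, (N <= n)%N -> (u n <= c)%E) -> (limn_esup u <= c)%E.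
Proof.
move=> uc; rewrite /limn_esup limf_esupE.
apply: (@le_trans _ _ (ereal_sup (u @` [set n | (N <= n)%N]))).
  by apply: ereal_inf_lbound; exists [set n | (N <= n)%N] => //; exact: nbhs_infty_ge.
by apply: ge_ereal_sup => _ [n Nn <-]; exact: uc.
Qed.

Lemma sqrt_div_small (a rho : R) : 0 <= a -> 0 < rho ->
  exists N, forall n, (N <= n)%N -> Num.sqrt (a / n%:R) <= rho.
Proof.
move=> a0 rho0; exists (Num.bound (a / rho ^+ 2)).+1 => n Nn.
have b0 : 0 <= a / rho ^+ 2 by rewrite divr_ge0 ?sqr_ge0.
have n0 : 0 < n%:R :> R by rewrite ltr0n; exact: leq_trans Nn.
have an : a / rho ^+ 2 <= n%:R.
  apply: le_trans (ltW (archi_boundP b0)) _.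
  by rewrite ler_nat; apply: leq_trans Nn.
rewrite -[leRHS](ger0_norm (ltW rho0)) -sqrtr_sqr ler_sqrt ?sqr_ge0//.
by rewrite ler_pdivrMr// mulrC -ler_pdivrMr ?exprn_gt0.
Qed.

Context {d : nat} {disp0 : measure_display}.
Context {T0 : measurableType disp0} {P0 : probability T0 R}.
Variable X : {RV P0 >-> d.-tuple R}.
Hypothesis X2 : ('E_P0[fun w => (enorm (colv (X w)) ^+ 2)%R] < +oo)%E.

Lemma whitened_moment_lty (r1 r2 : R) : 0 < r1 -> r1 <= r2 ->
  (whitened_moment P0 X r2 < +oo)%E -> (whitened_moment P0 X r1 < +oo)%E.
Proof.
move=> r10 r12; rewrite /whitened_moment unlock => h.
have me r : measurable_fun setT (fun w => enorm (pinv_sqrt (gram P0 X) *m colv (X w)) `^ r).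
  exact: (measurableT_comp (measurable_white_enorm_powR X2 r)).
apply: (@le_lt_trans _ _ (\int[P0]_w (1%:E + (enorm (pinv_sqrt (gram P0 X) *m colv (X w)) `^ r2)%:E))%E).
  apply: ge0_le_integral => //.
  - by move=> w _; rewrite lee_fin powR_ge0.
  - exact/measurable_EFinP.
  - by apply: emeasurable_funD => //; exact/measurable_EFinP.
  - move=> w _; rewrite -EFinD lee_fin; set e := enorm _.
    have e0 : 0 <= e by exact: sqrtr_ge0.
    have [e1|e1] := leP e 1.
      apply: (@le_trans _ _ (1 `^ r1)); last by rewrite powR1 lerDl powR_ge0.
      by rewrite ge0_ler_powR ?nnegrE// ltW.
    apply: (@le_trans _ _ (e `^ r2)); last by rewrite lerDr.
    by apply: ler_powR => //; exact: ltW.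
rewrite ge0_integralD//; last 2 first.
- by move=> w _; rewrite lee_fin powR_ge0.
- exact/measurable_EFinP.
by rewrite integral_cst_probability lte_add_pinfty// ltry.
Qed.

Variables (kappa eps p q : R).
Hypothesis kappa1 : 1 < kappa.
Hypothesis eps0 : 0 < eps.
Hypothesis conf0 : 0 <= conf eps d.
Hypothesis p12 : 1 < p <= 2.
Hypothesis q12 : 1 <= q <= 2.
Hypothesis moment : (whitened_moment P0 X (2 * q * (p + 1)) < +oo)%E.

(** The coefficients that depend on [n] are bounded, apart from [lam ^ p]. *)
Lemma gamma_plus_le : exists2 B : R, 0 <= B & forall n, (0 < n)%N ->
  0 <= delta_hat kappa eps d n <= 1 ->
  exists r : R, [/\ gamma_plus P0 X kappa eps p q n = r%:E, 0 <= r &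
    r <= B * trunc_level kappa eps d n `^ p].
Proof.
have /andP[p1 p2] := p12; have /andP[q1 q2] := q12.
have q0 : 0 < q by lra.
have p10 : 0 < p + 1 by lra.
have := moment; case ME : (whitened_moment P0 X (2 * q * (p + 1))) => [M| |]// _; last first.
  by have := whitened_moment_ge0 X (2 * q * (p + 1)); rewrite ME.
have : (whitened_moment P0 X (2 * (p + 1)) < +oo)%E.
  apply: whitened_moment_lty moment; first by rewrite mulr_gt0.
  by rewrite ler_wpM2r ?(ltW p10)// ler_peMr.
case EE : (whitened_moment P0 X (2 * (p + 1))) => [e| |]// _; last first.
  by have := whitened_moment_ge0 X (2 * (p + 1)); rewrite EE.
have e0 : 0 <= e by have := whitened_moment_ge0 X (2 * (p + 1)); rewrite EE lee_fin.
have C1 := Cq_ge1 q12.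
pose D := Cq q / eps `^ q^-1 * M `^ q^-1.
have D0 : 0 <= D by rewrite mulr_ge0 ?powR_ge0// divr_ge0 ?powR_ge0//; lra.
have eD : 0 <= e + D by rewrite addr_ge0.
exists (8 * (e + D)); first by rewrite mulr_ge0.
move=> n n0 /andP[d0 d1]; set lam := trunc_level _ _ _ _.
pose c := Cq q / (eps `^ q^-1 * n%:R `^ (1 - q^-1)).
have c0 : 0 <= c by rewrite divr_ge0 ?mulr_ge0 ?powR_ge0//; lra.
have cD : c * M `^ q^-1 <= D.
  rewrite ler_wpM2r ?powR_ge0// ler_wpM2l//; first by lra.
  rewrite lef_pV2 ?posrE ?mulr_gt0 ?powR_gt0 ?ltr0n//.
  rewrite ler_peMr ?powR_ge0//.
  rewrite -[leLHS](powRr0 n%:R); apply: ler_powR; first by rewrite ler1n.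
  by rewrite subr_ge0 invf_le1.
exists ((p + 1)^-1 * lam `^ p * (1 + delta_hat kappa eps d n) `^ (p + 1) * (e + c * M `^ q^-1)).
have cf0 : 0 <= (p + 1)^-1 * lam `^ p * (1 + delta_hat kappa eps d n) `^ (p + 1).
  by rewrite !mulr_ge0 ?powR_ge0// invr_ge0 ltW.
have cM0 : 0 <= c * M `^ q^-1 by rewrite mulr_ge0 ?powR_ge0.
split.
- by rewrite /gamma_plus (trunc_level_powR n kappa1 conf0) EE ME poweR_EFin -!EFinM.
- by rewrite mulr_ge0// addr_ge0.
have pw : (1 + delta_hat kappa eps d n) `^ (p + 1) <= 8.
  apply: (@le_trans _ _ (2 `^ (p + 1))).
    by rewrite ge0_ler_powR ?nnegrE ?(ltW p10)//; lra.
  apply: (@le_trans _ _ (2 `^ 3)); first by apply: ler_powR; lra.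
  by rewrite powR_mulrn// ; lra.
have ip : (p + 1)^-1 <= 1 by rewrite invf_le1//; lra.
have -> : 8 * (e + D) * lam `^ p = 1 * lam `^ p * 8 * (e + D) by ring.
apply: ler_pM => //; first by rewrite addr_ge0.
  apply: ler_pM => //; rewrite ?powR_ge0 ?mulr_ge0 ?powR_ge0 ?invr_ge0 ?(ltW p10)//.
  by rewrite ler_wpM2r ?powR_ge0.
by rewrite lerD2l.
Qed.

Lemma eventually_small (rho : R) : 0 < rho -> exists N, forall n, (N <= n)%N ->
  [/\ sample_threshold kappa eps d < n%:R, trunc_level kappa eps d n <= rho
    & dim_rate kappa d n <= rho].
Proof.
move=> rho0; have k1 : 0 < kappa - 1 by rewrite subr_gt0.
have [|N1 H1] := @sqrt_div_small (2 * conf eps d / (kappa - 1)) rho _ rho0.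
  by rewrite divr_ge0 ?mulr_ge0 ?(ltW k1).
have [|N2 H2] := @sqrt_div_small (kappa * d%:R) rho _ rho0.
  by rewrite mulr_ge0// ltW// (lt_trans _ kappa1).
have t0 : 0 <= sample_threshold kappa eps d by exact: sqr_ge0.
exists (maxn (Num.bound (sample_threshold kappa eps d)) (maxn N1 N2)) => n.
rewrite !geq_max => /and3P[n1 n2 n3]; split.
- by apply: lt_le_trans (archi_boundP t0) _; rewrite ler_nat.
- by rewrite /trunc_level invfM mulrA; exact: H1.
- exact: H2.
Qed.

(** Since [p > 1], [B * lam ^ p <= (kappa - 1) * lam <= delta] once [lam] is small,
so [gamma_plus <= delta] eventually; the numerator is then at most [2 * delta] and
the denominator at least [9 / 16]. *)
Lemma upper_bound_O :
  (limn_esup (fun n => quot (upper_bound P0 X kappa eps p q n)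
                            (delta_hat kappa eps d n)%:E) <= 4%:E)%E.
Proof.
have /andP[p1 p2] := p12; have [B B0 HB] := gamma_plus_le.
have k1 : 0 < kappa - 1 by rewrite subr_gt0.
pose eta := (kappa - 1) / (B + 1).
have B1 : 0 < B + 1 by rewrite ltr_wpDl.
have eta0 : 0 < eta by rewrite divr_gt0.
pose rho := Num.min (Num.min (200 * kappa)^-1 (eta `^ (p - 1)^-1)) (1 / 200).
have k0 : 0 < kappa by exact: lt_trans kappa1.
have rho0 : 0 < rho by rewrite !lt_min powR_gt0// invr_gt0 mulr_gt0//= divr_gt0.
have [N HN] := eventually_small rho0.
apply: (@limn_esup_le _ _ N) => n /HN[thr lamrho qrho].
have nR0 := sample_size_gt0 thr.
have n0 : (0 < n)%N by rewrite -(ltr0n R).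
have d0 := delta_ge0 kappa1 conf0 thr.
have dm := delta_mul kappa1 conf0 thr.
have /andP[_ muE] := mu_bounds kappa1 thr.
have m0 := mu_ge0 kappa1 thr.
have kl := trunc_level_le_delta kappa1 conf0 thr.
move: d0 dm muE m0 kl lamrho qrho; set lam := trunc_level _ _ _ _.
set delta := delta_hat _ _ _ _; set m := mu _ _ _ _; set dr := dim_rate _ _ _.
move=> d0 dm muE m0 kl lamrho qrho.
have lam0 : 0 <= lam by exact: sqrtr_ge0.
have lr1 : (kappa - 1) * lam <= 1 / 200.
  have : lam <= (200 * kappa)^-1 by apply: le_trans lamrho _; rewrite !ge_min lexx.
  move=> /(ler_wpM2l (ltW k1)) /le_trans; apply.
  rewrite -[(kappa - 1) / _]/((kappa - 1) * (200 * kappa)^-1) ler_pdivrMr ?mulr_gt0//.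
  have -> : 1 / 200 * (200 * kappa) = kappa by field.
  lra.
have lr2 : lam <= eta `^ (p - 1)^-1 by apply: le_trans lamrho _; rewrite !ge_min lexx orbT.
have qr : dr <= 1 / 200 by apply: le_trans qrho _; rewrite !ge_min lexx orbT.
have m10 : m <= 1 / 10 by lra.
have d4 : delta <= 1 / 4.
  have : delta * (8 / 10) <= delta * (1 - 2 * m) by rewrite ler_wpM2l//; lra.
  rewrite dm; lra.
have [r [gE r0 rB]] : exists r : R, [/\ gamma_plus P0 X kappa eps p q n = r%:E, 0 <= r &
    r <= B * lam `^ p].
  by apply: HB => //; rewrite -/delta d0/=; lra.
have rd : r <= delta.
  apply: le_trans rB _; have [->|lamn] := eqVneq lam 0.
    by rewrite powR0 ?mulr0// gt_eqF//; lra.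
  have lp : 0 < lam by rewrite lt_neqAle eq_sym lamn.
  apply: le_trans kl.
  have -> : lam `^ p = lam `^ (p - 1) * lam.
    by rewrite mulrC mulr_powRB1//; lra.
  rewrite mulrA ler_wpM2r//.
  have : lam `^ (p - 1) <= eta.
    have -> : eta = (eta `^ (p - 1)^-1) `^ (p - 1).
      rewrite -powRrM mulVf ?powRr1 ?(ltW eta0)// gt_eqF//; lra.
    by rewrite ge0_ler_powR ?nnegrE ?powR_ge0//; lra.
  move=> /(ler_wpM2l B0) /le_trans; apply.
  rewrite /eta mulrCA ler_piMr ?(ltW k1)// ler_pdivrMr//; lra.
rewrite /upper_bound gE (upper_denomE gE) -/delta max_l; last by lra.
have Dp : 9 / 16 <= (1 - delta) * (1 - r).
  have -> : 9 / 16 = 3 / 4 * (3 / 4) :> R by field.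
  by apply: ler_pM => //; lra.
set D := (1 - delta) * (1 - r) in Dp *.
have D0 : D != 0 by rewrite gt_eqF//; lra.
have Dpos : 0 < D by lra.
rewrite {2}/quot -EFinD !eqe (negbTE D0) andbF inver (negbTE D0) -EFinM.
rewrite /quot !eqe; have [dd|dn] := eqVneq delta 0.
  have -> : r = 0 by lra.
  by rewrite dd addr0 mul0r eqxx lee_fin ler1n.
rewrite andbF inver (negbTE dn) -EFinM lee_fin.
have dp : 0 < delta by rewrite lt_neqAle eq_sym dn.
rewrite ler_pdivrMr// ler_pdivrMr//.
have : 4 * delta * (9 / 16) <= 4 * delta * D by rewrite ler_wpM2l// mulr_ge0.
lra.
Qed.

End large_samples.

(** * The theorem *)

Theorem proposition2p6 (R : realType) :
  (* For delta > 1 the upper bounds would be negative numbers below - 1, hence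
     the guard delta <= 1; the lower bound needs no guard. *)
  (forall (d n : nat) (disp0 disp : measure_display)
     (T0 : measurableType disp0) (P0 : probability T0 R)
     (X : {RV P0 >-> d.-tuple R})
     (T : measurableType disp) (P : probability T R)
     (Xs : 'I_n -> {RV P >-> d.-tuple R})
     (kappa eps p q : R),
     independent_copies Xs X ->
     ('E_P0[fun w => (enorm (colv (X w)) ^+ 2)%R] < +oo)%E ->
     1 < kappa -> fourth_moment_bound P0 X kappa ->
     0 < eps -> sample_threshold kappa eps d < n%:R ->
     1 <= p <= 2 -> 1 <= q <= 2 ->
     let delta := delta_hat kappa eps d n in
     let gamma_m := gamma_minus kappa eps d n in
     exists A : set T,
       [/\ measurable A, ((1 - 4 * eps)%:E <= P A)%E &
         forall w, A w -> forall theta : 'cV[R]_d,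
           let dev := (quot (empN Xs theta w)%:E (quadN P0 X theta) - 1)%E in
           ((- ((delta + gamma_m) / (1 + delta)))%:E <= dev)%E /\
           (delta <= 1 ->
             (dev <= quot 1 (upper_denom P0 X kappa eps p q n) - 1)%E /\
             (quot 1 (upper_denom P0 X kappa eps p q n) - 1
                <= upper_bound P0 X kappa eps p q n)%E)]) /\
  (* (delta + gamma_-) / (1 + delta) = O(delta), uniformly for kappa away
     from 1: the ratio to delta is unbounded as kappa tends to 1. *)
  (forall kappa0 : R, 1 < kappa0 ->
     exists c : R, forall (kappa eps : R) (d n : nat),
       kappa0 <= kappa -> 0 < eps -> 0 <= conf eps d ->
       sample_threshold kappa eps d < n%:R ->
       (delta_hat kappa eps d n + gamma_minus kappa eps d n)
         / (1 + delta_hat kappa eps d n) <= c * delta_hat kappa eps d n) /\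
  (* the upper bound is O_{n -> oo}(delta) when p > 1 *)
  (exists c : R,
     forall (d : nat) (disp0 : measure_display)
       (T0 : measurableType disp0) (P0 : probability T0 R)
       (X : {RV P0 >-> d.-tuple R}) (kappa eps p q : R),
       ('E_P0[fun w => (enorm (colv (X w)) ^+ 2)%R] < +oo)%E ->
       1 < kappa -> fourth_moment_bound P0 X kappa ->
       0 < eps -> 0 <= conf eps d ->
       1 < p <= 2 -> 1 <= q <= 2 ->
       (whitened_moment P0 X (2 * q * (p + 1)) < +oo)%E ->
       (limn_esup (fun n => quot (upper_bound P0 X kappa eps p q n)
                                 (delta_hat kappa eps d n)%:E) <= c%:E)%E) /\
  (* delta = O(sqrt(kappa (d + log(1/eps)) / n)) *)
  (exists c : R, forall (kappa eps : R) (d n : nat),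
     1 < kappa -> 0 < eps -> 0 <= conf eps d ->
     sample_threshold kappa eps d < n%:R ->
     delta_hat kappa eps d n
       <= c * Num.sqrt (kappa * (d%:R + ln eps^-1) / n%:R)).
Proof.
split; last split; last split.
- move=> d n disp0 disp T0 P0 X T P Xs kappa eps p q copies X2 kappa1 X4 eps0.
  move=> threshold p12 q12 delta gamma_m.
  exact: (uniform_deviation copies X2 kappa1 X4 eps0 threshold p12 q12).
- move=> kappa0 kappa01; exists (1 + 2 / (3 * (kappa0 - 1))).
  move=> kappa eps d n k0k eps0 conf0 threshold.
  by apply: lower_bound_O => //; exact: lt_le_trans k0k.
- exists 4 => d disp0 T0 P0 X kappa eps p q X2 kappa1 _ eps0 conf0 p12 q12 moment.
  exact: upper_bound_O.
- exists 880 => kappa eps d n kappa1 eps0 conf0 threshold.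
  exact: delta_O.
Qed.
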